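(* Let $K\in C(\mathbb{S}^2\times\mathbb{S}^2)$, let $h$ be weakly singular and satisfy $t\mapsto h(\sqrt{2(1-t)})\in L^1(-1,1)\cap L^2(-1,1)$, and assume that the homogeneous equation $\varphi-A\varphi=0$ has only the trivial solution in $C(\mathbb{S}^2)$. Then there exist an integer $N$, a number $\eta_0>0$, and positive constants $C_1(m,n,\eta)$, $C_2(m,n,\eta)$, each decreasing as $n$ grows or $\eta$ decreases, such that for every $\gamma=(m,n,\eta)\in\Gamma$ with $n\ge N$ and $\eta\le\eta_0$ and every $f\in C(\mathbb{S}^2)$ the following holds. The two-stage scheme (first solve the linear system $$\varphi_\gamma(x_i)-\sum_{j=1}^m W_j(x_i)K(x_i,x_j)\varphi_\gamma(x_j)=f(x_i),\quad i=1,\dots,m,$$ then set $\varphi_\gamma(t)=f(t)+\sum_{j=1}^m W_j(t)K(t,x_j)\varphi_\gamma(x_j)$ for all $t\in\mathbb{S}^2$) computes a function $\varphi_\gamma\in C(\mathbb{S}^2)$ satisfying $$\|\varphi_\gamma\|_{L^\infty}\le C_1(m,n,\eta)\,\|f\|_{L^\infty}.$$ Moreover, with $\varphi\in C(\mathbb{S}^2)$ the unique solution of $\varphi-A\varphi=f$, there exists $x_0\in\mathbb{S}^2$ such that $$\|\varphi_\gamma-\varphi\|_{L^\infty}\le C_2(m,n,\eta)\left(E_n\big(K(x_0,\cdot)\varphi\big)+\sqrt{\eta^2+4\eta}\,\|\chi^*\|_{L^2}\right),$$ where $\chi^*\in\mathbb{P}_n$ is the best approximation polynomial of $K(x_0,\cdot)\varphi(\cdot)$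 in $\mathbb{P}_n$. In other words, $\varphi_\gamma$ converges uniformly to $\varphi$ as $n\to\infty$ and $\eta\to0$ simultaneously (that is, for each $\varepsilon>0$ there are $N'$ and $\delta>0$ such that $\|\varphi_\gamma-\varphi\|_{L^\infty}<\varepsilon$ for all $\gamma=(m,n,\eta)\in\Gamma$ with $n\ge N'$ and $\eta\le\delta$).
   Context: $\mathbb{S}^2=\{x\in\mathbb{R}^3:\|x\|_2=1\}$ with surface measure $d\omega$; $|x-y|=\sqrt{2(1-x\cdot y)}$ is the Euclidean distance. $C(\mathbb{S}^2)$ is the space of real continuous functions with norm $\|g\|_{L^\infty}=\max_{x\in\mathbb{S}^2}|g(x)|$; $\|\cdot\|_{L^2}$ is the norm of $L^2(\mathbb{S}^2,d\omega)$. $\{Y_{\ell,k}: \ell\ge0,\ 1\le k\le 2\ell+1\}$ is an $L^2$-orthonormal system of real spherical harmonics ($Y_{\ell,k}$ of degree $\ell$), and $\mathbb{P}_n$ is the span of those of degree at most $n$. For $g\in C(\mathbb{S}^2)$, $E_n(g)=\min_{\chi\in\mathbb{P}_n}\|g-\chi\|_{L^\infty}$, and a best approximation polynomial of $g$ in $\mathbb{P}_n$ is $\chi^*\in\mathbb{P}_n$ with $\|g-\chi^*\|_{L^\infty}=E_n(g)$. Kernel: $h:(0,\infty)\to\mathbb{R}$ is weakly singular, meaning that $h(|x-y|)$ is continuous for all $x,y\in\mathbb{S}^2$ with $x\neq y$ and there are constants $M>0$, $\alpha\in(0,2]$ with $|h(|x-y|)|\le M|x-y|^{\alpha-2}$.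 The integral operator $A:C(\mathbb{S}^2)\to C(\mathbb{S}^2)$ is $$(A\varphi)(x)=\int_{\mathbb{S}^2}h(|x-y|)K(x,y)\varphi(y)\,d\omega(y).$$ Quadrature: for each $m$ under consideration an $m$-point quadrature rule $\sum_{j=1}^m w_j g(x_j)\approx\int_{\mathbb{S}^2}g\,d\omega$ is given, with distinct points $x_1,\dots,x_m\in\mathbb{S}^2$ and positive weights $w_j>0$ (points and weights depend on $m$), such that $\sum_{j=1}^m w_j<C$ for a constant $C$ independent of $m$. $\Gamma$ is the set of triples $\gamma=(m,n,\eta)$ with $\eta\in[0,1)$ such that the $m$-point rule satisfies the Marcinkiewicz–Zygmund property with degree $n$ and constant $\eta$: $$(1-\eta)\int_{\mathbb{S}^2}\chi^2\,d\omega\le\sum_{j=1}^m w_j\chi(x_j)^2\le(1+\eta)\int_{\mathbb{S}^2}\chi^2\,d\omega\qquad\text{for all }\chi\in\mathbb{P}_n.$$ For $\gamma=(m,n,\eta)\in\Gamma$ the weight functions are $$W_j(x)=w_j\sum_{\ell=0}^n\sum_{k=1}^{2\ell+1}\left(\int_{\mathbb{S}^2}h(|x-y|)Y_{\ell,k}(y)\,d\omega(y)\right)Y_{\ell,k}(x_j),\quad j=1,\dots,m.$$ *)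

(* Defs.v *)
From HB Require Import structures.
From mathcomp Require Import all_boot all_order all_algebra.
(* No notations: those of mpoly clash with those of MathComp-Analysis. *)
From mathcomp.multinomials Require Import(canonicals, coercions) mpoly.
From mathcomp Require Import all_classical all_reals all_analysis.

Set Implicit Arguments.
Unset Strict Implicit.
Unset Printing Implicit Defensive.

Import Order.TTheory GRing.Theory Num.Theory.
Import numFieldNormedType.Exports.
Local Open Scope classical_set_scope.
Local Open Scope ring_scope.

Section Sphere.
Context {R : realType}.

(* The library norm on 'rV[R]_3 is the max norm (with the same topology). *)
Definition enorm (x : 'rV[R]_3) : R := Num.sqrt (\sum_i x ord0 i ^+ 2).

End Sphere.

(* As a type, [S2 R] is the subtype [set_type], with the topology induced by
   R^3. *)
Definition S2 (R : realType) : set 'rV[R]_3 := [set x | enorm x = 1].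
Arguments S2 : clear implicits.

Section SurfaceIntegral.
Context {R : realType}.

Definition edist (x y : S2 R) : R := enorm (set_val x - set_val y).

Definition spherical_coord (p : R * R) : 'rV[R]_3 :=
  \row_(i < 3) [:: sin p.1 * cos p.2; sin p.1 * sin p.2; cos p.1]`_i.

Lemma spherical_coord_S2 (p : R * R) : spherical_coord p \in S2 R.
Proof.
rewrite inE /S2 /= /enorm !big_ord_recr big_ord0 /= add0r !mxE /=.
rewrite !exprMn -mulrDr [cos p.2 ^+ 2 + _]addrC [sin p.2 ^+ 2 + _]addrC.
by rewrite cos2Dsin2 mulr1 [sin p.1 ^+ 2 + _]addrC cos2Dsin2 sqrtr1.
Qed.

Definition spherical_pt (p : R * R) : S2 R :=
  exist _ (spherical_coord p) (spherical_coord_S2 p).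

(* The integral of g against the surface measure: the polar angle theta = p.1
   runs over [0, pi], the azimuth phi = p.2 over [0, 2 pi], and the area
   element is sin theta dtheta dphi. *)
Definition surf_int (g : S2 R -> R) : R :=
  \int[(@lebesgue_measure R \x @lebesgue_measure R)%E]_(p in
      `[0, pi]%classic `*` `[0, 2 * pi]%classic)
    (g (spherical_pt p) * sin p.1).

Definition supnorm (g : S2 R -> R) : R := sup (range (fun x => `|g x|)).

Definition L2norm (g : S2 R -> R) : R :=
  Num.sqrt (surf_int (fun x => g x ^+ 2)).

(* A real spherical harmonic of degree l is the restriction to the sphere of a
   homogeneous harmonic polynomial of degree l in three variables. *)
Definition spherical_harmonic (l : nat) (Y : S2 R -> R) : Prop :=
  exists p : mpoly.mpoly 3 R,
    [/\ p \is mpoly.ishomog1 l (@mpoly.mdeg 3),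
        \sum_(i < 3) mpoly.mderiv i (mpoly.mderiv i p) = 0 &
        forall x : S2 R, Y x = mpoly.meval (fun i => set_val x ord0 i) p].

(* The second index runs over k = 0, ..., 2l instead of k = 1, ..., 2l+1. *)
Definition harmonic_orthonormal_system
    (Y : forall l : nat, 'I_(2 * l + 1) -> S2 R -> R) : Prop :=
  (forall l k, spherical_harmonic l (Y l k)) /\
  (forall l k l' k', surf_int (fun x => Y l k x * Y l' k' x) =
     ((l == l') && (k == k' :> nat))%:R).

Section Approximation.
Variable Y : forall l : nat, 'I_(2 * l + 1) -> S2 R -> R.

Definition Pspace (n : nat) : set (S2 R -> R) :=
  [set chi | exists a : forall l : nat, 'I_(2 * l + 1) -> R,
     chi = fun x => \sum_(l < n.+1) \sum_(k < 2 * l + 1) a l k * Y k x].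

(* The infimum is attained because Pspace n is finite dimensional. *)
Definition best_error (n : nat) (g : S2 R -> R) : R :=
  inf [set supnorm (fun x => g x - chi x) | chi in Pspace n].

Definition best_approx (n : nat) (g chi : S2 R -> R) : Prop :=
  Pspace n chi /\ supnorm (fun x => g x - chi x) = best_error n g.

End Approximation.

Definition weakly_singular (h : R -> R) : Prop :=
  (forall x y : S2 R, x <> y ->
     {for (x, y), continuous (fun p : S2 R * S2 R => h (edist p.1 p.2))}) /\
  exists M alpha : R, [/\ 0 < M, 0 < alpha, alpha <= 2 &
    forall x y : S2 R, x <> y ->
      `|h (edist x y)| <= M * edist x y `^ (alpha - 2)].

Definition integral_op (h : R -> R) (K : S2 R * S2 R -> R) (phi : S2 R -> R) :
    S2 R -> R :=
  fun x => surf_int (fun y => h (edist x y) * K (x, y) * phi y).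

(* D is the set of those m for which a rule is given; node m and weight m carry
   no information when m is not in D. *)
Definition quadrature_family (D : set nat) (node : forall m : nat, 'I_m -> S2 R)
    (weight : forall m : nat, 'I_m -> R) (C : R) : Prop :=
  forall m, D m ->
    [/\ injective (node m), forall j, 0 < weight m j &
        \sum_(j < m) weight m j < C].

Section Scheme.
Variables (Y : forall l : nat, 'I_(2 * l + 1) -> S2 R -> R)
  (D : set nat) (node : forall m : nat, 'I_m -> S2 R)
  (weight : forall m : nat, 'I_m -> R).

Definition Gamma (m n : nat) (eta : R) : Prop :=
  [/\ D m, 0 <= eta < 1 &
    forall chi, Pspace Y n chi ->
      (1 - eta) * surf_int (fun x => chi x ^+ 2)
        <= \sum_(j < m) weight j * chi (node j) ^+ 2
        <= (1 + eta) * surf_int (fun x => chi x ^+ 2)].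

Definition Wfun (h : R -> R) (m n : nat) (j : 'I_m) (x : S2 R) : R :=
  weight j * \sum_(l < n.+1) \sum_(k < 2 * l + 1)
    surf_int (fun y => h (edist x y) * Y k y) * Y k (node j).

(* c i stands for the unknown phi_gamma (node i). *)
Definition linear_system (h : R -> R) (K : S2 R * S2 R -> R) (m n : nat)
    (f : S2 R -> R) (c : 'I_m -> R) : Prop :=
  forall i : 'I_m,
    c i - \sum_(j < m) Wfun h n j (node i) * K (node i, node j) * c j
      = f (node i).

(* The scheme succeeds: the linear system is uniquely solvable, and phig is the
   function obtained from its solution. In particular phig is determined by
   the data, and phig (node i) = c i. *)
Definition scheme_output (h : R -> R) (K : S2 R * S2 R -> R) (m n : nat)
    (f phig : S2 R -> R) : Prop :=
  exists c : 'I_m -> R,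
    [/\ linear_system h K n f c,
        forall c', linear_system h K n f c' -> c' = c &
        forall t, phig t =
          f t + \sum_(j < m) Wfun h n j t * K (t, node j) * c j].

End Scheme.

(* C m n eta is positive, decreases as n grows, and decreases as eta
   decreases, on the range n >= N, 0 <= eta <= eta0. *)
Definition decreasing_constant (N : nat) (eta0 : R) (C : nat -> nat -> R -> R) :
    Prop :=
  [/\ forall m n eta, (N <= n)%N -> 0 <= eta <= eta0 -> 0 < C m n eta,
      forall m n n' eta, (N <= n)%N -> (n < n')%N -> 0 <= eta <= eta0 ->
        C m n' eta < C m n eta &
      forall m n eta eta', (N <= n)%N -> 0 <= eta' -> eta' < eta ->
        eta <= eta0 -> C m n eta' < C m n eta].

End SurfaceIntegral.

(* Main.v *)
(* Write A phi (x) = b (K(x,.) phi) (H_x) with H_x = h(|x - .|) and b g H = int g H.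
   The discrete operator A_gamma has the same shape, with b replaced by
   b_gamma g H = sum_j w_j g(x_j) (Pi_n H)(x_j), Pi_n the orthogonal projection
   onto P_n. By Cauchy-Schwarz, the Marcinkiewicz-Zygmund property and Bessel's
   inequality, all these forms are bounded by a common multiple of |g|_oo |H|_2.
   As x |-> H_x is bounded and continuous into L^2, the operators A_gamma are
   collectively compact; they converge pointwise to A because P_n is
   asymptotically dense. A compactness argument then gives
   |psi| <= B |psi - A_gamma psi| for n large and eta small, whence the
   solvability of the linear system, stability, and
   |phi_gamma - phi| <= B |(A_gamma - A) phi|; this last quantity is estimated at
   a point x_0 where it attains its maximum. On P_n the form b_gamma - b has norm
   at most eta, by polarization of the Marcinkiewicz-Zygmund property.

   That x |-> H_x is continuous into L^2 rests on Archimedes' theorem: the image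
   of the surface measure under y |-> x.y is proportional to Lebesgue measure on
   [-1, 1]. It is obtained from the moments of x.y and Weierstrass' theorem. *)
Require Import Defs.
From mathcomp Require Import all_boot all_order all_algebra.
From mathcomp.multinomials Require Import(canonicals, coercions) mpoly.
From mathcomp Require Import all_classical all_reals all_analysis measurable_realfun.
From mathcomp Require Import ring lra zify.

Set Implicit Arguments.
Unset Strict Implicit.
Unset Printing Implicit Defensive.

Import Order.TTheory GRing.Theory Num.Theory.
Import numFieldNormedType.Exports.
Local Open Scope classical_set_scope.
Local Open Scope ring_scope.

(** * Compact spaces *)

(** The surface integral is given in spherical coordinates, so rotation invariance does not come for
    free. The recursion for the moments of y |-> x.y uses nothing of x but |x| = 1, and therefore
    makes zonal integrals independent of x. This matters because h may be unbounded near 0: cutting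
    H_x off near y = x leaves a jointly continuous kernel, and the L^2 norm of the removed part,
    being controlled by the profile of h alone, is small uniformly in x. That every polynomial
    function of degree at most n belongs to P_n is not part of the definition of the harmonics. It
    follows from a count: on the sphere these functions are spanned by as many monomials as there
    are harmonics, and the harmonics are independent by orthonormality. The solution phi has to be
    produced from the injectivity of I - A; Riesz's argument does so, starting from the same lower
    bound applied to A itself. Limits are taken along ultrafilters, where bounded families converge
    pointwise without passing to subsequences. *)

Lemma compact_ind (T : topologicalType) (P : set T -> Prop) :
  compact [set: T] -> P set0 ->
  (forall A B, A `<=` B -> P B -> P A) ->
  (forall A B, P A -> P B -> P (A `|` B)) ->
  (forall x : T, exists2 U, nbhs x U & P U) -> P [set: T].
Proof.
move=> cT P0 Psub PU Ploc; apply: contrapT => nPT.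
(* If P failed for the whole space, the complements of the sets with P would form a proper filter;
   its cluster point has no neighbourhood with P. *)
pose F : set_system T := [set A | P (~` A)].
have FF : ProperFilter F.
  split; first by rewrite /F /= setC0.
  split; first by rewrite /F /= setCT.
  - by move=> A B FA FB; rewrite /F /= setCI; exact: PU.
  - by move=> A B AB; apply: Psub; apply: subsetC.
have [x [_ clx]] := cT F FF (@filterT _ F _).
have [U xU PU'] := Ploc x.
have FU : F (~` U) by rewrite /F /= setCK.
by have [y []] := clx _ _ FU xU.
Qed.

Section CompactSpace.
Context {R : realType} {T : topologicalType}.
Hypothesis cT : compact [set: T].

Lemma continuous_bounded_compact (f : T -> R) : continuous f ->
  exists2 M, 0 < M & forall x, `|f x| <= M.
Proof.
move=> cf.
suff [M M0 fM] : exists2 M, 0 < M & forall x, [set: T] x -> `|f x| <= M.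
  by exists M => // x; exact: fM.
apply: (@compact_ind T (fun A => exists2 M, 0 < M & forall x, A x -> `|f x| <= M)) => //.
- by exists 1.
- by move=> A B AB [M M0 BM]; exists M => // x /AB; exact: BM.
- move=> A B [M M0 AM] [N N0 BN]; exists (M + N); first exact: addr_gt0.
  by move=> x [/AM|/BN] h; apply: (le_trans h); rewrite ?lerDl ?lerDr ltW.
- move=> x; have /cvgrPdist_le/(_ 1 ltr01) := cf x => xU.
  exists [set y | `|f x - f y| <= 1] => //.
  exists (`|f x| + 1); first by rewrite ltr_wpDl.
  move=> y /= xy; have -> : f y = f x - (f x - f y) by lra.
  by rewrite (le_trans (ler_normB _ _))// lerD2l.
Qed.

(** The pointwise limit inherits the common modulus of continuity, so closeness at x within e / 3
    spreads to a neighbourhood of x with error e; compactness makes one index set of the filter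
    serve all points. *)
Lemma equicontinuous_cvg_uniform (I : Type) (G : set_system I) (psi : I -> T -> R)
    (phi : T -> R) : ProperFilter G ->
  (forall (x : T) (e : R), 0 < e -> \forall y \near x, forall i, `|psi i x - psi i y| <= e) ->
  (forall x, psi ^~ x @ G --> phi x) ->
  continuous phi /\
  forall e : R, 0 < e -> \forall i \near G, forall x, `|phi x - psi i x| <= e.
Proof.
move=> PG equi cvg.
have phiE (x : T) (e : R) : 0 < e -> \forall y \near x, `|phi x - phi y| <= e.
  move=> e0; apply: filterS (equi x _ e0) => y Uy.
  have cvgxy : (fun i => psi i x - psi i y) @ G --> phi x - phi y.
    by apply: cvgB; exact: cvg.
  rewrite leNgt; apply/negP => lt.
  have /cvgrPdist_lt/(_ (`|phi x - phi y| - e)) := cvgxy.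
  rewrite subr_gt0 => /(_ lt) /filter_ex[i].
  move/(le_lt_trans (ler_dist_dist _ _)); move/(le_lt_trans (ler_norm _)).
  by have := Uy i; lra.
split=> [x|e e0]; first by apply/cvgrPdist_le => e; exact: phiE.
have e30 : 0 < e / 3 by rewrite divr_gt0.
have cover := (compact_near_coveringP [set: T]).1 cT I G
  (fun i x => `|phi x - psi i x| <= e) _.
suff : \forall i \near G, [set: T] `<=` (fun x => `|phi x - psi i x| <= e).
  by apply: filterS => i h x; exact: h.
apply: cover => x _.
have /cvgrPdist_le/(_ _ e30) cx := cvg x.
exists ([set y | `|phi x - phi y| <= e / 3] `&`
        [set y | forall i, `|psi i x - psi i y| <= e / 3],
       [set i | `|phi x - psi i x| <= e / 3]).
  by split => //; apply: filterI; [exact: phiE|exact: equi].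
move=> [y i]/= [[]] h1 /(_ i) h2 h3; rewrite !ler_norml in h1 h2 h3 *; lra.
Qed.

(** The values at a point are pushed forward to an ultrafilter on the compact segment [-M, M], which
    converges; so the pointwise limit exists without any diagonal extraction. *)
Lemma ascoli_ultra (I : Type) (G : set_system I) (psi : I -> T -> R) (M : R) :
  UltraFilter G ->
  (forall (x : T) (e : R), 0 < e -> \forall y \near x, forall i, `|psi i x - psi i y| <= e) ->
  (forall i x, `|psi i x| <= M) ->
  exists phi : T -> R, continuous phi /\
  forall e : R, 0 < e -> \forall i \near G, forall x, `|phi x - psi i x| <= e.
Proof.
move=> UG equi bnd.
have [phi phiP] : {phi : T -> R & forall x, psi ^~ x @ G --> phi x}.
  apply: (@choice _ _ (fun x l => psi ^~ x @ G --> l)) => x.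
  have := @segment_compact R (- M) M; rewrite compact_ultra.
  have UF : UltraFilter (psi ^~ x @ G).
    split => [|H PH sub]; first exact: fmap_proper_filter.
    apply/seteqP; split => // A HA.
    have [//|GA] := in_ultra_setVsetC ((psi ^~ x) @^-1` A) UG.
    have : H (~` A) by exact: sub.
    by move=> /(filterI HA); rewrite setICr => /filter_not_empty.
  move=> /(_ _ UF)[].
    by apply: (@filterS _ G _ setT) => [i _ /=|]; [rewrite in_itv/= -ler_norml|exact: filterT].
  by move=> l [_ ?]; exists l.
by exists phi; exact: equicontinuous_cvg_uniform.
Qed.

End CompactSpace.

(** * The Stone-Weierstrass theorem *)

Section StoneWeierstrass.
Context {R : realType} {T : topologicalType}.
Hypothesis cT : compact [set: T].
Variable A : set (T -> R).
Hypothesis Acont : forall f, A f -> continuous f.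
Hypothesis Acst : forall c, A (cst c).
Hypothesis Aadd : forall f g, A f -> A g -> A (fun x => f x + g x).
Hypothesis Amul : forall f g, A f -> A g -> A (fun x => f x * g x).

(* Newton-like iteration whose iterates increase to [|t|] on [-1, 1]. *)
Fixpoint abs_iter (n : nat) (t : R) : R :=
  if n is m.+1 then abs_iter m t + (t ^+ 2 - abs_iter m t ^+ 2) / 2 else 0.

(** One step multiplies the error |t| - q by 1 - (|t| + q) / 2, which is at most 1 - u with u = |t|
    / 2, and (1 + (n + 1) u) (1 - u) <= 1 + n u. The second bound says that the error is at most 2 /
    n uniformly in t, and in this form it needs no division by |t|. *)
Lemma abs_iter_bound n (t : R) : `|t| <= 1 ->
  0 <= abs_iter n t <= `|t| /\ (1 + n%:R * (`|t| / 2)) * (`|t| - abs_iter n t) <= `|t|.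
Proof.
move=> t1; have s0 : 0 <= `|t| by [].
elim: n => [|n [/andP[q0 qt] IH]] /=; first by rewrite lexx s0; split => //; lra.
have -> : t ^+ 2 = `|t| ^+ 2 by rewrite real_normK// num_real.
set s := `|t| in t1 s0 qt IH *; set q := abs_iter n t in q0 qt IH *.
have n0 : 0 <= n%:R :> R by [].
have E : s - (q + (s ^+ 2 - q ^+ 2) / 2) = (s - q) * (1 - (s + q) / 2) by field.
split.
  by apply/andP; split; [nra|rewrite -subr_ge0 E; nra].
rewrite E -natr1.
have h1 : (1 + (n%:R + 1) * (s / 2)) * (1 - (s + q) / 2) <= 1 + n%:R * (s / 2).
  have : (1 + (n%:R + 1) * (s / 2)) * (1 - (s + q) / 2) <= (1 + (n%:R + 1) * (s / 2)) * (1 - s / 2).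
    by apply: ler_wpM2l; nra.
  move/le_trans; apply; have : 0 <= (n%:R + 1) * (s/2 * (s/2)) by nra.
  nra.
apply: le_trans IH; rewrite mulrCA mulrC; apply: ler_wpM2r => //; lra.
Qed.

Lemma abs_iter_closed n f : A f -> A (fun x => abs_iter n (f x)).
Proof.
move=> Af; elim: n => [|n IH] /=; first exact: Acst.
apply: (Aadd IH).
have -> : (fun x => (f x ^+ 2 - abs_iter n (f x) ^+ 2) / 2) =
  (fun x => cst (2^-1) x * (f x * f x + cst (-1) x * (abs_iter n (f x) * abs_iter n (f x)))).
  by apply/funext => x /=; ring.
by apply: Amul (Acst _) _; apply: Aadd; [exact: Amul|apply: Amul (Acst _) _; exact: Amul].
Qed.

Let clA (f : T -> R) := forall e : R, 0 < e -> exists2 g, A g & forall x, `|f x - g x| <= e.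

Let clA_add f g : clA f -> clA g -> clA (fun x => f x + g x).
Proof.
move=> Af Ag e e0; have e20 : 0 < e / 2 by rewrite divr_gt0.
have [f' Af' ff'] := Af _ e20; have [g' Ag' gg'] := Ag _ e20.
exists (fun x => f' x + g' x); first exact: Aadd.
move=> x; have := ff' x; have := gg' x; rewrite !ler_norml; lra.
Qed.

Let clA_scale c f : clA f -> clA (fun x => c * f x).
Proof.
move=> Af e e0; have c0 : 0 < `|c| + 1 by rewrite ltr_wpDl.
have [f' Af' ff'] := Af (e / (`|c| + 1)) (divr_gt0 e0 c0).
exists (fun x => cst c x * f' x); first exact: Amul.
move=> x /=; rewrite -mulrBr normrM.
have := ff' x; rewrite ler_pdivlMr// mulrC => h.
by rewrite (le_trans _ h)// ler_wpM2r// lerDl.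
Qed.

Let clA_abs f : clA f -> clA (fun x => `|f x|).
Proof.
move=> Af e e0; have e20 : 0 < e / 2 by rewrite divr_gt0.
have [g Ag fg] := Af _ e20.
have [M M0 gM] := continuous_bounded_compact cT (Acont Ag).
(* On [-1, 1] the n-th iterate is within 2 / n of the absolute value; rescaled by M, this is at most
   e / 2. *)
have [n nP] : exists n, 4 * M / e < n%:R.
  by exists (Num.truncn (4 * M / e)).+1; exact: truncnS_gt.
exists (fun x => cst M x * abs_iter n (cst M^-1 x * g x)).
  by apply: Amul => //; apply: (@abs_iter_closed n (fun x => cst M^-1 x * g x)); exact: Amul.
move=> x /=; set t := M^-1 * g x.
have gt : `|g x| = M * `|t|.
  by rewrite /t normrM gtr0_norm ?invr_gt0// mulVKf ?gt_eqF.
have t1 : `|t| <= 1 by rewrite -(ler_pM2l M0) -gt mulr1.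
have [/andP[q0 qt] qe] := abs_iter_bound n t1.
have h1 : `| `|f x| - `|g x| | <= e / 2.
  by apply: le_trans (fg x); exact: ler_dist_dist.
have h2 : M * (`|t| - abs_iter n t) <= e / 2.
  move: nP; rewrite ltr_pdivrMr// => nP.
  have [t0|t0] := eqVneq `|t| 0; first by move: q0 qt; rewrite t0; nra.
  have tp : 0 < `|t| by rewrite lt_def t0 /=.
  have : n%:R / 2 * (`|t| - abs_iter n t) <= 1.
    rewrite -(ler_pM2l tp) mulr1; apply: le_trans qe.
    rewrite mulrDl mul1r; 
    have -> : `|t| * (n%:R / 2 * (`|t| - abs_iter n t)) =
      n%:R * (`|t| / 2) * (`|t| - abs_iter n t) by ring.
    by rewrite lerDr subr_ge0.
  set d := `|t| - _ => nd; have d0 : 0 <= d by rewrite subr_ge0.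
  by nra.
rewrite gt in h1.
have h3 : 0 <= M * (`|t| - abs_iter n t) by rewrite mulr_ge0 ?(ltW M0)// subr_ge0.
rewrite mulrBr in h2 h3; move: h1; rewrite !ler_norml; lra.
Qed.

Let clA_max f g : clA f -> clA g -> clA (fun x => Num.max (f x) (g x)).
Proof.
move=> Af Ag; have -> : (fun x => Num.max (f x) (g x)) =
  (fun x => 2^-1 * (f x + g x + `|f x + (-1) * g x|)).
  apply/funext => x; rewrite mulN1r; case: (leP (f x) (g x)) => fg.
    rewrite ler0_norm; lra.
  rewrite gtr0_norm; lra.
apply: clA_scale; apply: clA_add; first exact: clA_add.
by apply: clA_abs; apply: clA_add => //; exact: clA_scale.
Qed.

Let clA_min f g : clA f -> clA g -> clA (fun x => Num.min (f x) (g x)).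
Proof.
move=> Af Ag; have -> : (fun x => Num.min (f x) (g x)) =
  (fun x => (-1) * Num.max ((-1) * f x) ((-1) * g x)).
  by apply/funext => x; rewrite !mulN1r -oppr_min opprK.
by apply: clA_scale; apply: clA_max; exact: clA_scale.
Qed.

Let clA_cont f : clA f -> continuous f.
Proof.
move=> Af x; apply/cvgrPdist_le => e e0; have e30 : 0 < e / 3 by rewrite divr_gt0.
have [g Ag fg] := Af _ e30.
have /cvgrPdist_le/(_ _ e30) := @Acont g Ag x.
apply: filterS => y; have := fg x; have := fg y; rewrite !ler_norml; lra.
Qed.

(* Two-point interpolation in [A], rather than separation of points, allows
   algebras that do not separate points. *)
Lemma stone_weierstrass (f : T -> R) : continuous f ->
  (forall x y, exists g, [/\ A g, g x = f x & g y = f y]) ->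
  forall e : R, 0 < e -> exists2 g, A g & forall x, `|f x - g x| <= e.
Proof.
move=> cf interp e e0; have e40 : 0 < e / 4 by rewrite divr_gt0.
have subA g : A g -> clA g.
  by move=> Ag d d0; exists g => // x; rewrite subrr normr0 ltW.
(* Interpolants through x and y are above f - e / 4 near y; the maximum of finitely many of them is
   so everywhere and still agrees with f at x. *)
have gt x : exists g, [/\ clA g, g x = f x & forall y, f y - e / 4 <= g y].
  suff [g [Ag gx gy]] : exists g, [/\ clA g, g x = f x &
      forall y, [set: T] y -> f y - e / 4 <= g y].
    by exists g; split=> // y; exact: gy.
  apply: (@compact_ind T (fun U => exists g, [/\ clA g, g x = f x &
      forall y, U y -> f y - e / 4 <= g y])) => //.
  - by exists (cst (f x)); split => //; exact: subA.
  - by move=> U V UV [g [Ag gx gy]]; exists g; split => // y /UV; exact: gy.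
  - move=> U V [g [Ag gx gy]] [h [Ah hx hy]].
    exists (fun x => Num.max (g x) (h x)); split; first exact: clA_max.
      by rewrite gx hx maxxx.
    by move=> y [/gy|/hy] k; rewrite le_max k ?orbT.
  - move=> y; have [g [Ag gx gy]] := interp x y.
    have /cvgrPdist_le/(_ _ e40) gfy : g z - f z @[z --> y] --> g y - f y.
      by apply: cvgB; [exact: Acont|exact: cf].
    exists [set z | `|g y - f y - (g z - f z)| <= e / 4] => //.
    exists g; split => //; first exact: subA.
    by move=> z /=; rewrite gy subrr sub0r normrN ler_norml; lra.
(* A function that agrees with f at x is not much larger than f near x; the minimum of finitely many
   such functions is bounded from both sides. The remaining e / 4 is spent on passing from the
   uniform closure back to the algebra. *)
suff [g [Ag glb gub]] : exists g, [/\ clA g, forall y, f y - e / 4 <= g y &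
    forall y, [set: T] y -> g y <= f y + e / 2].
  have [h Ah gh] := Ag _ e40; exists h => // x.
  have := gh x; have := glb x; have := gub x I; rewrite !ler_norml; lra.
apply: (@compact_ind T (fun U => exists g, [/\ clA g, forall y, f y - e / 4 <= g y &
    forall y, U y -> g y <= f y + e / 2])) => //.
- have [M M0 fM] := continuous_bounded_compact cT cf.
  exists (cst M); split => //; first exact: subA.
  by move=> y /=; have := fM y; rewrite ler_norml; lra.
- by move=> U V UV [g [Ag gx gy]]; exists g; split => // y /UV; exact: gy.
- move=> U V [g [Ag gx gy]] [h [Ah hx hy]].
  exists (fun x => Num.min (g x) (h x)); split; first exact: clA_min.
    by move=> y; rewrite le_min gx hx.
  by move=> y [/gy|/hy] k; rewrite ge_min k ?orbT.
- move=> x; have [g [Ag gx gy]] := gt x.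
  have /cvgrPdist_le/(_ _ e40) gfx : g z - f z @[z --> x] --> g x - f x.
    by apply: cvgB; [exact: clA_cont|exact: cf].
  exists [set z | `|g x - f x - (g z - f z)| <= e / 4] => //.
  exists g; split => //.
  by move=> z /=; rewrite gx subrr sub0r normrN ler_norml; lra.
Qed.

End StoneWeierstrass.

(** * The sphere and its polynomial functions *)

Section SphereGeometry.
Context {R : realType}.
Implicit Types x y : S2 R.

Definition i0 : 'I_3 := @Ordinal 3 0 isT.
Definition i1 : 'I_3 := @Ordinal 3 1 isT.
Definition i2 : 'I_3 := @Ordinal 3 2 isT.

Lemma sum3 (F : 'I_3 -> R) : \sum_i F i = F i0 + F i1 + F i2.
Proof.
by rewrite !big_ord_recr big_ord0 /= add0r; congr (F _ + F _ + F _); exact/val_inj.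
Qed.

Lemma prod3 (F : 'I_3 -> R) : \prod_i F i = F i0 * F i1 * F i2.
Proof.
by rewrite !big_ord_recr big_ord0 /= mul1r; congr (F _ * F _ * F _); exact/val_inj.
Qed.

Definition coor (i : 'I_3) (x : S2 R) : R := set_val x ord0 i.

Definition dot (x y : S2 R) : R :=
  coor i0 x * coor i0 y + coor i1 x * coor i1 y + coor i2 x * coor i2 y.

Lemma enorm_sqr (v : 'rV[R]_3) :
  enorm v = Num.sqrt (v ord0 i0 ^+ 2 + v ord0 i1 ^+ 2 + v ord0 i2 ^+ 2).
Proof. by rewrite /enorm sum3. Qed.

Lemma coor_sqr x : coor i0 x ^+ 2 + coor i1 x ^+ 2 + coor i2 x ^+ 2 = 1.
Proof.
have : enorm (set_val x) = 1 by have := set_valP x.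
rewrite enorm_sqr => /(congr1 (fun t => t ^+ 2)).
by rewrite sqr_sqrtr ?expr1n// !addr_ge0 ?sqr_ge0.
Qed.

Lemma mkS2_subproof (a b c : R) : a ^+ 2 + b ^+ 2 + c ^+ 2 = 1 ->
  (\row_(i < 3) [:: a; b; c]`_i) \in S2 R.
Proof. by move=> h; rewrite inE /S2 /= enorm_sqr !mxE /= h sqrtr1. Qed.

Definition mkS2 (a b c : R) (h : a ^+ 2 + b ^+ 2 + c ^+ 2 = 1) : S2 R :=
  exist (fun v : 'rV[R]_3 => v \in S2 R) _ (mkS2_subproof h).

Lemma coor_mkS2 a b c h i : coor i (@mkS2 a b c h) = [:: a; b; c]`_i.
Proof. by rewrite /coor set_valE /= mxE. Qed.

Lemma coor_inj x y : (forall i, coor i x = coor i y) -> x = y.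
Proof.
move=> xy; apply: val_inj; apply/rowP => i; have := xy i.
by rewrite /coor set_valE.
Qed.

Lemma dot_dist x y : (coor i0 x - coor i0 y) ^+ 2 + (coor i1 x - coor i1 y) ^+ 2 +
  (coor i2 x - coor i2 y) ^+ 2 = 2 * (1 - dot x y).
Proof. rewrite /dot; have := coor_sqr x; have := coor_sqr y; lra. Qed.

Lemma dot_le1 x y : dot x y <= 1.
Proof.
have : 0 <= 2 * (1 - dot x y) by rewrite -dot_dist !addr_ge0 ?sqr_ge0.
by lra.
Qed.

Lemma dot_geN1 x y : -1 <= dot x y.
Proof.
have : 0 <= (coor i0 x + coor i0 y) ^+ 2 + (coor i1 x + coor i1 y) ^+ 2 +
  (coor i2 x + coor i2 y) ^+ 2 by rewrite !addr_ge0 ?sqr_ge0.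
rewrite /dot; have := coor_sqr x; have := coor_sqr y; lra.
Qed.

Lemma edistE x y : Defs.edist x y = Num.sqrt (2 * (1 - dot x y)).
Proof. by rewrite -dot_dist /Defs.edist enorm_sqr !mxE. Qed.

Lemma continuous_coor i : continuous (coor i).
Proof.
move=> x; apply: (@continuous_comp _ _ _ (set_val : S2 R -> 'rV[R]_3) (fun v : 'rV[R]_3 => v ord0 i)).
  exact: initial_continuous.
exact: coord_continuous.
Qed.

Lemma continuous_S2 (T : topologicalType) (f : T -> S2 R) (t : T) :
  (forall i, {for t, continuous (coor i \o f)}) -> {for t, continuous f}.
Proof.
move=> cf U [? /= [[W oW <-]]] /= Wsfz /filterS; apply.
have cvf : {for t, continuous (set_val \o f : T -> 'rV[R]_3)}.
  apply/cvg_ballP => e e0.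
  have c i : \forall z \near t, ball (coor i (f t)) e (coor i (f z)).
    by have /cvg_ballP/(_ _ e0) := cf i.
  apply: filterS (filterI (c i0) (filterI (c i1) (c i2))) => z [/= z0 [z1 z2]].
  split => // i j.
  rewrite ord1; case: j => -[|[|[|//]]] kj.
  - by rewrite (_ : Ordinal kj = i0)//; exact/val_inj.
  - by rewrite (_ : Ordinal kj = i1)//; exact/val_inj.
  - by rewrite (_ : Ordinal kj = i2)//; exact/val_inj.
by apply: (cvf W); exact: open_nbhs_nbhs.
Qed.

(** The sphere is closed and bounded in R^3. Compactness passes to the subtype because a filter on
    it can be pushed forward to R^3, where a cluster point on the sphere lifts back: the open sets
    of the subtype are traces. *)
Lemma compact_S2 : compact [set: S2 R].
Proof.
have cS : compact (S2 R : set 'rV[R]_3).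
  apply: bounded_closed_compact.
    exists 1; split => // M M1 v /= v1; apply: le_trans (ltW M1).
    rewrite [leLHS]/Num.norm /= mx_normrE; apply/bigmax_leP; split => // -[i j] _ /=.
    move: v1; rewrite (ord1 i) /S2 /= /enorm => /(congr1 (fun t => t ^+ 2)).
    rewrite sqr_sqrtr ?expr1n; last by apply: sumr_ge0 => *; exact: sqr_ge0.
    rewrite (bigD1 j)//= => h; rewrite -(@ler_pXn2r _ 2) ?nnegrE// expr1n.
    rewrite real_normK ?num_real// -h lerDl.
    by apply: sumr_ge0 => *; exact: sqr_ge0.
  have -> : S2 R = (fun v : 'rV[R]_3 => \sum_i v ord0 i ^+ 2) @^-1` [set 1].
    apply/seteqP; split => v /=; rewrite /S2 /= /enorm.
      move=> /(congr1 (fun t => t ^+ 2)).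
      rewrite sqr_sqrtr ?expr1n//; last by apply: sumr_ge0 => *; exact: sqr_ge0.
    by move=> ->; rewrite sqrtr1.
  apply: (continuous_closedP _).1; last exact: closed_eq.
  move=> v; rewrite /continuous_at.
  rewrite [in X in _ --> X]sum3; under eq_fun do rewrite sum3.
  have c i : v' ord0 i ^+ 2 @[v' --> v] --> v ord0 i ^+ 2.
    apply: (@continuous_comp _ _ _ (fun v : 'rV[R]_3 => v ord0 i) (fun t => t ^+ 2)).
      exact: coord_continuous.
    exact: exprn_continuous.
  exact: (cvgD (cvgD (c i0) (c i1)) (c i2)).
move=> F PF _.
have [|v [Sv clv]] := cS ((set_val : S2 R -> _) @ F) _.
  by apply: (@filterS _ F _ setT) => [x _|]; [exact: set_valP|exact: filterT].
exists (exist (fun v : 'rV[R]_3 => v \in S2 R) v (mem_set Sv)); split => //.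
move=> A B FA [? /= [[W oW <-]]] /= Wv WB.
have FvA : ((set_val : S2 R -> 'rV[R]_3) @ F) (set_val @` A).
  by apply: (@filterS _ F _ A) => // x Ax; exists x.
have [_ [[x Ax <-] Wx]] := clv _ _ FvA (open_nbhs_nbhs (conj oW Wv)).
by exists x; split => //; exact: WB.
Qed.


Lemma continuous_dot x : continuous (dot x).
Proof.
move=> y; rewrite /continuous_at /dot.
have c i : (fun y => coor i x * coor i y) @ y --> coor i x * coor i y.
  exact: (cvgM (cvg_cst _) (@continuous_coor i y)).
exact: (cvgD (cvgD (c i0) (c i1)) (c i2)).
Qed.

Definition monom (a b c : nat) (x : S2 R) : R :=
  coor i0 x ^+ a * coor i1 x ^+ b * coor i2 x ^+ c.

(** Functions on the sphere rather than formal polynomials, since the relation x^2 + y^2 + z^2 = 1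
    identifies many of the latter. Building them one monomial at a time makes continuity,
    measurability and membership in P_n provable by induction. *)
Inductive polyfun (n : nat) : (S2 R -> R) -> Prop :=
| polyfun0 : polyfun n (fun=> 0)
| polyfunS c a b d f : (a + b + d <= n)%N -> polyfun n f ->
    polyfun n (fun x => c * monom a b d x + f x).

Lemma polyfun_continuous n f : polyfun n f -> continuous f.
Proof.
elim => [|c a b d g _ _ cg] x; first exact: cst_continuous.
have cc i k : (fun y => coor i y ^+ k) @ x --> coor i x ^+ k.
  apply: (@continuous_comp _ _ _ (coor i) (fun t => t ^+ k)).
    exact: continuous_coor.
  exact: exprn_continuous.
exact: (cvgD (cvgM (cvg_cst c) (cvgM (cvgM (cc i0 a) (cc i1 b)) (cc i2 d))) (cg x)).
Qed.

Lemma polyfun_le n m f : (n <= m)%N -> polyfun n f -> polyfun m f.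
Proof.
move=> nm; elim => [|c a b d g abd _ pg]; first exact: polyfun0.
by apply: polyfunS => //; exact: leq_trans nm.
Qed.

Lemma polyfun_ext n f g : (forall x, f x = g x) -> polyfun n f -> polyfun n g.
Proof. by move=> /funext ->. Qed.

Lemma polyfunD n f g : polyfun n f -> polyfun n g -> polyfun n (fun x => f x + g x).
Proof.
move=> pf pg; elim: pf => [|c a b d h abd _ ph].
  by apply: polyfun_ext pg => x; rewrite add0r.
by apply: (polyfun_ext _ (polyfunS c abd ph)) => x; rewrite addrA.
Qed.

Lemma polyfunZ n c f : polyfun n f -> polyfun n (fun x => c * f x).
Proof.
elim => [|e a b d h abd _ ph].
  by apply: (polyfun_ext _ (polyfun0 n)) => x; rewrite mulr0.
by apply: (polyfun_ext _ (polyfunS (c * e) abd ph)) => x; rewrite mulrDr mulrA.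
Qed.

Lemma polyfun_sum n (I : Type) (s : seq I) (P : pred I) (F : I -> S2 R -> R) :
  (forall i, P i -> polyfun n (F i)) -> polyfun n (fun x => \sum_(i <- s | P i) F i x).
Proof.
move=> pF; elim: s => [|i s IH].
  by apply: (polyfun_ext _ (polyfun0 n)) => x; rewrite big_nil.
case: (boolP (P i)) => Pi.
  by apply: (polyfun_ext _ (polyfunD (pF _ Pi) IH)) => x; rewrite big_cons Pi.
by apply: (polyfun_ext _ IH) => x; rewrite big_cons (negbTE Pi).
Qed.

Lemma polyfun_monom n a b d : (a + b + d <= n)%N -> polyfun n (monom a b d).
Proof.
move=> h; apply: (polyfun_ext _ (polyfunS 1 h (polyfun0 n))) => x.
by rewrite mul1r addr0.
Qed.

Lemma polyfun_cst n c : polyfun n (fun=> c).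
Proof.
have h : (0 + 0 + 0 <= n)%N by [].
apply: (polyfun_ext _ (polyfunS c h (polyfun0 n))) => x.
by rewrite /monom !expr0 !mulr1 addr0.
Qed.

Lemma polyfunM n m f g : polyfun n f -> polyfun m g ->
  polyfun (n + m) (fun x => f x * g x).
Proof.
elim => [_|c a b d h abd _ ph pg].
  by apply: (polyfun_ext _ (polyfun0 _)) => x; rewrite mul0r.
suff pm : polyfun (n + m) (fun x => c * (monom a b d x * g x)).
  by apply: (polyfun_ext _ (polyfunD pm (ph pg))) => x; rewrite mulrDl !mulrA.
apply: polyfunZ; elim: pg => [|c' a' b' d' g' abd' _ pg'].
  by apply: (polyfun_ext _ (polyfun0 _)) => x; rewrite mulr0.
have h' : (a + a' + (b + b') + (d + d') <= n + m)%N.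
  rewrite (_ : _ + (d + d') = (a + b + d) + (a' + b' + d'))%N; last by ring.
  exact: leq_add.
apply: (polyfun_ext _ (polyfunS c' h' pg')) => x.
by rewrite /monom !exprD; ring.
Qed.

Lemma polyfun_coor i : polyfun 1 (coor i).
Proof.
case: i => -[|[|[|//]]] ki.
- have -> : Ordinal ki = i0 by exact: val_inj.
  apply: (polyfun_ext _ (@polyfun_monom 1 1 0 0 _)) => // x.
  by rewrite /monom !expr0 expr1 !mulr1.
- have -> : Ordinal ki = i1 by exact: val_inj.
  apply: (polyfun_ext _ (@polyfun_monom 1 0 1 0 _)) => // x.
  by rewrite /monom !expr0 expr1 mul1r !mulr1.
- have -> : Ordinal ki = i2 by exact: val_inj.
  apply: (polyfun_ext _ (@polyfun_monom 1 0 0 1 _)) => // x.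
  by rewrite /monom !expr0 expr1 !mul1r.
Qed.

Lemma polyfun_dense (f : S2 R -> R) : continuous f -> forall e : R, 0 < e ->
  exists n, exists2 g, polyfun n g & forall x, `|f x - g x| <= e.
Proof.
move=> cf e e0; pose A : set (S2 R -> R) := [set g | exists n, polyfun n g].
suff [g [n png] fg] : exists2 g, A g & forall x, `|f x - g x| <= e.
  by exists n; exists g.
apply: (stone_weierstrass compact_S2) => //.
- by move=> g [n]; exact: polyfun_continuous.
- by move=> c; exists 0%N; exact: polyfun_cst.
- move=> g h [n pg] [m ph]; exists (n + m)%N; apply: polyfunD.
    by apply: polyfun_le pg; rewrite leq_addr.
  by apply: polyfun_le ph; rewrite leq_addl.
- by move=> g h [n pg] [m ph]; exists (n + m)%N; exact: polyfunM.
move=> x y; have [->|xy] := pselect (x = y).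
  by exists (fun=> f y); split => //; exists 0%N; exact: polyfun_cst.
have [i xyi] : exists i, coor i x <> coor i y.
  by apply/existsNP => h; apply: xy; exact: coor_inj.
pose c := (f y - f x) / (coor i y - coor i x).
exists (fun z => f x + c * (coor i z + - coor i x)); split.
- exists 1%N; apply: polyfunD; first exact: polyfun_cst.
  apply: polyfunZ; apply: polyfunD; first exact: polyfun_coor.
  exact: polyfun_cst.
- by rewrite subrr mulr0 addr0.
- rewrite /c mulfVK ?subrKC// subr_eq0; apply/eqP => h; exact: xyi.
Qed.

(* Applied to the algebra of polynomials in the third coordinate, the
   Stone-Weierstrass theorem on the sphere yields Weierstrass' theorem on [-1, 1]. *)
Lemma weierstrass (F : R -> R) : continuous F -> forall e : R, 0 < e ->
  exists p : {poly R}, forall t, -1 <= t <= 1 -> `|F t - p.[t]| <= e.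
Proof.
move=> cF e e0.
pose A : set (S2 R -> R) := [set g | exists p : {poly R}, g = fun x => p.[coor i2 x]].
suff [_ [p ->] Fp] : exists2 g, A g & forall x, `|F (coor i2 x) - g x| <= e.
  exists p => t /andP[t0 t1].
  (* A point of the sphere at height t: every t in [-1, 1] is a value of the third coordinate. *)
  have h : (Num.sqrt (1 - t ^+ 2)) ^+ 2 + 0 ^+ 2 + t ^+ 2 = 1.
    rewrite sqr_sqrtr; last by nra.
    by ring.
  by have := Fp (mkS2 h); rewrite coor_mkS2.
apply: (stone_weierstrass compact_S2) => //.
- move=> _ [p ->] x; apply: (@continuous_comp _ _ _ (coor i2) (fun t => p.[t])).
    exact: continuous_coor.
  exact: continuous_horner.
- by move=> c; exists c%:P; apply/funext => x; rewrite hornerC.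
- by move=> _ _ [p ->] [q ->]; exists (p + q); apply/funext => x; rewrite hornerD.
- by move=> _ _ [p ->] [q ->]; exists (p * q); apply/funext => x; rewrite hornerM.
- move=> x; apply: (@continuous_comp _ _ _ (coor i2) F).
    exact: continuous_coor.
  exact: cF.
move=> x y; have [xy|xy] := eqVneq (coor i2 x) (coor i2 y).
  (* The algebra does not separate points of equal height, but the function to be approximated does
     not either. *)
  exists (fun x => (F (coor i2 y))%:P.[coor i2 x]); split; rewrite ?hornerC//.
    by exists (F (coor i2 y))%:P.
  by rewrite xy.
pose c := (F (coor i2 y) - F (coor i2 x)) / (coor i2 y - coor i2 x).
exists (fun z => ((F (coor i2 x))%:P + c *: ('X - (coor i2 x)%:P)).[coor i2 z]); split.
- by exists ((F (coor i2 x))%:P + c *: ('X - (coor i2 x)%:P)).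
- by rewrite !hornerE subrr mulr0 addr0.
- by rewrite !hornerE /c mulfVK ?subrKC// subr_eq0 eq_sym.
Qed.

End SphereGeometry.

(** * Integration on the sphere *)

(** Shared by the Cauchy-Schwarz inequalities for integrals and for weighted sums and by the
    polarization of the Marcinkiewicz-Zygmund property. *)
Lemma quadratic_discriminant (R : realType) (F G H : R) : 0 <= F -> 0 <= G ->
  (forall a b : R, 0 <= a ^+ 2 * F ^+ 2 + 2 * a * b * H + b ^+ 2 * G ^+ 2) ->
  `|H| <= F * G.
Proof.
move=> F0 G0 quad.
rewrite -(@ler_pXn2r _ 2) ?nnegrE ?mulr_ge0// real_normK ?num_real// exprMn.
have [F1|F1] := eqVneq F 0.
  have H0 : H = 0.
    apply/eqP; apply: contraT => Hn.
    (* For F = 0 the form is affine in a; this a brings its value down to -1. *)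
    have := quad (- (G ^+ 2 + 1) / (2 * H)) 1; rewrite F1.
    have -> : (- (G ^+ 2 + 1) / (2 * H)) ^+ 2 * 0 ^+ 2 +
      2 * (- (G ^+ 2 + 1) / (2 * H)) * 1 * H + 1 ^+ 2 * G ^+ 2 = -1 by field.
    by lra.
  by rewrite H0 F1 expr0n mul0r.
have := quad (- H) (F ^+ 2).
have -> : (- H) ^+ 2 * F ^+ 2 + 2 * - H * F ^+ 2 * H + F ^+ 2 ^+ 2 * G ^+ 2 =
  F ^+ 2 * (F ^+ 2 * G ^+ 2 - H ^+ 2) by ring.
by rewrite pmulr_rge0 ?subr_ge0// exprn_gt0// lt_def F1.
Qed.

Section SurfaceIntegral.
Context {R : realType}.
Notation mu := (@lebesgue_measure R).
Notation mu2 := (mu \x mu)%E.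
Implicit Types f g : S2 R -> R.

Local Notation M2 := (measurableTypeR R * measurableTypeR R)%type.

Definition Rect : set M2 := `[0, pi]%classic `*` `[0, 2 * pi]%classic.

Definition sL1 (g : S2 R -> R) : Prop :=
  mu2.-integrable Rect (EFin \o (fun p : M2 => g (spherical_pt p) * sin p.1)).

Definition smeas (g : S2 R -> R) : Prop :=
  measurable_fun Rect (fun p : M2 => g (spherical_pt p)).

(** Integrability of the square does not make g itself measurable; the first conjunct is what
    products of two such functions require. *)
Definition sL2 (g : S2 R -> R) : Prop := smeas g /\ sL1 (fun x => g x ^+ 2).

Lemma measurable_Rect : measurable Rect.
Proof. exact: measurableX. Qed.

Lemma Rect_lty : (mu2 Rect < +oo)%E.
Proof.
have h (b : R) : 0 < b -> (mu `[0%R, b]%classic < +oo)%E.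
  by move=> b0; rewrite lebesgue_measure_itv/= lte_fin b0 ltry.
rewrite product_measure1E//; apply: lte_mul_pinfty => //.
  by rewrite ge0_fin_numE//; apply: h; exact: pi_gt0.
by apply: h; rewrite mulr_gt0// pi_gt0.
Qed.

Lemma Rect_sin_ge0 p : Rect p -> 0 <= sin p.1.
Proof. by case=> /= + _; rewrite in_itv/=; exact: sin_ge0_pi. Qed.

Lemma coor_spherical_pt (p : M2) i : coor i (spherical_pt p) =
  [:: sin p.1 * cos p.2; sin p.1 * sin p.2; cos p.1]`_i.
Proof. by rewrite /coor set_valE /= mxE. Qed.

Lemma measurable_sin1 : measurable_fun setT (fun p : M2 => sin p.1).
Proof.
apply: (measurableT_comp (continuous_measurable_fun (@continuous_sin R))).
exact: measurable_fst.
Qed.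

Lemma measurable_coor i : measurable_fun setT (fun p : M2 => coor i (spherical_pt p)).
Proof.
have sC := continuous_measurable_fun (@continuous_sin R).
have cC := continuous_measurable_fun (@continuous_cos R).
have s2 : measurable_fun setT (fun p : M2 => sin p.2).
  exact: (measurableT_comp sC measurable_snd).
have c1 : measurable_fun setT (fun p : M2 => cos p.1).
  exact: (measurableT_comp cC measurable_fst).
have c2 : measurable_fun setT (fun p : M2 => cos p.2).
  exact: (measurableT_comp cC measurable_snd).
under eq_fun do rewrite coor_spherical_pt.
case: i => -[|[|[|//]]] ki /=; last exact: c1.
  exact: (measurable_funM measurable_sin1 c2).
exact: (measurable_funM measurable_sin1 s2).
Qed.

Lemma polyfun_measurable n f : polyfun n f ->
  measurable_fun setT (fun p : M2 => f (spherical_pt p)).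
Proof.
elim => [|c a b d g _ _ mg]; first exact: measurable_cst.
apply: measurable_funD => //; apply: measurable_funM; first exact: measurable_cst.
apply: measurable_funM; first apply: measurable_funM.
- exact: (measurable_funX _ (measurable_coor i0)).
- exact: (measurable_funX _ (measurable_coor i1)).
- exact: (measurable_funX _ (measurable_coor i2)).
Qed.

(** The pull-back is a pointwise limit of polynomials in the coordinates, whose measurability is
    explicit; no sigma-algebra on the sphere is involved. *)
Lemma continuous_S2_measurable f : continuous f ->
  measurable_fun setT (fun p : M2 => f (spherical_pt p)).
Proof.
move=> cf.
have h n : exists g, (exists m, polyfun m g) /\ forall x : S2 R, `|f x - g x| <= n.+1%:R^-1.
  have [|m [g pg fg]] := polyfun_dense cf (e := n.+1%:R^-1); first by rewrite invr_gt0.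
  by exists g; split => //; exists m.
have {h} [g gP] := choice h.
apply: (@measurable_fun_cvg _ _ _ _ (fun n p => g n (spherical_pt p))).
  by move=> n; have [[m pm] _] := gP n; exact: polyfun_measurable pm.
move=> p _; apply/cvgrPdist_le => e e0.
near=> n; have [_ /(_ (spherical_pt p))/le_trans] := gP n; apply; apply: ltW.
by near: n; exact: (near_infty_natSinv_lt (PosNum e0)).
Unshelve. all: by end_near. Qed.

Lemma smeas_continuous f : continuous f -> smeas f.
Proof. by move=> cf; apply: measurable_funTS; exact: continuous_S2_measurable. Qed.

Lemma sL1_bounded f M : smeas f -> (forall x, `|f x| <= M) -> sL1 f.
Proof.
move=> mf fM; apply: measurable_bounded_integrable.
- exact: measurable_Rect.
- exact: Rect_lty.
- by apply: measurable_funM => //; apply: measurable_funTS; exact: measurable_sin1.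
exists M; split; first exact: num_real.
move=> N MN p _ /=; rewrite normrM; apply: le_trans (ltW MN).
rewrite -[leRHS]mulr1; apply: ler_pM => //.
by rewrite ler_norml sin_geN1 sin_le1.
Qed.

Lemma sL1_continuous f : continuous f -> sL1 f.
Proof.
move=> cf; have [M M0 fM] := continuous_bounded_compact compact_S2 cf.
exact: (sL1_bounded (smeas_continuous cf) fM).
Qed.

Lemma sL2_continuous f : continuous f -> sL2 f.
Proof.
move=> cf; split; first exact: smeas_continuous.
apply: sL1_continuous => x.
apply: (@continuous_comp _ _ _ f (fun t => t ^+ 2)); first exact: cf.
exact: exprn_continuous.
Qed.

Lemma eq_sL1 f g : (forall x, f x = g x) -> sL1 f -> sL1 g.
Proof. by move=> /funext ->. Qed.

Lemma sL1D f g : sL1 f -> sL1 g -> sL1 (fun x => f x + g x).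
Proof.
move=> If Ig; apply: (eq_integrable measurable_Rect _ _ _ (integrableD measurable_Rect If Ig)).
by move=> p _ /=; rewrite mulrDl EFinD.
Qed.

Lemma sL1Z c f : sL1 f -> sL1 (fun x => c * f x).
Proof.
move=> If; apply: (eq_integrable measurable_Rect _ _ _ (integrableZl measurable_Rect c If)).
by move=> p _ /=; rewrite -mulrA EFinM.
Qed.

Lemma sL1_le f g : smeas f -> (forall x, `|f x| <= `|g x|) -> sL1 g -> sL1 f.
Proof.
move=> mf fg; apply: le_integrable; first exact: measurable_Rect.
  apply/measurable_EFinP; apply: measurable_funM => //.
  by apply: measurable_funTS; exact: measurable_sin1.
by move=> p _; rewrite /= lee_fin !normrM ler_wpM2r.
Qed.

Lemma surf_intD f g : sL1 f -> sL1 g ->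
  surf_int (fun x => f x + g x) = surf_int f + surf_int g.
Proof.
move=> If Ig; rewrite /surf_int -RintegralD//; last exact: measurable_Rect.
by congr Rintegral; apply/funext => p; rewrite mulrDl.
Qed.

Lemma surf_intZ c f : sL1 f -> surf_int (fun x => c * f x) = c * surf_int f.
Proof.
move=> If; rewrite /surf_int -RintegralZl//; last exact: measurable_Rect.
by congr Rintegral; apply/funext => p; rewrite mulrA.
Qed.

Lemma surf_intB f g : sL1 f -> sL1 g ->
  surf_int (fun x => f x - g x) = surf_int f - surf_int g.
Proof.
move=> If Ig; have -> : (fun x => f x - g x) = (fun x => f x + (-1) * g x).
  by apply/funext => x; rewrite mulN1r.
by rewrite surf_intD ?surf_intZ ?mulN1r//; exact: sL1Z.
Qed.

Lemma sL1B f g : sL1 f -> sL1 g -> sL1 (fun x => f x - g x).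
Proof.
move=> If Ig; apply: (@eq_sL1 (fun x => f x + (-1) * g x)).
  by move=> x; rewrite mulN1r.
by apply: sL1D => //; exact: sL1Z.
Qed.

Lemma surf_int0 : surf_int (fun=> 0) = 0 :> R.
Proof.
rewrite /surf_int /Rintegral integral0_eq// => p _.
by rewrite mul0r.
Qed.

Lemma sL1_0 : sL1 (fun=> 0).
Proof. apply: sL1_continuous => x; exact: cst_continuous. Qed.

Lemma sL1_sum (I : Type) (s : seq I) (P : pred I) (F : I -> S2 R -> R) :
  (forall i, P i -> sL1 (F i)) -> sL1 (fun x => \sum_(i <- s | P i) F i x).
Proof.
move=> IF; elim: s => [|i s IH].
  by apply: eq_sL1 sL1_0 => x; rewrite big_nil.
case: (boolP (P i)) => Pi.
  by apply: eq_sL1 (sL1D (IF _ Pi) IH) => x; rewrite big_cons Pi.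
by apply: eq_sL1 IH => x; rewrite big_cons (negbTE Pi).
Qed.

Lemma surf_int_sum (I : Type) (s : seq I) (P : pred I) (F : I -> S2 R -> R) :
  (forall i, P i -> sL1 (F i)) ->
  surf_int (fun x => \sum_(i <- s | P i) F i x) = \sum_(i <- s | P i) surf_int (F i).
Proof.
move=> IF; elim: s => [|i s IH].
  by under eq_fun do rewrite big_nil; rewrite big_nil surf_int0.
rewrite big_cons; case: ifPn => Pi.
  rewrite -IH -surf_intD; [|exact: IF|exact: sL1_sum].
  by congr surf_int; apply/funext => x; rewrite big_cons Pi.
by rewrite -IH; congr surf_int; apply/funext => x; rewrite big_cons (negbTE Pi).
Qed.

Lemma surf_int_ge0 f : (forall x, 0 <= f x) -> 0 <= surf_int f.
Proof.
move=> f0; apply: Rintegral_ge0 => p /Rect_sin_ge0 s0.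
by rewrite mulr_ge0.
Qed.

Lemma surf_int_le f g : sL1 f -> sL1 g -> (forall x, f x <= g x) ->
  surf_int f <= surf_int g.
Proof.
move=> If Ig fg; rewrite -subr_ge0 -surf_intB//.
by apply: surf_int_ge0 => x; rewrite subr_ge0.
Qed.

Lemma smeasD f g : smeas f -> smeas g -> smeas (fun x => f x + g x).
Proof. exact: measurable_funD. Qed.

Lemma smeasM f g : smeas f -> smeas g -> smeas (fun x => f x * g x).
Proof. exact: measurable_funM. Qed.

Lemma smeas_cst c : smeas (fun=> c).
Proof. exact: measurable_cst. Qed.

Lemma sL2M f g : sL2 f -> sL2 g -> sL1 (fun x => f x * g x).
Proof.
move=> [mf If] [mg Ig]; apply: (@sL1_le _ (fun x => f x ^+ 2 + g x ^+ 2)).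
- exact: smeasM.
- move=> x; rewrite [leRHS]ger0_norm ?addr_ge0 ?sqr_ge0//.
  rewrite normrM -(real_normK (num_real (f x))) -(real_normK (num_real (g x))).
  have := normr_ge0 (f x); have := normr_ge0 (g x).
  move: `|f x| `|g x| => a b a0 b0; have := sqr_ge0 (a - b); nra.
- exact: sL1D.
Qed.

Lemma sL2Z c f : sL2 f -> sL2 (fun x => c * f x).
Proof.
move=> [mf If]; split; first exact: smeasM (smeas_cst _) mf.
by apply: eq_sL1 (sL1Z (c ^+ 2) If) => x; rewrite exprMn.
Qed.

Lemma sL2D f g : sL2 f -> sL2 g -> sL2 (fun x => f x + g x).
Proof.
move=> Lf Lg; split; first by apply: smeasD; [exact: Lf.1|exact: Lg.1].
apply: (@eq_sL1 (fun x => (f x ^+ 2 + g x ^+ 2) + 2 * (f x * g x))).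
  by move=> x; ring.
by apply: sL1D; [apply: sL1D; [exact: Lf.2|exact: Lg.2]|apply: sL1Z; exact: sL2M].
Qed.

Lemma sL2B f g : sL2 f -> sL2 g -> sL2 (fun x => f x - g x).
Proof.
move=> Lf Lg; have := sL2D Lf (sL2Z (-1) Lg).
by under eq_fun do rewrite mulN1r.
Qed.

Lemma L2norm_ge0 f : 0 <= L2norm f.
Proof. exact: sqrtr_ge0. Qed.

Lemma L2norm_sqr f : L2norm f ^+ 2 = surf_int (fun x => f x ^+ 2).
Proof. by rewrite sqr_sqrtr//; apply: surf_int_ge0 => x; exact: sqr_ge0. Qed.

Lemma cauchy_schwarz f g : sL2 f -> sL2 g ->
  `|surf_int (fun x => f x * g x)| <= L2norm f * L2norm g.
Proof.
move=> Lf Lg; set H := surf_int _.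
have quad (a b : R) : 0 <= a ^+ 2 * L2norm f ^+ 2 + 2 * a * b * H + b ^+ 2 * L2norm g ^+ 2.
  have /le_trans -> // : 0 <= surf_int (fun x => (a * f x + b * g x) ^+ 2).
    by apply: surf_int_ge0 => x; exact: sqr_ge0.
  have -> : (fun x => (a * f x + b * g x) ^+ 2) = (fun x => (a ^+ 2 * f x ^+ 2 +
      (2 * a * b) * (f x * g x)) + b ^+ 2 * g x ^+ 2) by apply/funext => x; ring.
  have I1 := sL1Z (a ^+ 2) Lf.2; have I2 := sL1Z (b ^+ 2) Lg.2.
  have I3 := sL1Z (2 * a * b) (sL2M Lf Lg).
  rewrite surf_intD// ?surf_intD// ?surf_intZ ?L2norm_sqr//.
  - exact: Lg.2.
  - exact: sL2M.
  - exact: Lf.2.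
  - exact: sL1D.
by apply: quadratic_discriminant quad; exact: L2norm_ge0.
Qed.

Lemma L2norm_le f M : sL2 f -> 0 <= M -> (forall x, `|f x| <= M) ->
  L2norm f <= L2norm (fun=> 1) * M.
Proof.
move=> Lf M0 fM; rewrite -(@ler_pXn2r _ 2) ?nnegrE ?mulr_ge0 ?L2norm_ge0//.
have c1 : sL1 (fun=> 1) by apply: sL1_continuous => x; exact: cst_continuous.
rewrite exprMn !L2norm_sqr mulrC.
have -> : (fun _ : S2 R => 1 ^+ 2) = (fun=> 1) :> (S2 R -> R).
  by apply/funext => x; rewrite expr1n.
rewrite -surf_intZ//; apply: surf_int_le; [exact: Lf.2|exact: sL1Z|].
move=> x; rewrite mulr1 -(real_normK (num_real (f x))).
by rewrite ler_pXn2r ?nnegrE.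
Qed.

End SurfaceIntegral.

(** * Archimedes' theorem *)

Section Archimedes.
Context {R : realType}.
Notation mu := (@lebesgue_measure R).
Notation mu2 := (mu \x mu)%E.
Notation M2 := (measurableTypeR R * measurableTypeR R)%type.

(** This and the following rules have their functions in eta-expanded form, so that [deriv_tac] can
    unify them with an explicit expression. *)
Lemma deriv_cst (c x : R) : is_derive x (1 : R) (fun=> c) 0.
Proof. exact: is_derive_cst. Qed.

Lemma derivD (f g : R -> R) (x a b : R) : is_derive x (1 : R) f a ->
  is_derive x (1 : R) g b -> is_derive x (1 : R) (fun t => f t + g t) (a + b).
Proof. exact: is_deriveD. Qed.

Lemma derivN (f : R -> R) (x a : R) : is_derive x (1 : R) f a ->
  is_derive x (1 : R) (fun t => - f t) (- a).
Proof. exact: is_deriveN. Qed.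

Lemma derivM (f g : R -> R) (x a b : R) : is_derive x (1 : R) f a ->
  is_derive x (1 : R) g b -> is_derive x (1 : R) (fun t => f t * g t) (f x * b + g x * a).
Proof. exact: is_deriveM. Qed.

Lemma derivX n (f : R -> R) (x a : R) : is_derive x (1 : R) f a ->
  is_derive x (1 : R) (fun t => f t ^+ n) (n%:R * f x ^+ n.-1 * a).
Proof.
by move=> df; have := @is_deriveX R R f n x 1 a df; rewrite exprfctE.
Qed.

Lemma deriv_eq (f : R -> R) (x a b : R) : is_derive x (1 : R) f a -> a = b ->
  is_derive x (1 : R) f b.
Proof. by move=> ? <-. Qed.

Lemma integral_derivative (F f : R -> R) (a b : R) : a < b ->
  (forall x : R, is_derive x (1 : R) F (f x)) -> continuous f ->
  (\int[mu]_(x in `[a, b]) (f x)%:E = (F b - F a)%:E)%E.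
Proof.
move=> ab Ff cf; have cF : continuous F.
  move=> x; apply: differentiable_continuous; apply/derivable1_diffP.
  by have [] := Ff x.
rewrite (@continuous_FTC2 _ f F) ?EFinB//.
- exact: continuous_subspaceT.
- split => [x _||]; first by have [] := Ff x.
    by apply: cvg_at_right_filter; exact: cF.
  by apply: cvg_at_left_filter; exact: cF.
- by move=> x _; rewrite derive1E; have [] := Ff x.
Qed.

(** Fubini's theorem in the form suited to exact derivatives, whose integral vanishes along every
    line in one direction. *)
Lemma Rect_iterated_eq0 (G : M2 -> R) : mu2.-integrable Rect (EFin \o G) ->
  (forall x, \int[mu]_(y in `[0%R, (2 * pi)%R]) (G (x, y))%:E = 0)%E ->
  Rintegral mu2 Rect G = 0.
Proof.
move=> IG G0; rewrite /Rintegral integral_mkcond -integral12_prod_meas1; last first.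
  exact: (integrable_mkcond _ measurable_Rect).1.
rewrite integral0_eq// => x _; rewrite /fubini_F.
have [x0|x0] := boolP (x \in `[0, pi]).
  rewrite -[RHS](G0 x) [RHS]integral_mkcond; apply: eq_integral => y _.
  rewrite /patch; congr (if _ then _ else _).
  by apply/idP/idP => /set_mem h; apply/mem_set; [case: h|split].
rewrite integral0_eq// => y _; rewrite /patch ifF//.
by apply/negP; rewrite inE => -[/=]; rewrite (negbTE x0).
Qed.

Lemma Rect_iterated_eq0' (G : M2 -> R) : mu2.-integrable Rect (EFin \o G) ->
  (forall y, \int[mu]_(x in `[0%R, pi%R]) (G (x, y))%:E = 0)%E ->
  Rintegral mu2 Rect G = 0.
Proof.
move=> IG G0; rewrite /Rintegral integral_mkcond -integral21_prod_meas1; last first.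
  exact: (integrable_mkcond _ measurable_Rect).1.
rewrite integral0_eq// => y _; rewrite /fubini_G.
have [y0|y0] := boolP (y \in `[0, 2 * pi]).
  rewrite -[RHS](G0 y) [RHS]integral_mkcond; apply: eq_integral => x _.
  rewrite /patch; congr (if _ then _ else _).
  by apply/idP/idP => /set_mem h; apply/mem_set; [case: h|split].
rewrite integral0_eq// => x _; rewrite /patch ifF//.
by apply/negP; rewrite inE => -[/= _]; rewrite (negbTE y0).
Qed.

(** The integrands of the moment recursion lie in this class; integrability on the rectangle and
    continuity of the sections follow by induction on their construction. *)
Inductive trigpoly : (M2 -> R) -> Prop :=
| trig_cst c : trigpoly (fun=> c)
| trig_sin1 : trigpoly (fun p => sin p.1)
| trig_cos1 : trigpoly (fun p => cos p.1)
| trig_sin2 : trigpoly (fun p => sin p.2)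
| trig_cos2 : trigpoly (fun p => cos p.2)
| trigD f g : trigpoly f -> trigpoly g -> trigpoly (fun p => f p + g p)
| trigM f g : trigpoly f -> trigpoly g -> trigpoly (fun p => f p * g p).

Lemma trigN f : trigpoly f -> trigpoly (fun p => - f p).
Proof.
move=> tf; have := trigM (trig_cst (-1)) tf.
by under eq_fun do rewrite mulN1r.
Qed.

Lemma trigX n f : trigpoly f -> trigpoly (fun p => f p ^+ n).
Proof.
move=> tf; elim: n => [|n IH].
  by under eq_fun do rewrite expr0; exact: trig_cst.
by under eq_fun do rewrite exprS; exact: trigM.
Qed.

Lemma trigpoly_integrable f : trigpoly f -> mu2.-integrable Rect (EFin \o f).
Proof.
move=> tf; suff [mf [M fM]] : measurable_fun setT f /\ exists M, forall p, `|f p| <= M.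
  apply: measurable_bounded_integrable.
  - exact: measurable_Rect.
  - exact: Rect_lty.
  - exact: measurable_funTS.
  exists M; split; first exact: num_real.
  by move=> N MN p _ /=; exact: le_trans (fM p) (ltW MN).
have sC := continuous_measurable_fun (@continuous_sin R).
have cC := continuous_measurable_fun (@continuous_cos R).
have s1 (t : R) : `|sin t| <= 1 by rewrite ler_norml sin_geN1 sin_le1.
have c1 (t : R) : `|cos t| <= 1 by rewrite ler_norml cos_geN1 cos_le1.
elim: tf => [c|||||{}f g _ [mf [M fM]] _ [mg [N gN]]|{}f g _ [mf [M fM]] _ [mg [N gN]]].
- by split; [exact: measurable_cst|exists `|c|].
- by split; [exact: (measurableT_comp sC measurable_fst)|exists 1].
- by split; [exact: (measurableT_comp cC measurable_fst)|exists 1].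
- by split; [exact: (measurableT_comp sC measurable_snd)|exists 1].
- by split; [exact: (measurableT_comp cC measurable_snd)|exists 1].
- split; first exact: measurable_funD.
  by exists (M + N) => p; rewrite (le_trans (ler_normD _ _))// lerD.
- split; first exact: measurable_funM.
  by exists (M * N) => p; rewrite normrM ler_pM.
Qed.

Lemma trigpoly_continuous1 f y : trigpoly f -> continuous (fun x => f (x, y)).
Proof.
elim=> [c|||||{}f g _ cf _ cg|{}f g _ cf _ cg] x /=.
- exact: cst_continuous.
- exact: continuous_sin.
- exact: continuous_cos.
- exact: cst_continuous.
- exact: cst_continuous.
- exact: (cvgD (cf x) (cg x)).
- exact: (cvgM (cf x) (cg x)).
Qed.

Lemma trigpoly_continuous2 f x : trigpoly f -> continuous (fun y => f (x, y)).
Proof.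
elim=> [c|||||{}f g _ cf _ cg|{}f g _ cf _ cg] y /=.
- exact: cst_continuous.
- exact: cst_continuous.
- exact: cst_continuous.
- exact: continuous_sin.
- exact: continuous_cos.
- exact: (cvgD (cf y) (cg y)).
- exact: (cvgM (cf y) (cg y)).
Qed.

End Archimedes.

Ltac trigpoly_tac := repeat first
  [ exact: trig_sin1 | exact: trig_cos1 | exact: trig_sin2 | exact: trig_cos2
  | exact: trig_cst | apply: trigX | apply: trigN | apply: trigM | apply: trigD ].

Ltac deriv_tac := repeat first
  [ exact: is_derive_sin | exact: is_derive_cos | exact: deriv_cst
  | apply: derivN | apply: derivM | apply: derivD ].

(** * Moments of x.y and integrals of continuous zonal functions *)

Section Moments.
Context {R : realType}.
Notation mu := (@lebesgue_measure R).
Notation mu2 := (mu \x mu)%E.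
Notation M2 := (measurableTypeR R * measurableTypeR R)%type.

(* Up to the factor n + 1, the integrand is the Laplace-Beltrami operator
   d/dtheta (sin theta d/dtheta) + d/dphi (1 / sin theta d/dphi)
   applied to the (n + 1)-st power of y |-> x.y, hence it integrates to 0. *)
Lemma dot_moment_rec n (x : S2 R) :
  n.+2%:R * surf_int (fun y => dot x y ^+ n.+1) =
  n%:R * surf_int (fun y => dot x y ^+ n.-1).
Proof.
set u1 := coor i0 x; set u2 := coor i1 x; set u3 := coor i2 x.
have u1E : u1 ^+ 2 + u2 ^+ 2 + u3 ^+ 2 = 1 by exact: coor_sqr.
(* In spherical coordinates P is x.y, P1 is its derivative in theta, and w is its derivative in phi
   divided by sin theta; in this form nothing is singular at the poles. *)
pose v (p : M2) : R := u1 * cos p.2 + u2 * sin p.2.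
pose w (p : M2) : R := u2 * cos p.2 + - (u1 * sin p.2).
pose P (p : M2) : R := sin p.1 * v p + u3 * cos p.1.
pose P1 (p : M2) : R := cos p.1 * v p + - (u3 * sin p.1).
have dotP p : dot x (spherical_pt p) = P p.
  by rewrite /dot !coor_spherical_pt /= -/u1 -/u2 -/u3 /P /v; ring.
(* A' is the theta-derivative of sin theta P^n P1, whose boundary values vanish because sin 0 = sin
   pi = 0. B' is the phi-derivative of P^n w, which is periodic in phi. *)
pose A' (p : M2) := cos p.1 * (P p ^+ n * P1 p) +
  sin p.1 * (n%:R * P p ^+ n.-1 * P1 p * P1 p + - (P p ^+ n * P p)).
pose B' (p : M2) := n%:R * P p ^+ n.-1 * (sin p.1 * w p) * w p + - (P p ^+ n * v p).
have tA : trigpoly A' by rewrite /A' /P /P1 /v; trigpoly_tac.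
have tB : trigpoly B' by rewrite /B' /P /w /v; trigpoly_tac.
have A0 : Rintegral mu2 Rect A' = 0.
  apply: Rect_iterated_eq0' => [|y]; first exact: trigpoly_integrable.
  have dP t : is_derive t (1 : R) (fun t => P (t, y)) (P1 (t, y)).
    apply: deriv_eq; first by rewrite /P /v /=; deriv_tac.
    by rewrite /P1 /v /= /GRing.scale /=; ring.
  have dP1 t : is_derive t (1 : R) (fun t => P1 (t, y)) (- P (t, y)).
    apply: deriv_eq; first by rewrite /P1 /v /=; deriv_tac.
    by rewrite /P /v /= /GRing.scale /=; ring.
  have dA t : is_derive t (1 : R) (fun t => sin t * (P (t, y) ^+ n * P1 (t, y))) (A' (t, y)).
    apply: (deriv_eq (derivM (is_derive_sin t) (derivM (derivX n (dP t)) (dP1 t)))).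
    rewrite /A' /=; move: (P1 _) (P _) (P _ ^+ n.-1) (P _ ^+ n) n%:R => a b c d e.
    by ring.
  rewrite (integral_derivative (pi_gt0 _) dA) ?sin0 ?sinpi ?mul0r ?subrr//.
  exact: trigpoly_continuous1.
have B0 : Rintegral mu2 Rect B' = 0.
  apply: Rect_iterated_eq0 => [|t]; first exact: trigpoly_integrable.
  have dP y : is_derive y (1 : R) (fun y => P (t, y)) (sin t * w (t, y)).
    apply: deriv_eq; first by rewrite /P /v /=; deriv_tac.
    by rewrite /w /= /GRing.scale /=; ring.
  have dw y : is_derive y (1 : R) (fun y => w (t, y)) (- v (t, y)).
    apply: deriv_eq.
    by rewrite /v /= /GRing.scale /=; ring.
  have dB y : is_derive y (1 : R) (fun y => P (t, y) ^+ n * w (t, y)) (B' (t, y)).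
    apply: (deriv_eq (derivM (derivX n (dP y)) (dw y))).
    rewrite /B' /=; move: (v _) (w _) (P _ ^+ n.-1) (P _ ^+ n) n%:R => a b c d e.
    by ring.
  rewrite (integral_derivative _ dB) ?mulr_gt0 ?pi_gt0//.
    by rewrite /P /w /v /= [2 * pi]mulrC mulr_natr sin2pi cos2pi sin0 cos0 subrr.
  exact: trigpoly_continuous2.
have cX k : continuous (fun y => dot x y ^+ k).
  move=> y; apply: (@continuous_comp _ _ _ (dot x) (fun t => t ^+ k)).
    exact: continuous_dot.
  exact: exprn_continuous.
have L1X k := sL1_continuous (cX k).
rewrite -!surf_intZ//; apply/eqP; rewrite -subr_eq0 -surf_intB; last 2 first.
- exact: sL1Z.
- exact: sL1Z.
rewrite -[X in _ == X]oppr0 -[X in - X]addr0 -{1}A0 -{1}B0.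
rewrite -RintegralD; last 3 first.
- exact: measurable_Rect.
- exact: trigpoly_integrable.
- exact: trigpoly_integrable.
rewrite -mulN1r -RintegralZl; last 2 first.
- exact: measurable_Rect.
- exact: (trigpoly_integrable (trigD tA tB)).
apply/eqP; congr Rintegral; apply/funext => p; rewrite !dotP /A' /B'.
have vw : v p ^+ 2 + w p ^+ 2 = u1 ^+ 2 + u2 ^+ 2.
  rewrite /v /w; have := cos2Dsin2 p.2; set c := cos p.2; set s := sin p.2 => cs.
  transitivity ((u1 ^+ 2 + u2 ^+ 2) * (c ^+ 2 + s ^+ 2)); first by ring.
  by rewrite cs mulr1.
have cs := cos2Dsin2 p.1.
(* The squared length of the tangential gradient of x.y is P1^2 + w^2 = 1 - P^2; here |x| = 1
   enters, through [u1E]. *)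
have e1 : P1 p * P1 p = 1 - P p * P p - w p * w p.
  have -> : P1 p * P1 p = (cos p.1 ^+ 2 + sin p.1 ^+ 2) * (v p ^+ 2 + u3 ^+ 2) - P p * P p.
    by rewrite /P1 /P; ring.
  by rewrite cs mul1r -[1 in RHS]u1E -vw; ring.
have e2 : cos p.1 * P1 p = v p - sin p.1 * P p.
  have -> : cos p.1 * P1 p = (cos p.1 ^+ 2 + sin p.1 ^+ 2) * v p - sin p.1 * P p.
    by rewrite /P1 /P; ring.
  by rewrite cs mul1r.
symmetry; move: e1 e2; move: (P1 p) (P p) (v p) (w p) (cos p.1) (sin p.1).
(* For n = 0 the exponent [n.-1] is truncated, but its coefficient n vanishes. *)
case: n {A' B' tA tB A0 B0 cX L1X} => [|n] a b d e c s e1 e2 /=.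
  rewrite expr0 expr1; transitivity (- (c * a - s * b - d)); first by ring.
  by rewrite e2; ring.
rewrite !exprS; move: (b ^+ n) => q.
transitivity (- (c * a * b * q + s * (n.+1%:R * q * (a * a) - b * q * b) +
  n.+1%:R * q * s * e * e - b * q * d)); first by ring.
by rewrite e1 e2 -[n.+3%:R]natr1 -[n.+2%:R]natr1; ring.
Qed.

(** The last factor is the integral of t^n over [-1, 1]. The recursion lowers the exponent by two;
    its case 0 says that the first moment vanishes. The total area appears only as a factor and is
    never evaluated. *)
Lemma dot_moment n (x : S2 R) :
  surf_int (fun y => dot x y ^+ n) =
  surf_int (fun _ : S2 R => 1) / 2 * ((1 - (-1) ^+ n.+1) / n.+1%:R).
Proof.
have [m] := ubnP n; elim: m n => // m IH [|[|n]] nm.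
- rewrite (_ : (fun y => dot x y ^+ 0) = (fun=> 1)); last by apply/funext => y; rewrite expr0.
  by rewrite expr1; field.
- have := dot_moment_rec 0 x; rewrite mul0r => /eqP.
  rewrite mulf_eq0 pnatr_eq0/= => /eqP ->.
  by rewrite expr2 mulrNN mulr1 subrr mul0r mulr0.
have := dot_moment_rec n.+1 x; rewrite /= [in RHS]IH; last by rewrite ltnS in nm; exact: ltnW.
move=> h; have n3 : n.+3%:R != 0 :> R by rewrite pnatr_eq0.
apply: (mulfI n3); rewrite h !exprS.
move: (surf_int _) ((-1) ^+ n) => a b.
by field; apply/andP; split; apply: lt0r_neq0; rewrite ltr_wpDr.
Qed.

Lemma integral_horner (p : {poly R}) :
  Rintegral mu `[-1, 1]%classic (fun t => p.[t]) =
  \sum_(i < size p) p`_i * ((1 - (-1) ^+ i.+1) / i.+1%:R).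
Proof.
pose q := \poly_(i < (size p).+1) (p`_i.-1 / i%:R).
have qE : q^`() = p.
  apply/polyP => i; rewrite coef_deriv coef_poly ltnS.
  case: ltnP => ip; last by rewrite mul0rn nth_default.
  by rewrite /= -[_ *+ _]mulr_natr mulfVK// pnatr_eq0.
have dq t : is_derive t (1 : R) (horner q) p.[t].
  by rewrite -[in X in is_derive _ _ _ X]qE; exact: is_derive_poly.
have ab : -1 < 1 :> R by lra.
rewrite /Rintegral (integral_derivative ab dq) /=; last exact: continuous_horner.
rewrite !horner_poly -sumrB big_ord_recl invr0 mulr0 !mul0r subrr add0r.
by apply: eq_bigr => i _; rewrite /= -mulrBr expr1n -!mulrA [_^-1 * _]mulrC.
Qed.

Lemma surf_int_horner_dot (p : {poly R}) (x : S2 R) :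
  surf_int (fun y => p.[dot x y]) =
  surf_int (fun _ : S2 R => 1) / 2 * Rintegral mu `[-1, 1]%classic (fun t => p.[t]).
Proof.
have cX k : continuous (fun y => dot x y ^+ k).
  move=> y; apply: (@continuous_comp _ _ _ (dot x) (fun t => t ^+ k)).
    exact: continuous_dot.
  exact: exprn_continuous.
have -> : (fun y => p.[dot x y]) = (fun y => \sum_(i < size p) p`_i * dot x y ^+ i).
  by apply/funext => y; rewrite horner_coef.
rewrite surf_int_sum; last by move=> i _; apply: sL1Z; exact: sL1_continuous.
rewrite integral_horner mulr_sumr; apply: eq_bigr => i _.
by rewrite surf_intZ ?dot_moment; [ring|exact: sL1_continuous].
Qed.

Lemma surf_int_comp_dot (F : R -> R) (x : S2 R) : continuous F ->
  surf_int (fun y => F (dot x y)) =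
  surf_int (fun _ : S2 R => 1) / 2 * Rintegral mu `[-1, 1]%classic F.
Proof.
move=> cF; set A := surf_int (fun=> 1).
have A0 : 0 <= A by exact: surf_int_ge0.
have mI : measurable (`[-1, 1]%classic : set (measurableTypeR R)) by [].
have II (G : R -> R) : continuous G -> mu.-integrable `[-1, 1]%classic (EFin \o G).
  move=> cG; apply: continuous_compact_integrable; first exact: segment_compact.
  exact: continuous_subspaceT.
have cc (c : R) : continuous (fun _ : R => c) by move=> t; exact: cst_continuous.
have I2 c : Rintegral mu `[-1, 1]%classic (fun=> c) = 2 * c.
  have muI : mu `[(-1)%R, 1%R]%classic = 2%:E.
    by rewrite lebesgue_measure_itv/= lte_fin ifT ?EFinB ?opprK//; lra.
  rewrite Rintegral_cst//; transitivity (c * fine (2%:E : \bar R)); last by rewrite mulrC.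
  by congr (_ * fine _).
have cdot (G : R -> R) : continuous G -> continuous (fun y => G (dot x y)).
  move=> cG y; apply: (@continuous_comp _ _ _ (dot x) G); last exact: cG.
  exact: continuous_dot.
apply/eqP; rewrite -subr_eq0 -normr_le0; apply/ler_addgt0Pr => e e0; rewrite add0r.
(* A uniform error d costs d A on the sphere and A / 2 times 2 d on the interval; the added 1 covers
   the case A = 0. *)
pose d := e / (2 * A + 1).
have A1 : 0 < 2 * A + 1 by rewrite ltr_wpDl// mulr_ge0.
have d0 : 0 < d by rewrite divr_gt0.
have [p Fp] := weierstrass cF d0.
have cp : continuous (horner p) by exact: continuous_horner.
have dp y : `|F (dot x y) - p.[dot x y]| <= d by apply: Fp; rewrite dot_geN1 dot_le1.
have s1 := @sL1_continuous _ (fun y => F (dot x y)) (cdot _ cF).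
have s2 := @sL1_continuous _ (fun y => p.[dot x y]) (cdot _ cp).
have sc c : sL1 (fun _ : S2 R => c) by apply: sL1_continuous => y; exact: cst_continuous.
have ubS : surf_int (fun y => F (dot x y)) - surf_int (fun y => p.[dot x y]) <= d * A.
  rewrite -surf_intB// -surf_intZ//; apply: surf_int_le.
  - exact: sL1B.
  - exact: sL1Z.
  - by move=> y /=; rewrite mulr1; have := dp y; rewrite ler_norml => /andP[].
have lbS : - (d * A) <= surf_int (fun y => F (dot x y)) - surf_int (fun y => p.[dot x y]).
  rewrite -mulNr -surf_intB// -surf_intZ//; apply: surf_int_le.
  - exact: sL1Z.
  - exact: sL1B.
  - by move=> y /=; rewrite mulr1; have := dp y; rewrite ler_norml => /andP[].
have ubI : Rintegral mu `[-1, 1]%classic F - Rintegral mu `[-1, 1]%classic (horner p) <= 2 * d.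
  rewrite -RintegralB//; try exact: II.
  rewrite -I2; apply: le_Rintegral => //; [|exact: II|].
    by apply: (II (fun t => F t - p.[t])) => t; exact: (cvgB (cF t) (cp t)).
  by move=> t; rewrite /= in_itv => /Fp; rewrite ler_norml => /andP[].
have lbI : - (2 * d) <= Rintegral mu `[-1, 1]%classic F - Rintegral mu `[-1, 1]%classic (horner p).
  rewrite -RintegralB//; try exact: II.
  rewrite -mulrN -I2; apply: le_Rintegral => //; [exact: II| |].
    by apply: (II (fun t => F t - p.[t])) => t; exact: (cvgB (cF t) (cp t)).
  by move=> t; rewrite /= in_itv => /Fp; rewrite ler_norml => /andP[].
have E : surf_int (fun y => p.[dot x y]) = A / 2 * Rintegral mu `[-1, 1]%classic (horner p).
  exact: surf_int_horner_dot.
have dE : 2 * (d * A) + d = e by rewrite -[RHS](mulfVK (lt0r_neq0 A1)) -/d; ring.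
rewrite E in ubS lbS; rewrite ler_norml.
pose i := Rintegral mu `[-1, 1]%classic F.
pose j := Rintegral mu `[-1, 1]%classic (horner p).
have {}ubI : i - j <= 2 * d := ubI.
have {}lbI : - (2 * d) <= i - j := lbI.
rewrite -/i -/j in ubS lbS *.
have h1 : A / 2 * (i - j) <= A / 2 * (2 * d) by apply: ler_wpM2l => //; rewrite divr_ge0.
have h2 : A / 2 * - (2 * d) <= A / 2 * (i - j) by apply: ler_wpM2l => //; rewrite divr_ge0.
apply/andP; split; lra.
Qed.

End Moments.

(** * The kernel in L^2 *)

Lemma continuous_maxr (R : realType) (T : topologicalType) (f g : T -> R) :
  continuous f -> continuous g -> continuous (fun t => Num.max (f t) (g t)).
Proof. by move=> cf cg t; exact: (continuous_max (cf t) (cg t)). Qed.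

Lemma continuous_minr (R : realType) (T : topologicalType) (f g : T -> R) :
  continuous f -> continuous g -> continuous (fun t => Num.min (f t) (g t)).
Proof. by move=> cf cg t; exact: (continuous_min (cf t) (cg t)). Qed.

Section ContinuousKernel.
Context {R : realType}.

Lemma near_uniform_compact (T U : topologicalType) (G : U * T -> R) (x : U) (e : R) :
  compact [set: T] -> continuous G -> 0 < e ->
  \forall x' \near x, forall y : T, `|G (x, y) - G (x', y)| <= e.
Proof.
move=> cT cG e0; have e20 : 0 < e / 2 by rewrite divr_gt0.
have cover := (compact_near_coveringP [set: T]).1 cT U (nbhs x)
  (fun x' y => `|G (x, y) - G (x', y)| <= e) _.
suff : \forall x' \near x, [set: T] `<=` (fun y => `|G (x, y) - G (x', y)| <= e).
  by apply: filterS => i h y; exact: h.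
apply: cover => y _.
have /cvgrPdist_le/(_ _ e20) [[V1 V2] /= [xV1 yV2] V12] := cG (x, y).
exists (V2, V1) => // -[y' x'] /= [yV xV].
have := V12 (x, y') (conj (nbhs_singleton xV1) yV).
have := V12 (x', y') (conj xV yV).
by rewrite /= !ler_norml; lra.
Qed.

Lemma continuous_dot2 : continuous (fun p : S2 R * S2 R => dot p.1 p.2).
Proof.
move=> p; rewrite /continuous_at /dot.
have c1 i : (fun q : S2 R * S2 R => coor i q.1) @ p --> coor i p.1.
  apply: (@continuous_comp _ _ _ fst (coor i)); first exact: cvg_fst.
  exact: continuous_coor.
have c2 i : (fun q : S2 R * S2 R => coor i q.2) @ p --> coor i p.2.
  apply: (@continuous_comp _ _ _ snd (coor i)); first exact: cvg_snd.
  exact: continuous_coor.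
have c i : (fun q : S2 R * S2 R => coor i q.1 * coor i q.2) @ p --> coor i p.1 * coor i p.2.
  exact: (cvgM (c1 i) (c2 i)).
exact: (cvgD (cvgD (c i0) (c i1)) (c i2)).
Qed.

End ContinuousKernel.

Section Kernel.
Context {R : realType}.
Notation mu := (@lebesgue_measure R).
Notation mu2 := (mu \x mu)%E.
Notation M2 := (measurableTypeR R * measurableTypeR R)%type.
Let J : set (measurableTypeR R) := `]-1, 1[%classic.

Lemma area_half_ge0 : 0 <= surf_int (fun _ : S2 R => 1) / 2.
Proof. by rewrite divr_ge0// surf_int_ge0. Qed.

Lemma continuous_integrable_J (G : R -> R) : continuous G -> mu.-integrable J (EFin \o G).
Proof.
move=> cG; have I1 : mu.-integrable `[-1, 1]%classic (EFin \o G).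
  apply: continuous_compact_integrable; first exact: segment_compact.
  exact: continuous_subspaceT.
by apply: (integrableS _ _ _ I1) => //; [exact: measurable_itv|exact: subset_itv_oo_cc].
Qed.

Lemma surf_int_comp_dotJ (F : R -> R) (x : S2 R) : continuous F ->
  surf_int (fun y => F (dot x y)) =
  surf_int (fun _ : S2 R => 1) / 2 * Rintegral mu `]-1, 1[%classic F.
Proof.
move=> cF; rewrite surf_int_comp_dot//; congr (_ * _).
rewrite -Rintegral_itv_bndo_bndc; last first.
  have I1 : mu.-integrable `[-1, 1]%classic (EFin \o F).
    apply: continuous_compact_integrable; first exact: segment_compact.
    exact: continuous_subspaceT.
  by apply: (integrableS _ _ _ I1) => //; exact: subset_itv_co_cc.
rewrite -Rintegral_itv_obnd_cbnd//.
exact: continuous_integrable_J.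
Qed.

(** The zonal identity is known for continuous profiles only. Fatou's lemma carries the upper bound,
    together with integrability, over to limits, and upper bounds are all that the L^2 estimates of
    the kernel need. *)
Lemma surf_int_fatou (x : S2 R) (F : R -> R) (Fn : nat -> R -> R) (B : R) :
  (forall n, continuous (Fn n)) -> (forall n t, 0 <= Fn n t) ->
  (forall t, -1 <= t <= 1 -> Fn ^~ t @ \oo --> F t) ->
  (forall n, Rintegral mu J (Fn n) <= B) ->
  sL1 (fun y => F (dot x y)) /\
  surf_int (fun y => F (dot x y)) <= surf_int (fun _ : S2 R => 1) / 2 * B.
Proof.
move=> cF F0 FnF FB.
pose phi n (p : M2) : \bar R := (Fn n (dot x (spherical_pt p)) * sin p.1)%:E.
pose phi0 (p : M2) : \bar R := (F (dot x (spherical_pt p)) * sin p.1)%:E.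
have cS n : continuous (fun y => Fn n (dot x y)).
  move=> y; apply: (@continuous_comp _ _ _ (dot x) (Fn n)); last exact: cF.
  exact: continuous_dot.
have iphi n : mu2.-integrable Rect (phi n) := sL1_continuous (cS n).
have mphi n : measurable_fun Rect (phi n) := measurable_int _ (iphi n).
have phicvg p : Rect p -> phi ^~ p @ \oo --> phi0 p.
  move=> _; apply: cvg_EFin; first exact: nearW.
  apply: cvgMl; apply: FnF; by rewrite dot_geN1 dot_le1.
have mphi0 : measurable_fun Rect phi0 by exact: (emeasurable_fun_cvg _ _ mphi phicvg).
have Fx0 y : 0 <= F (dot x y).
  have c : Fn ^~ (dot x y) @ \oo --> F (dot x y) by apply: FnF; rewrite dot_geN1 dot_le1.
  rewrite -(cvg_lim (@Rhausdorff R) c); apply: limr_ge; last exact: nearW.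
  by apply/cvg_ex; eexists; exact: c.
have phi00 p : Rect p -> (0 <= phi0 p)%E.
  by move=> /Rect_sin_ge0 s0; rewrite lee_fin mulr_ge0.
have le : (\int[mu2]_(p in Rect) phi0 p <= (surf_int (fun _ : S2 R => 1) / 2 * B)%:E)%E.
  have := fatou mu2 measurable_Rect mphi _.
  have -> : (\int[mu2]_(p in Rect) limn_einf (phi^~ p) = \int[mu2]_(p in Rect) phi0 p)%E.
    apply: eq_integral => p /set_mem Rp.
    by rewrite is_cvg_limn_einfE; [apply/cvg_lim => //|apply/cvg_ex; eexists]; exact: phicvg.
  move=> /(_ _)/le_trans; apply.
    by move=> n p /Rect_sin_ge0 s0; rewrite lee_fin mulr_ge0.
  rewrite limn_einf_lim; apply: lime_le; first exact: is_cvg_einfs.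
  apply: nearW => n; apply: (@le_trans _ _ (\int[mu2]_(p in Rect) phi n p)%E).
    by apply: ereal_inf_lbound; exists n => /=.
  rewrite -[leLHS]fineK; last exact: (integrable_fin_num measurable_Rect (iphi n)).
  rewrite lee_fin; have := surf_int_comp_dotJ x (cF n); rewrite /surf_int /Rintegral => ->.
  by rewrite ler_wpM2l ?area_half_ge0//; exact: FB.
have fin0 : (\int[mu2]_(p in Rect) phi0 p)%E \is a fin_num.
  by rewrite ge0_fin_numE ?(le_lt_trans le) ?ltry// integral_ge0.
split; last by rewrite -lee_fin /surf_int /Rintegral fineK.
apply/integrableP; split => //.
rewrite (_ : \int[mu2]_(p in Rect) _ = \int[mu2]_(p in Rect) phi0 p)%E ?(le_lt_trans le) ?ltry//.
by apply: eq_integral => p /set_mem Rp; rewrite gee0_abs ?phi00.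
Qed.


Lemma Rintegral_small (f : nat -> R -> R) (g : R -> R) (e : R) :
  (forall n, measurable_fun J (f n)) -> mu.-integrable J (EFin \o g) ->
  (forall n t, J t -> 0 <= f n t <= g t) ->
  (forall t, J t -> f ^~ t @ \oo --> 0) -> 0 < e ->
  \forall n \near \oo, Rintegral mu J (f n) <= e.
Proof.
move=> mf ig fg f0 e0; have mJ : measurable J by exact: measurable_itv.
have [] := @dominated_convergence _ _ _ mu J mJ (fun n t => (f n t)%:E) (cst 0%E) (EFin \o g).
- by move=> n; exact/measurable_EFinP.
- exact: measurable_cst.
- apply: aeW => t Jt; apply: cvg_EFin; first exact: nearW.
  exact: f0.
- exact: ig.
- apply: aeW => t n Jt; have /andP[a b] := fg n t Jt.
  by rewrite /= lee_fin ger0_norm.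
move=> _ _; rewrite integral0 => cvg.
have {}cvg : (fun n => Rintegral mu J (f n)) @ \oo --> 0 by exact: (fine_cvg cvg).
exact: (cvgr_le _ cvg _ e0).
Qed.

(** A continuous cutoff for the cap around t = 1: it equals 1 where n (1 - t) <= 1 and 0 where n (1
    - t) >= 2. *)
Definition bump (n : nat) (t : R) : R := Num.min 1 (Num.max 0 (2 - n%:R * (1 - t))).

Lemma continuous_bump n : continuous (bump n).
Proof.
have c1 : continuous (fun t : R => 2 - n%:R * (1 - t)).
  by move=> t; exact: (cvgB (cvg_cst (2 : R)) (cvgM (cvg_cst (n%:R : R)) (cvgB (cvg_cst (1 : R)) cvg_id))).
have cc (c : R) : continuous (fun _ : R => c) by move=> t; exact: cst_continuous.
exact: (continuous_minr (cc 1) (continuous_maxr (cc 0) c1)).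
Qed.

Lemma bump_ge0 n t : 0 <= bump n t.
Proof. by rewrite /bump le_min ler01 le_max lexx. Qed.

Lemma bump_le1 n t : bump n t <= 1.
Proof. by rewrite /bump ge_min lexx. Qed.

Lemma bump1 n : bump n 1 = 1.
Proof. by rewrite /bump subrr mulr0 subr0; rewrite max_r ?min_l//; lra. Qed.

Lemma bump_eq1 n t : n%:R * (1 - t) <= 1 -> bump n t = 1.
Proof. by move=> h; rewrite /bump max_r ?min_l//; lra. Qed.

Lemma bump_eq0 n t : 2 <= n%:R * (1 - t) -> bump n t = 0.
Proof. by move=> h; rewrite /bump max_l ?min_r//; lra. Qed.

Lemma bump_near0 t : t < 1 -> \forall n \near \oo, bump n t = 0.
Proof.
move=> t1; have t0 : 0 < 1 - t by lra.
near=> n; apply: bump_eq0; rewrite -ler_pdivrMr//.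
near: n; exact: nbhs_infty_ger.
Unshelve. all: by end_near. Qed.

Lemma bump_cvg0 t : t < 1 -> bump ^~ t @ \oo --> (0 : R).
Proof. by move=> t1; apply: cvg_near_cst; exact: bump_near0. Qed.

Variable h : R -> R.
Hypothesis hc : forall x y : S2 R, x <> y ->
  {for (x, y), continuous (fun p : S2 R * S2 R => h (Defs.edist p.1 p.2))}.
Hypothesis hL1 : mu.-integrable J (fun t => (h (Num.sqrt (2 * (1 - t))))%:E).
Hypothesis hL2 : mu.-integrable J (fun t => (h (Num.sqrt (2 * (1 - t))) ^+ 2)%:E).

Let clamp (t : R) : R := Num.max (-1) (Num.min 1 t).

Let clamp_bound t : -1 <= clamp t <= 1.
Proof. by rewrite /clamp le_max lexx ge_max ge_min lexx /= andbT; lra. Qed.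

Let clampE t : -1 <= t <= 1 -> clamp t = t.
Proof. by move=> /andP[a b]; rewrite /clamp min_r// max_r. Qed.

Let clamp_lt1 t : t < 1 -> clamp t < 1.
Proof. by move=> t1; rewrite /clamp gt_max gt_min t1 orbT andbT; lra. Qed.

Let continuous_clamp : continuous clamp.
Proof.
have cc (c : R) : continuous (fun _ : R => c) by move=> t; exact: cst_continuous.
have cid : continuous (fun t : R => t) by move=> t; exact: cvg_id.
exact: (continuous_maxr (cc (-1)) (continuous_minr (cc 1) cid)).
Qed.

(** The kernel as a function of t = x.y. Clamping t to [-1, 1] extends it by constants, so that
    continuity for all t < 1 can be stated on the whole line. *)
Definition kprof (t : R) : R := h (Num.sqrt (2 * (1 - clamp t))).

Lemma kprofE x y : h (Defs.edist x y) = kprof (dot x y).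
Proof. by rewrite edistE /kprof clampE ?dot_geN1 ?dot_le1. Qed.

Let gamma_subproof t : Num.sqrt (1 - clamp t ^+ 2) ^+ 2 + 0 ^+ 2 + clamp t ^+ 2 = 1.
Proof.
have /andP[a b] := clamp_bound t.
by rewrite sqr_sqrtr; [ring|nra].
Qed.

(** A meridian parametrized by height. Its scalar product with the north pole is the clamped t,
    which turns continuity of h(|x - y|) off the diagonal into continuity of the profile below 1. *)
Let gamma t : S2 R := mkS2 (gamma_subproof t).

Let north_subproof : 0 ^+ 2 + 0 ^+ 2 + 1 ^+ 2 = 1 :> R. Proof. by ring. Qed.

Let north : S2 R := mkS2 north_subproof.

Let kprof_gamma t : kprof t = h (Defs.edist north (gamma t)).
Proof.
by rewrite edistE /dot !coor_mkS2 /= /kprof; congr (h (Num.sqrt _)); ring.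
Qed.

Let continuous_gamma : continuous gamma.
Proof.
move=> t; apply: continuous_S2 => i.
have -> : coor i \o gamma = fun t => [:: Num.sqrt (1 - clamp t ^+ 2); 0; clamp t]`_i.
  by apply/funext => s; rewrite /= coor_mkS2.
case: i => -[|[|[|//]]] ki /=.
- have c2 : continuous (fun t => 1 - clamp t ^+ 2).
    have cq : continuous (fun s => clamp s ^+ 2).
      move=> s; apply: (@continuous_comp _ _ _ clamp (fun t => t ^+ 2)).
        exact: continuous_clamp.
      exact: exprn_continuous.
    by move=> s; exact: (cvgB (cvg_cst (1 : R)) (cq s)).
  apply: (@continuous_comp _ _ _ (fun t => 1 - clamp t ^+ 2) Num.sqrt); first exact: c2.
  exact: sqrt_continuous.
- exact: cst_continuous.
- exact: continuous_clamp.
Qed.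

Lemma continuous_kprof t : t < 1 -> {for t, continuous kprof}.
Proof.
move=> t1.
have -> : kprof = (fun p : S2 R * S2 R => h (Defs.edist p.1 p.2)) \o (fun t => (north, gamma t)).
  by apply/funext => s; exact: kprof_gamma.
apply: continuous_comp.
  exact: (cvg_pair (cvg_cst north) (@continuous_gamma t)).
apply: hc => ng; have := congr1 (coor i2) ng; rewrite !coor_mkS2 /= => c1.
by have := clamp_lt1 t1; rewrite -c1 ltxx.
Qed.

Definition kcut (n : nat) (t : R) : R := kprof t * (1 - bump n t).

(** The factor [1 - bump n] vanishes identically in a neighbourhood of every t >= 1, so the
    singularity of the profile at 1 is never met. *)
Lemma continuous_kcut n : continuous (kcut n).
Proof.
move=> t; have [t1|t1] := ltP t 1.
  exact: (cvgM (continuous_kprof t1) (cvgB (cvg_cst (1 : R)) (@continuous_bump n t))).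
have cn : {for t, continuous (fun t : R => n%:R * (1 - t))}.
  exact: (cvgM (cvg_cst (n%:R : R)) (cvgB (cvg_cst (1 : R)) cvg_id)).
have lt : n%:R * (1 - t) < 1.
  by rewrite (le_lt_trans _ ltr01)// mulr_ge0_le0// subr_le0.
have nz : \forall s \near t, kcut n s = 0.
  apply: filterS (cvgr_lt _ cn _ lt) => s /ltW /bump_eq1 b.
  by rewrite /kcut b subrr mulr0.
rewrite /continuous_at (nbhs_singleton nz); exact: cvg_near_cst.
Qed.

(** The added term restores the limit at t = 1, where the profile has the arbitrary value h(0); at
    every point the sequence is eventually constant. *)
Lemma kcut_cvg t : -1 <= t <= 1 ->
  (fun n => kcut n t + kprof 1 * bump n t) @ \oo --> kprof t.
Proof.
move=> /andP[_ t1]; apply: cvg_near_cst.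
have [t2|t2] := ltP t 1; last first.
  have -> : t = 1 by apply/eqP; rewrite eq_le t1 t2.
  by apply: nearW => n; rewrite /kcut bump1 subrr mulr0 add0r mulr1.
by apply: filterS (bump_near0 t2) => n b; rewrite /kcut b subr0 mulr1 mulr0 addr0.
Qed.

Lemma kprof_J t : J t -> kprof t = h (Num.sqrt (2 * (1 - t))).
Proof. by rewrite /J /= in_itv/= => /andP[a b]; rewrite /kprof clampE// !ltW. Qed.

Lemma measurable_kprof : measurable_fun J kprof.
Proof.
have m : measurable_fun J (fun t => h (Num.sqrt (2 * (1 - t)))).
  by apply/measurable_EFinP; exact: (measurable_int _ hL1).
apply: eq_measurable_fun m => t /set_mem Jt.
by rewrite kprof_J.
Qed.

Lemma integrable_kprof_sqr : mu.-integrable J (EFin \o (fun t => kprof t ^+ 2)).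
Proof.
apply: (eq_integrable _ _ _ _ hL2); first exact: measurable_itv.
by move=> t /set_mem Jt; rewrite /= kprof_J.
Qed.

Lemma integrable_kprofM (rho : R -> R) : continuous rho ->
  (forall t, 0 <= rho t <= 1) ->
  mu.-integrable J (EFin \o (fun t => (kprof t * rho t) ^+ 2)).
Proof.
move=> crho rho01.
apply: (le_integrable _ _ _ integrable_kprof_sqr); first exact: measurable_itv.
  apply/measurable_EFinP; apply: measurable_funX; apply: measurable_funM.
    exact: measurable_kprof.
  by apply: measurable_funTS; exact: continuous_measurable_fun.
move=> t _; rewrite /= lee_fin !ger0_norm ?sqr_ge0// exprMn.
have /andP[a b] := rho01 t; rewrite -[leRHS]mulr1 ler_wpM2l ?sqr_ge0//.
by rewrite expr_le1.
Qed.

(* The square of the truncated kernel is a limit of continuous zonal functions;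
   the bump term takes care of the value on the diagonal. *)
Lemma surf_int_kernel_le (rho : R -> R) (x : S2 R) : continuous rho ->
  (forall t, 0 <= rho t <= 1) ->
  sL1 (fun y => (kprof (dot x y) * rho (dot x y)) ^+ 2) /\
  surf_int (fun y => (kprof (dot x y) * rho (dot x y)) ^+ 2) <=
    surf_int (fun _ : S2 R => 1) / 2 * Rintegral mu J (fun t => (kprof t * rho t) ^+ 2).
Proof.
move=> crho rho01.
pose F t := (kprof t * rho t) ^+ 2; set c := (kprof 1 * rho 1) ^+ 2.
have c0 : 0 <= c by exact: sqr_ge0.
have mJ : measurable J by exact: measurable_itv.
have main (e : R) : 0 < e -> sL1 (fun y => F (dot x y)) /\
  surf_int (fun y => F (dot x y)) <= surf_int (fun _ : S2 R => 1) / 2 *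
    (Rintegral mu J F + e).
  move=> e0; have ce : 0 < e / (c + 1) by rewrite divr_gt0// ltr_wpDl.
  have ib n : mu.-integrable J (EFin \o bump n).
    by apply: continuous_integrable_J; exact: continuous_bump.
  have [N _ NP] : \forall n \near \oo, Rintegral mu J (bump n) <= e / (c + 1).
    apply: (@Rintegral_small _ (fun=> 1)) => //.
    - by move=> n; apply: measurable_funTS; apply: continuous_measurable_fun; exact: continuous_bump.
    - by apply: (@continuous_integrable_J (fun=> 1)) => t; exact: cst_continuous.
    - by move=> n t _; rewrite bump_ge0 bump_le1.
    - by move=> t; rewrite /J /= in_itv/= => /andP[_ t1]; exact: bump_cvg0.
  have crk n : continuous (fun t => (kcut n t * rho t) ^+ 2).
    move=> t; apply: (@continuous_comp _ _ _ (fun t => kcut n t * rho t) (fun t => t ^+ 2)).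
      exact: (cvgM (@continuous_kcut n t) (crho t)).
    exact: exprn_continuous.
  (* The bound has to hold for every index, hence the shift by N: from there on c times the bump
     integrates to at most e. *)
  apply: (@surf_int_fatou x F (fun n t => (kcut (n + N) t * rho t) ^+ 2 + c * bump (n + N) t)).
  - by move=> n t; exact: (cvgD (@crk (n + N)%N t) (cvgM (cvg_cst c) (@continuous_bump (n + N)%N t))).
  - by move=> n t; rewrite addr_ge0 ?sqr_ge0// mulr_ge0// bump_ge0.
  - move=> t /andP[_ t1]; apply: cvg_near_cst.
    have [t2|t2] := ltP t 1; last first.
      have -> : t = 1 by apply/eqP; rewrite eq_le t1 t2.
      by apply: nearW => n; rewrite /kcut bump1 subrr mulr0 mul0r expr0n add0r mulr1.
    have [M _ MP] := bump_near0 t2; exists M => // n /= Mn.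
    by rewrite /kcut MP ?subr0 ?mulr1 ?mulr0 ?addr0//= (leq_trans Mn)// leq_addr.
  - move=> n.
    have i1 : mu.-integrable J (EFin \o (fun t => (kcut (n + N) t * rho t) ^+ 2)).
      by apply: continuous_integrable_J; exact: crk.
    have i2 : mu.-integrable J (EFin \o (fun t => c * bump (n + N) t)).
      by apply: continuous_integrable_J => t; exact: (cvgM (cvg_cst c) (@continuous_bump (n + N)%N t)).
    rewrite RintegralD// lerD//.
      apply: le_Rintegral => //; first exact: integrable_kprofM.
      move=> t _; rewrite /F /kcut !exprMn -[leRHS]mulr1 [leLHS]mulrAC.
      apply: ler_wpM2l; first by apply: mulr_ge0; exact: sqr_ge0.
      by rewrite expr_le1 ?subr_ge0 ?bump_le1// lerBlDr lerDl bump_ge0.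
    rewrite RintegralZl//; have := NP (n + N)%N (leq_addl _ _).
    rewrite ler_pdivlMr ?ltr_wpDl// => h1; apply: le_trans h1.
    by rewrite mulrC ler_wpM2l ?lerDl// Rintegral_ge0// => t _; exact: bump_ge0.
have [I1 _] := main 1 ltr01; split => //.
apply/ler_addgt0Pr => e e0.
have a0 := area_half_ge0; set a := surf_int (fun _ : S2 R => 1) / 2 in main a0 *.
have ae : 0 < e / (a + 1) by rewrite divr_gt0// ltr_wpDl.
have [_ /le_trans] := main _ ae; apply; rewrite mulrDr lerD2l.
by rewrite mulrCA ler_piMr ?(ltW e0)// ler_pdivrMr ?ltr_wpDl// mul1r lerDl.
Qed.

Definition kern (x y : S2 R) : R := h (Defs.edist x y).

Lemma smeas_kern x : smeas (kern x).
Proof.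
apply: (@measurable_fun_cvg _ _ _ _ (fun n p => kcut n (dot x (spherical_pt p)) +
  kprof 1 * bump n (dot x (spherical_pt p)))).
  move=> n; apply: (@smeas_continuous _ (fun y => kcut n (dot x y) + kprof 1 * bump n (dot x y))) => y.
  apply: (@continuous_comp _ _ _ (dot x) (fun t => kcut n t + kprof 1 * bump n t)).
    exact: continuous_dot.
  exact: (cvgD (@continuous_kcut n _) (cvgM (cvg_cst (kprof 1)) (@continuous_bump n _))).
move=> p _; rewrite /kern kprofE; apply: kcut_cvg.
by rewrite dot_geN1 dot_le1.
Qed.

Lemma sL2_kern x : sL2 (kern x).
Proof.
split; first exact: smeas_kern.
have [||I1 _] := @surf_int_kernel_le (fun=> 1) x.
- by move=> t; exact: cst_continuous.
- by move=> t; rewrite ler01 lexx.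
by apply: eq_sL1 I1 => y; rewrite mulr1 /kern kprofE.
Qed.

Lemma L2norm_kern_bounded : exists2 B, 0 < B & forall x, L2norm (kern x) <= B.
Proof.
exists (Num.sqrt (surf_int (fun _ : S2 R => 1) / 2 * Rintegral mu J (fun t => (kprof t * 1) ^+ 2)) + 1).
  by rewrite ltr_wpDl// sqrtr_ge0.
move=> x; have [||_ I1] := @surf_int_kernel_le (fun=> 1) x.
- by move=> t; exact: cst_continuous.
- by move=> t; rewrite ler01 lexx.
apply: (@le_trans _ _ (Num.sqrt (surf_int (fun y => (kprof (dot x y) * 1) ^+ 2)))).
  rewrite /L2norm (_ : (fun y => kern x y ^+ 2) = (fun y => (kprof (dot x y) * 1) ^+ 2))//.
  by apply/funext => y; rewrite mulr1 /kern kprofE.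
by rewrite (le_trans (ler_wsqrtr I1))// lerDl.
Qed.

(** The kernel cut off near the diagonal is jointly continuous, so its variation in x is small
    uniformly in y. The rest is supported near the diagonal, and its L^2 norm is small uniformly in
    x by [surf_int_kernel_le]. *)
Lemma L2norm_kern_continuous x (e : R) : 0 < e ->
  \forall x' \near x, L2norm (fun y => kern x y - kern x' y) <= e.
Proof.
(* Each of the two tails contributes a d / 2 and the cut part contributes a d; with the factor 3
   from squaring a sum of three terms this is 6 a d, at most e^2. *)
move=> e0; set a := surf_int (fun _ : S2 R => 1).
have a0 : 0 <= a by exact: surf_int_ge0.
pose d := e ^+ 2 / (6 * (a + 1)).
have a1 : 0 < 6 * (a + 1) by rewrite mulr_gt0// ltr_wpDl.
have d0 : 0 < d by rewrite divr_gt0// exprn_gt0.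
have [n nP] : exists n, Rintegral mu J (fun t => (kprof t * bump n t) ^+ 2) <= d.
  have [N _ NP] : \forall n \near \oo, Rintegral mu J (fun t => (kprof t * bump n t) ^+ 2) <= d.
    apply: (@Rintegral_small _ (fun t => kprof t ^+ 2)) => //.
    - move=> n; apply: measurable_funX; apply: measurable_funM; first exact: measurable_kprof.
      by apply: measurable_funTS; apply: continuous_measurable_fun; exact: continuous_bump.
    - exact: integrable_kprof_sqr.
    - move=> n t _; rewrite sqr_ge0/= exprMn -[leRHS]mulr1 ler_wpM2l ?sqr_ge0//.
      by rewrite expr_le1 ?bump_ge0 ?bump_le1.
    - move=> t; rewrite /J /= in_itv/= => /andP[_ t1]; apply: cvg_near_cst.
      by apply: filterS (bump_near0 t1) => k b; rewrite b mulr0 expr0n.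
  by exists N; exact: (NP N (leqnn N)).
have tail z : sL1 (fun y => (kprof (dot z y) * bump n (dot z y)) ^+ 2) /\
  surf_int (fun y => (kprof (dot z y) * bump n (dot z y)) ^+ 2) <= a / 2 * d.
  have [||I1 I2] := @surf_int_kernel_le (bump n) z.
  - exact: continuous_bump.
  - by move=> t; rewrite bump_ge0 bump_le1.
  by split => //; apply: (le_trans I2); rewrite ler_wpM2l// divr_ge0.
have cG : continuous (fun p : S2 R * S2 R => kcut n (dot p.1 p.2)).
  move=> p; apply: (@continuous_comp _ _ _ (fun p : S2 R * S2 R => dot p.1 p.2) (kcut n)).
    exact: continuous_dot2.
  exact: continuous_kcut.
have q0 : 0 < Num.sqrt d by rewrite sqrtr_gt0.
have := near_uniform_compact x compact_S2 cG q0.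
apply: filterS => x' xx'.
rewrite -(@ler_pXn2r _ 2) ?nnegrE ?L2norm_ge0 ?(ltW e0)// L2norm_sqr.
have [I1 L1] := tail x; have [I2 L2] := tail x'.
have Id : sL1 (fun _ : S2 R => d).
  by apply: sL1_continuous => y; exact: cst_continuous.
pose b z y := (kprof (dot z y) * bump n (dot z y)) ^+ 2.
(* The integrand is the square of t + P - Q, with t the difference of the cut kernels and P, Q the
   two tails; it is at most 3 (t^2 + P^2 + Q^2), and t^2 <= d. *)
apply: (@le_trans _ _ (surf_int (fun y => 3 * ((b x y + b x' y) + d)))).
  apply: surf_int_le.
  - exact: (sL2B (sL2_kern x) (sL2_kern x')).2.
  - by apply: sL1Z; apply: sL1D => //; exact: sL1D.
  - move=> y; have := xx' y; rewrite -(@ler_pXn2r _ 2) ?nnegrE ?sqrtr_ge0//.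
    rewrite sqr_sqrtr ?(ltW d0)// real_normK ?num_real// /kern !kprofE /b /kcut.
    set p := kprof (dot x y); set q := kprof (dot x' y); set r := bump n _; set s := bump n _.
    move: p q r s => p q r s; rewrite !mulrBr !mulr1.
    set P := p * r; set Q := q * s => h1.
    have -> : p - q = (p - P - (q - Q)) + P - Q by ring.
    move: (p - P - (q - Q)) h1 => t h1.
    have := sqr_ge0 (t - P); have := sqr_ge0 (t + Q); have := sqr_ge0 (P + Q).
    nra.
rewrite surf_intZ; last by apply: sL1D => //; exact: sL1D.
rewrite surf_intD//; last exact: sL1D.
rewrite surf_intD// (_ : surf_int (fun=> d) = d * a); last first.
  rewrite -surf_intZ; last by apply: sL1_continuous => y; exact: cst_continuous.
  by congr surf_int; apply/funext => y; rewrite mulr1.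
have dE : d * (6 * (a + 1)) = e ^+ 2 by rewrite /d mulfVK// gt_eqF.
rewrite -dE; rewrite /b; nra.
Qed.

End Kernel.

(** * Integral operators and their discretizations *)

Section ContinuousFunctions.
Context {R : realType} {T : topologicalType}.
Implicit Types f g : T -> R.

Lemma continuous_add f g : continuous f -> continuous g -> continuous (fun x => f x + g x).
Proof. by move=> cf cg x; exact: (cvgD (cf x) (cg x)). Qed.

Lemma continuous_sub f g : continuous f -> continuous g -> continuous (fun x => f x - g x).
Proof. by move=> cf cg x; exact: (cvgB (cf x) (cg x)). Qed.

Lemma continuous_mul f g : continuous f -> continuous g -> continuous (fun x => f x * g x).
Proof. by move=> cf cg x; exact: (cvgM (cf x) (cg x)). Qed.

Lemma continuous_scale (c : R) f : continuous f -> continuous (fun x => c * f x).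
Proof. by move=> cf x; exact: (cvgM (cvg_cst c) (cf x)). Qed.

Lemma continuous_cst (c : R) : continuous (fun _ : T => c).
Proof. by move=> x; exact: cst_continuous. Qed.

Lemma continuous_near f (x : T) (e : R) : continuous f -> 0 < e ->
  \forall y \near x, `|f x - f y| <= e.
Proof. by move=> cf e0; have /cvgrPdist_le := cf x; exact. Qed.

Lemma continuous_eps f :
  (forall (x : T) (e : R), 0 < e -> \forall y \near x, `|f x - f y| <= e) -> continuous f.
Proof. by move=> H x; apply/cvgrPdist_le => e; exact: H. Qed.

Lemma continuous_sum (I : Type) (s : seq I) (P : pred I) (F : I -> T -> R) :
  (forall i, P i -> continuous (F i)) -> continuous (fun x => \sum_(i <- s | P i) F i x).
Proof.
move=> cF; elim: s => [|i s IH].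
  have -> : (fun x => \sum_(i <- [::] | P i) F i x) = (fun=> 0).
    by apply/funext => x; rewrite big_nil.
  exact: continuous_cst.
case: (boolP (P i)) => Pi.
  have -> : (fun x => \sum_(j <- i :: s | P j) F j x) =
      (fun x => F i x + \sum_(j <- s | P j) F j x).
    by apply/funext => x; rewrite big_cons Pi.
  by apply: continuous_add => //; exact: cF.
have -> : (fun x => \sum_(j <- i :: s | P j) F j x) = (fun x => \sum_(j <- s | P j) F j x).
  by apply/funext => x; rewrite big_cons (negbTE Pi).
exact: IH.
Qed.

End ContinuousFunctions.

Section Supnorm.
Context {R : realType}.
Implicit Types f g : S2 R -> R.

Lemma S2_nonempty : exists x : S2 R, True.
Proof.
have h : 0 ^+ 2 + 0 ^+ 2 + 1 ^+ 2 = 1 :> R by ring.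
by exists (mkS2 h).
Qed.

Lemma supnorm_ub f x : continuous f -> `|f x| <= supnorm f.
Proof.
move=> cf; have [M _ fM] := continuous_bounded_compact compact_S2 cf.
apply: ub_le_sup; last by exists x.
by exists M => _ [y _ <-].
Qed.

Lemma supnorm_le f M : (forall x, `|f x| <= M) -> supnorm f <= M.
Proof.
move=> fM; apply: ge_sup.
  by have [x _] := S2_nonempty; exists `|f x|; exists x.
by move=> _ [y _ <-].
Qed.

Lemma supnorm_ge0 f : continuous f -> 0 <= supnorm f.
Proof.
by move=> cf; have [x _] := S2_nonempty; apply: le_trans (supnorm_ub x cf).
Qed.

Lemma supnorm_attained f : continuous f -> exists x, supnorm f = `|f x|.
Proof.
move=> cf; have cn : continuous (fun x => `|f x|).
  by move=> x; exact: (cvg_norm (cf x)).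
have [|x _ xP] := compact_EVT_max _ compact_S2 (continuous_subspaceT cn).
  by have [x _] := S2_nonempty; exists x.
exists x; apply/eqP; rewrite eq_le supnorm_ub// andbT.
by apply: supnorm_le => y; apply: xP; rewrite inE.
Qed.

End Supnorm.

Section Operators.
Context {R : realType}.
Implicit Types f g phi psi H : S2 R -> R.

(** The common interface of the exact and the discrete forms. The operator estimates below depend on
    a form only through c, which makes them uniform in m, n and eta. *)
Definition bilin_bounded (c : R) (b : (S2 R -> R) -> (S2 R -> R) -> R) :=
  [/\ forall g g' H, continuous g -> continuous g' -> sL2 H ->
        b (fun y => g y - g' y) H = b g H - b g' H,
      forall a g H, continuous g -> sL2 H -> b (fun y => a * g y) H = a * b g H,
      forall g H H', continuous g -> sL2 H -> sL2 H' ->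
        b g (fun y => H y - H' y) = b g H - b g H' &
      forall g H (M : R), continuous g -> sL2 H -> (forall y, `|g y| <= M) ->
        `|b g H| <= c * M * L2norm H].

Variable h : R -> R.
Variable K : S2 R * S2 R -> R.
Hypothesis hK : continuous K.
Hypothesis kL2 : forall x, sL2 (kern h x).
Hypothesis kB : exists2 B, 0 < B & forall x, L2norm (kern h x) <= B.
Hypothesis kC : forall (x : S2 R) (e : R), 0 < e ->
  \forall x' \near x, L2norm (fun y => kern h x y - kern h x' y) <= e.

Definition op (b : (S2 R -> R) -> (S2 R -> R) -> R) (phi : S2 R -> R) (x : S2 R) : R :=
  b (fun y => K (x, y) * phi y) (kern h x).

Lemma continuous_Kl x : continuous (fun y => K (x, y)).
Proof.
move=> y; apply: (@continuous_comp _ _ _ (fun y => (x, y)) K); last exact: hK.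
have cid : {for y, continuous (fun y : S2 R => y)} by exact: cvg_id.
exact: (cvg_pair (cvg_cst x) cid).
Qed.

Lemma continuous_Kphi x phi : continuous phi -> continuous (fun y => K (x, y) * phi y).
Proof. by move=> cp; apply: continuous_mul => //; exact: continuous_Kl. Qed.

Lemma K_bounded : exists2 M, 0 < M & forall x y, `|K (x, y)| <= M.
Proof.
have cT : compact [set: S2 R * S2 R].
  by rewrite -setXTT; apply: compact_setX; exact: compact_S2.
have [M M0 KM] := continuous_bounded_compact cT hK.
by exists M => // x y; exact: KM.
Qed.

Lemma opB c b phi psi x : bilin_bounded c b -> continuous phi -> continuous psi ->
  op b (fun y => phi y - psi y) x = op b phi x - op b psi x.
Proof.
move=> [bB _ _ _] cp cq; rewrite /op -bB//; try exact: continuous_Kphi.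
by congr b; apply/funext => y; rewrite mulrBr.
Qed.

Lemma opZ c b a phi x : bilin_bounded c b -> continuous phi ->
  op b (fun y => a * phi y) x = a * op b phi x.
Proof.
move=> [_ bZ _ _] cp; rewrite /op -bZ//; try exact: continuous_Kphi.
by congr b; apply/funext => y; rewrite mulrCA.
Qed.

Lemma op_bounded c : 0 <= c -> exists2 B, 0 < B & forall b, bilin_bounded c b ->
  forall phi (M : R) x, continuous phi -> (forall y, `|phi y| <= M) -> `|op b phi x| <= B * M.
Proof.
move=> c0; have [Kb Kb0 KK] := K_bounded; have [Hb Hb0 HH] := kB.
exists (c * Kb * Hb + 1); first by rewrite ltr_wpDl// !mulr_ge0// ltW.
move=> b [_ _ _ bb] phi M x cp pM.
have M0 : 0 <= M by have := pM x; exact: le_trans.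
have h1 : forall y, `|K (x, y) * phi y| <= Kb * M by move=> y; rewrite normrM ler_pM.
rewrite /op; apply: (le_trans (bb _ _ _ (@continuous_Kphi x _ cp) (kL2 x) h1)).
have h2 : c * (Kb * M) * L2norm (kern h x) <= c * (Kb * M) * Hb.
  by apply: ler_wpM2l; rewrite ?mulr_ge0// ltW.
apply: (le_trans h2); rewrite mulrDl mul1r -!mulrA [M * Hb]mulrC !mulrA.
by rewrite lerDl.
Qed.

(** The neighbourhood depends neither on the form nor on phi: together with [op_bounded] this is
    collective compactness as Ascoli's theorem uses it. The variation in x is split into that of K
    and that of the kernel. *)
Lemma op_equicontinuous c : 0 <= c -> forall (x : S2 R) (e : R), 0 < e ->
  \forall x' \near x, forall b, bilin_bounded c b ->
  forall phi (M : R), continuous phi -> (forall y, `|phi y| <= M) ->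
  `|op b phi x - op b phi x'| <= e * M.
Proof.
move=> c0 x e e0; have [Kb Kb0 KK] := K_bounded; have [Hb Hb0 HH] := kB.
pose d := e / (c * (Kb + Hb) + 1).
have q0 : 0 < c * (Kb + Hb) + 1 by rewrite ltr_wpDl// mulr_ge0// addr_ge0// ltW.
have d0 : 0 < d by rewrite divr_gt0.
apply: filterS (filterI (near_uniform_compact x compact_S2 hK d0) (kC x d0)).
move=> x' [/= KE HE] b [bB _ bH bb] phi M cp pM.
have M0 : 0 <= M by have := pM x; exact: le_trans.
have -> : op b phi x - op b phi x' =
    b (fun y => K (x, y) * phi y - K (x', y) * phi y) (kern h x) +
    b (fun y => K (x', y) * phi y) (fun y => kern h x y - kern h x' y).
  rewrite bB ?bH//; try exact: continuous_Kphi.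
  by rewrite /op subrKA.
apply: (le_trans (ler_normD _ _)).
have h1 : `|b (fun y => K (x, y) * phi y - K (x', y) * phi y) (kern h x)| <= c * (d * M) * Hb.
  apply: (@le_trans _ _ (c * (d * M) * L2norm (kern h x))).
    apply: bb => //; first by apply: continuous_sub; exact: continuous_Kphi.
    by move=> y; rewrite -mulrBl normrM ler_pM.
  by apply: ler_wpM2l => //; apply: mulr_ge0 => //; apply: mulr_ge0 => //; exact: ltW.
have h2 : `|b (fun y => K (x', y) * phi y) (fun y => kern h x y - kern h x' y)| <= c * (Kb * M) * d.
  apply: (@le_trans _ _ (c * (Kb * M) * L2norm (fun y => kern h x y - kern h x' y))).
    apply: bb => //; first exact: continuous_Kphi.
      exact: sL2B.
    by move=> y; rewrite normrM ler_pM.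
  by apply: ler_wpM2l => //; apply: mulr_ge0 => //; apply: mulr_ge0 => //; exact: ltW.
apply: (le_trans (lerD h1 h2)).
have -> : c * (d * M) * Hb + c * (Kb * M) * d = (c * (Kb + Hb) * d) * M by ring.
apply: ler_wpM2r => //; rewrite -[leRHS](mulfVK (lt0r_neq0 q0)) -/d mulrC.
by apply: ler_wpM2l; [exact: ltW|rewrite lerDl].
Qed.

Lemma op_continuous c b phi : 0 <= c -> bilin_bounded c b -> continuous phi ->
  continuous (op b phi).
Proof.
move=> c0 bb cp; have [M M0 pM] := continuous_bounded_compact compact_S2 cp.
have E (x : S2 R) (e : R) : 0 < e ->
    \forall x' \near x, `|op b phi x - op b phi x'| <= e.
  move=> e0; have equi := op_equicontinuous c0 x (divr_gt0 e0 M0).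
  apply: (@filterS _ (nbhs x) _ _ _ _ equi) => x' /(_ _ bb _ _ cp pM).
  by rewrite mulfVK// gt_eqF.
exact: continuous_eps.
Qed.

Definition bint (g H : S2 R -> R) : R := surf_int (fun y => g y * H y).

Lemma bint_bounded : bilin_bounded (L2norm (fun _ : S2 R => 1)) bint.
Proof.
split.
- move=> g g' H cg cg' LH; rewrite /bint -surf_intB.
  + by congr surf_int; apply/funext => y; rewrite mulrBl.
  + exact: sL2M (sL2_continuous cg) LH.
  + exact: sL2M (sL2_continuous cg') LH.
- move=> a g H cg LH; rewrite /bint -surf_intZ; last exact: sL2M (sL2_continuous cg) LH.
  by congr surf_int; apply/funext => y; rewrite mulrA.
- move=> g H H' cg LH LH'; rewrite /bint -surf_intB.
  + by congr surf_int; apply/funext => y; rewrite mulrBr.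
  + exact: sL2M (sL2_continuous cg) LH.
  + exact: sL2M (sL2_continuous cg) LH'.
- move=> g H M cg LH gM; have Lg := sL2_continuous cg.
  apply: (le_trans (cauchy_schwarz Lg LH)); apply: ler_wpM2r; first exact: L2norm_ge0.
  apply: L2norm_le => //.
  by have [x _] := @S2_nonempty R; exact: (le_trans (normr_ge0 _) (gM x)).
Qed.

Lemma op_bint phi x : op bint phi x = integral_op h K phi x.
Proof.
by rewrite /op /bint /integral_op; congr surf_int; apply/funext => y; rewrite /kern mulrC mulrA.
Qed.

Lemma op_ascoli c (G : set_system nat) (b : nat -> (S2 R -> R) -> (S2 R -> R) -> R)
    (phi : nat -> S2 R -> R) M : 0 <= c -> UltraFilter G ->
  (forall n, bilin_bounded c (b n)) -> (forall n, continuous (phi n)) ->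
  (forall n y, `|phi n y| <= M) ->
  exists chi : S2 R -> R, continuous chi /\
  forall e : R, 0 < e -> \forall n \near G, forall x, `|chi x - op (b n) (phi n) x| <= e.
Proof.
move=> c0 UG bb cphi phiM; have [B B0 BP] := op_bounded c0.
apply: (@ascoli_ultra _ _ compact_S2 _ _ (fun n => op (b n) (phi n)) (B * M)).
- move=> x e e0; have M1 : 0 < `|M| + 1 by rewrite ltr_wpDl.
  apply: filterS (op_equicontinuous c0 x (divr_gt0 e0 M1)) => x' h1 n.
  have phiM' y : `|phi n y| <= `|M| + 1.
    by apply: le_trans (phiM n y) _; rewrite (le_trans (ler_norm _))// lerDl.
  by have := h1 _ (bb n) _ _ (cphi n) phiM'; rewrite mulfVK// gt_eqF.
- by move=> n x; exact: BP.
Qed.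

End Operators.

(** * Uniform lower bound and the Fredholm alternative *)

Section LowerBound.
Context {R : realType}.
Variable h : R -> R.
Variable K : S2 R * S2 R -> R.
Hypothesis hK : continuous K.
Hypothesis kL2 : forall x, sL2 (kern h x).
Hypothesis kB : exists2 B, 0 < B & forall x, L2norm (kern h x) <= B.
Hypothesis kC : forall (x : S2 R) (e : R), 0 < e ->
  \forall x' \near x, L2norm (fun y => kern h x y - kern h x' y) <= e.
Hypothesis injA : forall phi : S2 R -> R, continuous phi ->
  (forall x, phi x - op h K bint phi x = 0) -> forall x, phi x = 0.

(** Otherwise there are functions psi_n of norm 1 with (I - A_n) psi_n -> 0, for forms of growing
    index. By collective compactness A_n psi_n has a uniform limit chi along an ultrafilter, so
    psi_n -> chi as well. Since A_n chi -> A chi and the A_n are uniformly bounded, chi = A chi,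
    hence chi = 0, against |psi_n| = 1. The predicate Q allows many forms at each stage k; it covers
    the triples gamma as well as the constant family [bint] of Riesz's argument. *)
Lemma uniform_lower_bound (c : R) (Q : nat -> ((S2 R -> R) -> (S2 R -> R) -> R) -> Prop) :
  0 <= c -> (forall k b, Q k b -> bilin_bounded c b) ->
  (forall (phi : S2 R -> R) x (e : R), continuous phi -> 0 < e ->
    exists k0, forall k b, (k0 <= k)%N -> Q k b ->
      `|op h K b phi x - op h K bint phi x| <= e) ->
  exists k (B : R), 0 < B /\ forall k' b phi, (k <= k')%N -> Q k' b -> continuous phi ->
    supnorm phi <= B * supnorm (fun x => phi x - op h K b phi x).
Proof.
move=> c0 Qb Qcvg; apply: contrapT => nlow.
have bad (k : nat) : exists t : nat * ((S2 R -> R) -> (S2 R -> R) -> R) * (S2 R -> R),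
    [/\ (k <= t.1.1)%N, Q t.1.1 t.1.2, continuous t.2, supnorm t.2 = 1 &
      k.+1%:R * supnorm (fun x => t.2 x - op h K t.1.2 t.2 x) <= 1].
  apply: contrapT => nb; apply: nlow; exists k, k.+1%:R; split => // k' b phi kk' Qkb cphi.
  rewrite leNgt; apply/negP => lt; apply: nb.
  have cop : continuous (op h K b phi) by exact: (op_continuous hK kL2 kB kC c0 (Qb _ _ Qkb)).
  have cd := continuous_sub cphi cop.
  have d0 := supnorm_ge0 cd.
  have s0 : 0 < supnorm phi by apply: le_lt_trans lt; rewrite mulr_ge0.
  have cpsi : continuous (fun x => (supnorm phi)^-1 * phi x) by exact: continuous_scale.
  exists (k', b, fun x => (supnorm phi)^-1 * phi x); split => //=.
    apply/eqP; rewrite eq_le; apply/andP; split.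
      apply: supnorm_le => x; rewrite normrM gtr0_norm ?invr_gt0//.
      by rewrite ler_pdivrMl// mulr1 supnorm_ub.
    have [x xE] := supnorm_attained cphi.
    apply: le_trans (supnorm_ub x cpsi); rewrite normrM gtr0_norm ?invr_gt0//.
    by rewrite -xE mulVf// gt_eqF.
  have -> : (fun x => (supnorm phi)^-1 * phi x - op h K b (fun x => (supnorm phi)^-1 * phi x) x) =
      (fun x => (supnorm phi)^-1 * (phi x - op h K b phi x)).
    by apply/funext => x; rewrite (opZ hK kL2 _ _ (Qb _ _ Qkb))// mulrBr.
  apply: (@le_trans _ _ (k.+1%:R * ((supnorm phi)^-1 * supnorm (fun x => phi x - op h K b phi x)))).
    apply: ler_wpM2l => //; apply: supnorm_le => x.
    rewrite normrM gtr0_norm ?invr_gt0// ler_wpM2l ?invr_ge0 ?(ltW s0)//.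
    exact: (supnorm_ub x cd).
  by rewrite mulrCA ler_pdivrMl// mulr1 ltW.
have {bad nlow} [t tP] := choice bad.
pose kk n := (t n).1.1; pose b n := (t n).1.2; pose psi n := (t n).2.
have [G [UG ooG]] := ultraFilterLemma (@eventually_filter).
have bb n : bilin_bounded c (b n) by have [_ Qn _ _ _] := tP n; exact: (Qb (kk n)).
have cpsi n : continuous (psi n) by have [] := tP n.
have psi1 n : supnorm (psi n) = 1 by have [] := tP n.
have psib n y : `|psi n y| <= 1 by rewrite -(psi1 n) supnorm_ub.
have [chi [cchi chiP]] := op_ascoli hK kL2 kB kC c0 UG bb cpsi psib.
have small n x : `|psi n x - op h K (b n) (psi n) x| <= n.+1%:R^-1.
  have [_ _ _ _ sm] := tP n.
  have cd : continuous (fun x => psi n x - op h K (b n) (psi n) x).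
    by apply: continuous_sub => //; exact: (op_continuous hK kL2 kB kC c0).
  apply: le_trans (supnorm_ub x cd) _.
  by rewrite -[leRHS]mulr1 ler_pdivlMl.
have psichi (e : R) : 0 < e -> \forall n \near G, forall x, `|chi x - psi n x| <= e.
  move=> e0; have e2 : 0 < e / 2 by rewrite divr_gt0.
  have G1 := chiP _ e2.
  have G2 : G [set n | n.+1%:R^-1 <= e / 2].
    apply: ooG; near=> n; apply/ltW; near: n; exact: (near_infty_natSinv_lt (PosNum e2)).
  apply: filterS (filterI G1 G2) => n [/= h1 h2] x.
  have := h1 x; have := le_trans (small n x) h2; rewrite !ler_norml; lra.
have chi0 : forall x, chi x = 0.
  apply: injA => // x.
  suff key (e : R) : 0 < e -> `|chi x - op h K bint chi x| <= e.
    by apply/eqP; rewrite -normr_le0; apply/ler_addgt0Pr => e e0; rewrite add0r key.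
  move=> e0.
  have [B B0 BP] := op_bounded hK kL2 kB c0.
  have e3 : 0 < e / 3 by rewrite divr_gt0.
  have [k0 k0P] := Qcvg chi x _ cchi e3.
  have G1 := chiP _ e3.
  have G2 := psichi _ (divr_gt0 e3 B0).
  have G3 : G [set n | (k0 <= n)%N] by apply: ooG; exact: nbhs_infty_ge.
  have [n [/= h1 [/= h2 h3]]] := filter_ex (filterI G1 (filterI G2 G3)).
  have [kn Qn _ _ _] := tP n.
  have h4 : `|op h K (b n) chi x - op h K bint chi x| <= e / 3 := k0P _ _ (leq_trans h3 kn) Qn.
  have h5 : `|op h K (b n) chi x - op h K (b n) (psi n) x| <= e / 3.
    rewrite -(opB hK kL2 _ (bb n))//.
    apply: (le_trans (BP _ (bb n) _ _ x (continuous_sub cchi (cpsi n)) h2)).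
    by rewrite mulrCA mulfV ?gt_eqF// mulr1.
  have := h1 x; move: h4 h5.
  move: (op h K (b n) chi x) (op h K (b n) (psi n) x) (op h K bint chi x) (chi x) => p q r s.
  rewrite !ler_norml; lra.
have half0 : 0 < 1 / 2 :> R by lra.
have [n /= h1] := filter_ex (psichi _ half0).
have [x xE] := supnorm_attained (cpsi n).
by have := h1 x; rewrite chi0 sub0r normrN -xE psi1; lra.
Unshelve. all: by end_near. Qed.

Let A phi : S2 R -> R := op h K bint phi.
Let Tr (phi : S2 R -> R) : S2 R -> R := fun x => phi x - A phi x.
Let c1 := L2norm (fun _ : S2 R => 1 : R).
Let c10 : 0 <= c1. Proof. exact: L2norm_ge0. Qed.
Let bb1 := @bint_bounded R.

Let cA (phi : S2 R -> R) : continuous phi -> continuous (A phi).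
Proof. exact: (op_continuous hK kL2 kB kC c10). Qed.

Let cT (phi : S2 R -> R) : continuous phi -> continuous (Tr phi).
Proof. by move=> cp; apply: continuous_sub => //; exact: cA. Qed.

Let TB (phi psi : S2 R -> R) : continuous phi -> continuous psi ->
  Tr (fun x => phi x - psi x) = fun x => Tr phi x - Tr psi x.
Proof.
move=> cp cq; apply/funext => x; rewrite /Tr /A (opB hK kL2 _ bb1)//; ring.
Qed.

Let TZ a (phi : S2 R -> R) : continuous phi -> Tr (fun x => a * phi x) = fun x => a * Tr phi x.
Proof.
move=> cp; apply/funext => x; rewrite /Tr /A (opZ hK kL2 _ _ bb1)//; ring.
Qed.

Let cTn n (phi : S2 R -> R) : continuous phi -> continuous (iter n Tr phi).
Proof. by move=> cp; elim: n => //= n; exact: cT. Qed.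

Let TnB n (phi psi : S2 R -> R) : continuous phi -> continuous psi ->
  iter n Tr (fun x => phi x - psi x) = fun x => iter n Tr phi x - iter n Tr psi x.
Proof. by move=> cp cq; elim: n => //= n ->; rewrite TB//; exact: cTn. Qed.

Let TnZ n a (phi : S2 R -> R) : continuous phi ->
  iter n Tr (fun x => a * phi x) = fun x => a * iter n Tr phi x.
Proof. by move=> cp; elim: n => //= n ->; rewrite TZ//; exact: cTn. Qed.

(* Riesz's argument: if [f] is not in the range, then the ranges of the powers
   of [I - A] decrease strictly, and almost orthogonal unit vectors in them have
   images under [A] that stay apart, contradicting compactness. *)
Lemma fredholm f : continuous f ->
  exists2 phi, continuous phi & forall x, phi x - op h K bint phi x = f x.
Proof.
move=> cf; apply: contrapT => nsol.
have [k [B [B0 low]]] : exists k (B : R), 0 < B /\ forall k' b phi, (k <= k')%N ->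
    (b = bint) -> continuous phi ->
    supnorm phi <= B * supnorm (fun x => phi x - op h K b phi x).
  apply: (@uniform_lower_bound c1 (fun _ b => b = bint) c10) => [_ b ->|phi x e _ e0].
    exact: bb1.
  by exists 0%N => k b _ ->; rewrite subrr normr0 ltW.
have {k low} lowT phi : continuous phi -> supnorm phi <= B * supnorm (Tr phi).
  by move=> cp; exact: (low k bint).
have [G [UG ooG]] := ultraFilterLemma (@eventually_filter).
have [BA BA0 BAP] := op_bounded hK kL2 kB c10.
(* The range of I - A is closed: approximate preimages phi_n of f are bounded by [lowT], and if A
   phi_n -> chi along the ultrafilter, then f + chi is a preimage of f. *)
have [d d0 dP] : exists2 d : R, 0 < d & forall phi, continuous phi ->
    d <= supnorm (fun x => f x - Tr phi x).
  apply: contrapT => nd.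
  have bad (n : nat) : exists phi, continuous phi /\
      supnorm (fun x => f x - Tr phi x) <= n.+1%:R^-1.
    apply: contrapT => nb; apply: nd; exists n.+1%:R^-1; first by rewrite invr_gt0.
    by move=> phi cp; rewrite leNgt; apply/negP => lt; apply: nb; exists phi; split => //; exact: ltW.
  have {bad} [phi phiP] := choice bad.
  have cphi n : continuous (phi n) by have [] := phiP n.
  have phiT n x : `|f x - Tr (phi n) x| <= n.+1%:R^-1.
    have [_] := phiP n; apply: le_trans; apply: supnorm_ub.
    by apply: continuous_sub => //; exact: cT.
  have phib n y : `|phi n y| <= B * (supnorm f + 1).
    apply: (le_trans (supnorm_ub y (cphi n))); apply: (le_trans (lowT _ (cphi n))).
    apply: ler_wpM2l; first exact: ltW.
    apply: supnorm_le => x; rewrite -[Tr _ x](subKr (f x)).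
    apply: (le_trans (ler_normB _ _)); rewrite lerD ?supnorm_ub//.
    by apply: (le_trans (phiT n x)); rewrite invf_le1 ?ler1n.
  have [chi [cchi chiP]] := op_ascoli hK kL2 kB kC c10 UG (fun=> bb1) cphi phib.
  apply: nsol; exists (fun x => f x + chi x); first exact: continuous_add.
  move=> x.
  suff key (e : R) : 0 < e -> `|f x + chi x - op h K bint (fun x => f x + chi x) x - f x| <= e.
    by apply/eqP; rewrite -subr_eq0 -normr_le0; apply/ler_addgt0Pr => e e0; rewrite add0r key.
  move=> e0.
  pose e' := e / (2 * (2 + BA)).
  have q0 : 0 < 2 * (2 + BA) by rewrite mulr_gt0// addr_gt0.
  have e'0 : 0 < e' by rewrite divr_gt0.
  have G2 : G [set n | n.+1%:R^-1 <= e'].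
    by apply: ooG; near=> n; apply/ltW; near: n; exact: (near_infty_natSinv_lt (PosNum e'0)).
  have [n [/= h1 h2]] := filter_ex (filterI (chiP _ e'0) G2).
  have hT y := le_trans (phiT n y) h2.
  have near_phi y : `|f y + chi y - phi n y| <= 2 * e'.
    have := hT y; have := h1 y; rewrite /Tr /A !ler_norml; lra.
  have := BAP _ bb1 _ _ x (continuous_sub (continuous_add cf cchi) (cphi n)) near_phi.
  rewrite (opB hK kL2 _ bb1)//; last exact: continuous_add.
  have := hT x; have := near_phi x; rewrite /Tr /A !ler_norml.
  have : e = 4 * e' + BA * (2 * e') by rewrite -[LHS](mulfVK (lt0r_neq0 q0)) -/e'; ring.
  by move: (BA * (2 * e')) => z; lra.
have lowTn n phi : continuous phi -> supnorm phi <= B ^+ n * supnorm (iter n Tr phi).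
  move=> cp; elim: n => [|n IH]; first by rewrite mul1r.
  apply: (le_trans IH); rewrite exprSr -mulrA ler_wpM2l ?exprn_ge0 ?(ltW B0)//.
  exact: (lowT _ (cTn cp)).
(* Riesz's lemma for the range of the (n + 1)-st power of [Tr] inside that of the n-th. The set D
   below consists of the distances from the n-th power at f to points of the smaller range; [lowTn]
   keeps them away from 0. *)
have ex (n : nat) : exists p, [/\ continuous p, supnorm (iter n Tr p) <= 1 &
    forall w, continuous w -> 1 / 2 <= supnorm (fun x => iter n Tr p x - iter n.+1 Tr w x)].
  pose D := [set r | exists2 z, continuous z & r = supnorm (iter n Tr (fun x => f x - Tr z x))].
  have Dd r : D r -> d / B ^+ n <= r.
    move=> [z cz ->]; rewrite ler_pdivrMr ?exprn_gt0// mulrC.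
    apply: le_trans (lowTn n _ _); first exact: dP.
    by apply: continuous_sub => //; exact: cT.
  have dB : 0 < d / B ^+ n by rewrite divr_gt0// exprn_gt0.
  have D0 : D !=set0 by exists (supnorm (iter n Tr (fun x => f x - Tr f x))), f.
  have hinf : has_inf D by split => //; exists (d / B ^+ n).
  have inf0 : d / B ^+ n <= inf D by apply: lb_le_inf.
  (* The infimum serves as its own margin: the chosen norm s is below twice the infimum, whence the
     constant 1 / 2. *)
  have [_ [z cz ->] zP] := inf_adherent (lt_le_trans dB inf0) hinf.
  set y := fun x => f x - Tr z x; have cy : continuous y by apply: continuous_sub => //; exact: cT.
  set s := supnorm (iter n Tr y) in zP.
  have s0 : 0 < s by apply: (lt_le_trans dB); apply: Dd; exists z.
  exists (fun x => s^-1 * y x); split; first exact: continuous_scale.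
    rewrite TnZ//; apply: supnorm_le => x; rewrite normrM gtr0_norm ?invr_gt0//.
    by rewrite ler_pdivrMl// mulr1; apply: supnorm_ub; exact: cTn.
  move=> w cw; rewrite TnZ// iterSr.
  have cz' : continuous (fun x => z x + s * w x).
    by apply: continuous_add => //; exact: continuous_scale.
  have : inf D <= supnorm (iter n Tr (fun x => f x - Tr (fun x => z x + s * w x) x)).
    by apply: inf_lbound; [by case: hinf|exists (fun x => z x + s * w x)].
  have -> : iter n Tr (fun x => f x - Tr (fun x => z x + s * w x) x) =
      fun x => s * (s^-1 * iter n Tr y x - iter n Tr (Tr w) x).
    have cTw : continuous (Tr w) by exact: cT.
    have -> : (fun x => f x - Tr (fun x => z x + s * w x) x) = fun x => y x - s * Tr w x.
      apply/funext => x; have -> : (fun x => z x + s * w x) = (fun x => z x - (- s) * w x).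
        by apply/funext => x'; rewrite mulNr opprK.
      by rewrite TB ?TZ//; [rewrite /y; ring|exact: continuous_scale].
    rewrite TnB//; last exact: continuous_scale.
    rewrite TnZ//; apply/funext => x.
    by rewrite mulrBr mulVKf ?gt_eqF.
  move=> le1; have cw2 : continuous (fun x => s^-1 * iter n Tr y x - iter n Tr (Tr w) x).
    apply: continuous_sub; first by apply: continuous_scale; exact: cTn.
    by apply: cTn; exact: cT.
  have le2 : supnorm (fun x => s * (s^-1 * iter n Tr y x - iter n Tr (Tr w) x)) <=
      s * supnorm (fun x => s^-1 * iter n Tr y x - iter n Tr (Tr w) x).
    apply: supnorm_le => x; rewrite normrM gtr0_norm// ler_wpM2l ?(ltW s0)//.
    exact: (supnorm_ub x cw2).
  rewrite -(ler_pM2l s0); apply: le_trans le2; apply: le_trans le1.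
  by move: zP; rewrite -/y -/s; lra.
have {ex} [p pP] := choice ex.
pose X n := iter n Tr (p n).
have cp n : continuous (p n) by have [] := pP n.
have cX n : continuous (X n) by exact: cTn.
have Xb n y : `|X n y| <= 1.
  by have [_ le1 _] := pP n; apply: le_trans le1; exact: supnorm_ub.
have [chi [cchi chiP]] := op_ascoli hK kL2 kB kC c10 UG (fun=> bb1) cX Xb.
have e8 : 0 < 1 / 8 :> R by lra.
have [n /= nP] := filter_ex (chiP _ e8).
have Gn : G [set m | (n < m)%N] by apply: ooG; exact: nbhs_infty_gt.
have [m [/= mP nm]] := filter_ex (filterI (chiP _ e8) Gn).
(* Since A = I - Tr, A X_n - A X_m equals X_n minus (Tr X_n + X_m - Tr X_m), and for m > n the
   bracket is the (n + 1)-st power of [Tr] at this function. So the images stay 1 / 2 apart, while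
   both are within 1 / 8 of chi. *)
have [_ _ /(_ (fun x => p n x + iter (m - n.+1) Tr (p m) x - iter (m - n) Tr (p m) x))] := pP n.
have cpp : continuous (fun x => p n x + iter (m - n.+1) Tr (p m) x).
  by apply: continuous_add => //; exact: cTn.
have cq : continuous (fun x => p n x + iter (m - n.+1) Tr (p m) x - iter (m - n) Tr (p m) x).
  by apply: continuous_sub => //; exact: cTn.
move=> /(_ cq).
have -> : (fun x => iter n Tr (p n) x - iter n.+1 Tr
    (fun x => p n x + iter (m - n.+1) Tr (p m) x - iter (m - n) Tr (p m) x) x) =
    fun x => A (X n) x - A (X m) x.
  apply/funext => x; rewrite TnB//; last exact: cTn.
  have -> : (fun x => p n x + iter (m - n.+1) Tr (p m) x) =
      (fun x => p n x - (-1) * iter (m - n.+1) Tr (p m) x).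
    by apply/funext => x'; rewrite mulN1r opprK.
  rewrite TnB//; last by apply: continuous_scale; exact: cTn.
  rewrite TnZ; last exact: cTn.
  rewrite -!iterD subnKC// addSn subnKC; last exact: ltnW.
  by rewrite [iter n.+1 Tr (p n)]iterS [iter m.+1 Tr (p m)]iterS -/(X n) -/(X m) /Tr; ring.
apply/negP; rewrite -ltNge; apply: (@le_lt_trans _ _ (1 / 4)); last by lra.
apply: supnorm_le => x; have := nP x; have := mP x.
by rewrite /A !ler_norml; lra.
Unshelve. all: by end_near. Qed.

End LowerBound.

(** * The spaces of spherical polynomials *)

(** Both families have the same finite index set. A vector in the left kernel of M gives a vanishing
    combination of the Y, so the square matrix M is invertible; independence of the E is not
    assumed. *)
Lemma invert_basis (R : realType) (S : Type) (I : finType) (Y E : I -> S -> R) (M : I -> I -> R) :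
  (forall i x, Y i x = \sum_j M i j * E j x) ->
  (forall v : I -> R, (forall x, \sum_i v i * Y i x = 0) -> forall i, v i = 0) ->
  forall j, exists c : I -> R, forall x, E j x = \sum_i c i * Y i x.
Proof.
move=> YE free j.
pose A : 'M[R]_#|I| := \matrix_(i, j) M (enum_val i) (enum_val j).
have sumE (F : I -> R) : \sum_i F i = \sum_(i < #|I|) F (enum_val i).
  by transitivity (\sum_(i in I) F i); [exact: eq_bigl|exact: big_enum_val].
have AE i x : Y (enum_val i) x = \sum_k A i k * E (enum_val k) x.
  by rewrite YE sumE; apply: eq_bigr => k _; rewrite mxE.
have uA : A \in unitmx.
  rewrite -row_free_unit -kermx_eq0; apply/rowV0P => v /sub_kermxP vA.
  apply/rowP => i; rewrite mxE -[i]enum_valK; apply: (free (fun i => v 0 (enum_rank i))) => x.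
  rewrite sumE.
  transitivity (\sum_k (v *m A) 0 k * E (enum_val k) x); last first.
    by rewrite big1// => k _; rewrite vA mxE mul0r.
  transitivity (\sum_i0 \sum_k v 0 i0 * A i0 k * E (enum_val k) x).
    by apply: eq_bigr => k _; rewrite enum_valK AE mulr_sumr; apply: eq_bigr => l _; rewrite mulrA.
  rewrite exchange_big; apply: eq_bigr => k _; rewrite mxE mulr_suml.
  by apply: eq_bigr.
exists (fun i => invmx A (enum_rank j) (enum_rank i)) => x.
rewrite sumE; under eq_bigr do rewrite enum_valK AE mulr_sumr.
rewrite exchange_big /=.
transitivity (\sum_k (invmx A *m A) (enum_rank j) k * E (enum_val k) x).
  rewrite mulVmx// (bigD1 (enum_rank j))//= big1 => [|k kj].
    by rewrite mxE eqxx mul1r addr0 enum_rankK.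
  by rewrite mxE eq_sym (negbTE kj) mul0r.
apply: eq_bigr => k _; rewrite mxE mulr_suml; apply: eq_bigr => l _.
by rewrite mulrA.
Qed.

Section PolynomialSpace.
Context {R : realType}.

(** One finite type for all pairs (l, k) of degree at most n: harmonics and reduced monomials must
    share it for [invert_basis]. *)
Definition deg_index (n : nat) : finType := {l : 'I_n.+1 & 'I_(2 * l + 1)}.

(* Modulo [z^2 = 1 - x^2 - y^2], the homogeneous polynomials of degree [l] are
   spanned by the [2 l + 1] monomials [x^a y^b] and [x^a y^b z]. *)
Definition red_monom (l k : nat) : S2 R -> R :=
  if (k <= l)%N then monom k (l - k) 0 else monom (k - l.+1) (2 * l - k) 1.

Definition red_span (n : nat) (f : S2 R -> R) : Prop :=
  exists c : deg_index n -> R, forall x, f x = \sum_i c i * red_monom (tag i) (tagged i) x.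

Lemma red_span0 n : red_span n (fun=> 0).
Proof. by exists (fun=> 0) => x; rewrite big1// => i _; rewrite mul0r. Qed.

Lemma red_spanD n a f g : red_span n f -> red_span n g -> red_span n (fun x => a * f x + g x).
Proof.
move=> [c cf] [d dg]; exists (fun i => a * c i + d i) => x.
rewrite cf dg mulr_sumr -big_split; apply: eq_bigr => i _ /=; ring.
Qed.

Lemma red_span_index n (l k : nat) : (l <= n)%N -> (k <= 2 * l)%N -> red_span n (red_monom l k).
Proof.
move=> ln kl; have ln' : (l < n.+1)%N by [].
have kl' : (k < 2 * Ordinal ln' + 1)%N by rewrite addn1.
pose i0 : deg_index n := @Tagged _ (Ordinal ln') (fun l : 'I_n.+1 => 'I_(2 * l + 1)) (Ordinal kl').
exists (fun i => (i == i0)%:R) => x.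
rewrite (bigD1 i0)//= eqxx mul1r big1 ?addr0// => i ii0.
by rewrite (negbTE ii0) mul0r.
Qed.

Lemma red_span_monom n a b d : (a + b + d <= n)%N -> red_span n (monom a b d).
Proof.
have [m] := ubnP d; elim: m a b d => // m IH a b [|[|d]] dm abd.
- have -> : monom a b 0 = red_monom (a + b) a by rewrite /red_monom leq_addr addKn.
  by apply: red_span_index; lia.
- have -> : monom a b 1 = red_monom (a + b + 1) (a + (a + b + 1).+1).
    rewrite /red_monom ifF; last by apply/negP; lia.
    by rewrite addnK; congr (monom _ _ _); lia.
  by apply: red_span_index; lia.
have h1 : red_span n (monom a b d) by apply: IH; lia.
have h2 : red_span n (monom a.+2 b d) by apply: IH; lia.
have h3 : red_span n (monom a b.+2 d) by apply: IH; lia.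
have [c cP] := red_spanD (-1) h3 (red_spanD (-1) h2 h1).
exists c => x; rewrite -cP /monom.
have := coor_sqr x; move: (coor i0 x) (coor i1 x) (coor i2 x) => X Y Z XYZ.
have ZE : Z ^+ 2 = 1 - X ^+ 2 - Y ^+ 2 by rewrite -XYZ; ring.
rewrite -[d.+2]addn2 -[a.+2]addn2 -[b.+2]addn2 !exprD ZE; ring.
Qed.

Lemma polyfun_red_span n f : polyfun n f -> red_span n f.
Proof.
elim=> [|c a b d g abd _ sg]; first exact: red_span0.
by apply: red_spanD => //; exact: red_span_monom.
Qed.

Lemma spherical_harmonic_polyfun l (Y : S2 R -> R) : spherical_harmonic l Y -> polyfun l Y.
Proof.
move=> [p [/mpoly.dhomogP hp _ Yp]].
(* The guard is vacuous along the support; it is there because [polyfun_sum] asks for the degree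
   bound at every index. *)
have -> : Y = fun x => \sum_(m <- mpoly.msupp p)
    (if m \in mpoly.msupp p then mpoly.mcoeff m p else 0) * monom (m i0) (m i1) (m i2) x.
  apply/funext => x; rewrite Yp mpoly.mevalE; apply: eq_big_seq => m mp.
  by rewrite mp prod3.
apply: polyfun_sum => m _; case: ifPn => mp.
  apply: polyfunZ; apply: polyfun_monom.
  have <- : mpoly.mdeg m = l by exact: hp.
  rewrite mpoly.mdegE !big_ord_recr big_ord0 /= add0n.
  by apply: eq_leq; congr (m _ + m _ + m _)%N; exact/val_inj.
by apply: (polyfun_ext _ (polyfun0 l)) => x; rewrite mul0r.
Qed.

End PolynomialSpace.

(** * The harmonics as a basis of the polynomial functions, and orthogonal projection *)

Section HarmonicSystem.
Context {R : realType}.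
Variable Y : forall l : nat, 'I_(2 * l + 1) -> S2 R -> R.
Hypothesis hY : harmonic_orthonormal_system Y.

Definition Yidx n (i : deg_index n) : S2 R -> R := Y (tagged i).

Lemma polyfun_Yidx n (i : deg_index n) : polyfun n (Yidx i).
Proof.
have [sh _] := hY; apply: (@polyfun_le _ (tag i)); first by rewrite -ltnS.
by apply: spherical_harmonic_polyfun; exact: sh.
Qed.

Lemma continuous_Yidx n (i : deg_index n) : continuous (Yidx i).
Proof. exact: (polyfun_continuous (polyfun_Yidx i)). Qed.

Lemma sL2_Yidx n (i : deg_index n) : sL2 (Yidx i).
Proof. by apply: sL2_continuous; exact: continuous_Yidx. Qed.

Lemma Yidx_orthonormal n (i j : deg_index n) :
  surf_int (fun x => Yidx i x * Yidx j x) = (i == j)%:R.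
Proof.
have [_ ->] := hY; have [->|ij] := eqVneq i j; first by rewrite !eqxx.
congr (_%:R); congr nat_of_bool; apply/negP => /andP[/eqP ll' /eqP kk'].
move/eqP: ij; apply; case: i j ll' kk' => [l k] [l' k'] /= ll'.
move/val_inj: ll' => ll'; subst l' => kk'.
by congr existT; exact: val_inj.
Qed.

Lemma sum_deg_index n (F : forall l : nat, 'I_(2 * l + 1) -> R) :
  \sum_(l < n.+1) \sum_(k < 2 * l + 1) F l k = \sum_(i : deg_index n) F (tag i) (tagged i).
Proof.
rewrite (@sig_big_dep _ _ _ _ (fun l : 'I_n.+1 => 'I_(2 * l + 1)) predT (fun _ => predT)
  (fun l k => F l k)).
exact: eq_bigl.
Qed.

Lemma PspaceP n (chi : S2 R -> R) :
  Pspace Y n chi <-> exists c : deg_index n -> R, forall x, chi x = \sum_i c i * Yidx i x.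
Proof.
split=> [[a ->]|[c chiE]].
  exists (fun i : deg_index n => a (tag i) (tagged i)) => x.
  by rewrite (@sum_deg_index n (fun l k => a l k * Y k x)).
(* The coefficients in [Pspace] are indexed by all degrees; those above n are set to 0, and matching
   on [idP] provides the bound needed to form the ordinal. *)
pose a (l : nat) (k : 'I_(2 * l + 1)) : R :=
  match @idP (l < n.+1)%N with
  | ReflectT ln => c (@Tagged _ (Ordinal ln) (fun l : 'I_n.+1 => 'I_(2 * l + 1)) k)
  | ReflectF _ => 0
  end.
exists a; apply/funext => x; rewrite (@sum_deg_index n (fun l k => a l k * Y k x)) chiE.
apply: eq_bigr => -[[l ln] k] _ /=; congr (_ * _); rewrite /a /=.
case: {-}_ / idP => [ln'|//]; congr (c _).
by rewrite (bool_irrelevance ln ln').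
Qed.

Lemma Pspace_lin n (a b : R) chi psi : Pspace Y n chi -> Pspace Y n psi ->
  Pspace Y n (fun x => a * chi x + b * psi x).
Proof.
move=> /PspaceP[c cE] /PspaceP[d dE]; apply/PspaceP; exists (fun i => a * c i + b * d i) => x.
rewrite cE dE !mulr_sumr -big_split; apply: eq_bigr => i _ /=; ring.
Qed.

Lemma Pspace_polyfun n chi : Pspace Y n chi -> polyfun n chi.
Proof.
move=> /PspaceP[c cE]; apply: (@polyfun_ext R n (fun x => \sum_i c i * Yidx i x)) => //.
by apply: polyfun_sum => i _; apply: polyfunZ; exact: polyfun_Yidx.
Qed.

Lemma Pspace_continuous n chi : Pspace Y n chi -> continuous chi.
Proof. by move=> /Pspace_polyfun; exact: polyfun_continuous. Qed.

Lemma Pspace_coef n (c : deg_index n -> R) j :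
  surf_int (fun x => (\sum_i c i * Yidx i x) * Yidx j x) = c j.
Proof.
under [X in surf_int X]eq_fun do rewrite mulr_suml.
rewrite surf_int_sum; last first.
  move=> i _; apply: (@eq_sL1 _ (fun x => c i * (Yidx i x * Yidx j x))) => [x|].
    by rewrite mulrA.
  by apply: sL1Z; apply: sL2M; exact: sL2_Yidx.
rewrite (bigD1 j)//= big1 ?addr0 => [|i ij].
  under eq_fun do rewrite -mulrA.
  by rewrite surf_intZ ?Yidx_orthonormal ?eqxx ?mulr1//; apply: sL2M; exact: sL2_Yidx.
under eq_fun do rewrite -mulrA.
rewrite surf_intZ ?Yidx_orthonormal ?(negbTE ij) ?mulr0//.
by apply: sL2M; exact: sL2_Yidx.
Qed.

(** A dimension count. The harmonics of degree at most n are combinations of equally many reduced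
    monomials and are free by orthonormality; inverting the matrix expresses the monomials through
    harmonics. Completeness of the system is thereby proved, not assumed. *)
Lemma polyfun_Pspace n f : polyfun n f -> Pspace Y n f.
Proof.
move=> pf; apply/PspaceP; pose E (i : deg_index n) := red_monom (R := R) (tag i) (tagged i).
have [M ME] : exists M : deg_index n -> deg_index n -> R,
    forall i x, Yidx i x = \sum_j M i j * E j x.
  suff [M ME] : {M : deg_index n -> deg_index n -> R &
      forall i x, Yidx i x = \sum_j M i j * E j x} by exists M.
  apply: (@choice _ _ (fun i (c : deg_index n -> R) => forall x, Yidx i x = \sum_j c j * E j x)).
  by move=> i; exact: (polyfun_red_span (polyfun_Yidx i)).
have free (v : deg_index n -> R) : (forall x, \sum_i v i * Yidx i x = 0) -> forall i, v i = 0.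
  move=> v0 j; rewrite -(Pspace_coef v j).
  under eq_fun do rewrite v0 mul0r.
  exact: surf_int0.
have inv := invert_basis ME free.
have {inv} [c cE] := choice inv.
have [d dE] := polyfun_red_span pf.
exists (fun i => \sum_j d j * c j i) => x; rewrite dE.
under [RHS]eq_bigr do rewrite mulr_suml.
rewrite [RHS]exchange_big; apply: eq_bigr => j _ /=.
by rewrite -/(E j) cE mulr_sumr; apply: eq_bigr => i _; rewrite mulrA.
Qed.

Definition harm_proj n (H : S2 R -> R) : S2 R -> R :=
  fun x => \sum_(i : deg_index n) surf_int (fun y => H y * Yidx i y) * Yidx i x.

Lemma harm_proj_Pspace n H : Pspace Y n (harm_proj n H).
Proof. by apply/PspaceP; eexists => x; reflexivity. Qed.

Lemma sL2_Pspace n chi : Pspace Y n chi -> sL2 chi.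
Proof. by move=> /Pspace_continuous; exact: sL2_continuous. Qed.

Lemma harm_projB n H H' x : sL2 H -> sL2 H' ->
  harm_proj n (fun y => H y - H' y) x = harm_proj n H x - harm_proj n H' x.
Proof.
move=> LH LH'; rewrite /harm_proj -sumrB; apply: eq_bigr => i _; rewrite -mulrBl; congr (_ * _).
rewrite -surf_intB; [|exact: sL2M (sL2_Yidx i)|exact: sL2M (sL2_Yidx i)].
by congr surf_int; apply/funext => y; rewrite mulrBl.
Qed.

Lemma harm_proj_id n chi : Pspace Y n chi -> harm_proj n chi = chi.
Proof.
move=> /PspaceP[c cE]; apply/funext => x; rewrite cE; apply: eq_bigr => i _; congr (_ * _).
rewrite -[RHS](Pspace_coef c i); congr surf_int; apply/funext => y.
by rewrite cE.
Qed.

Lemma harm_proj_inner n chi H : Pspace Y n chi -> sL2 H ->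
  surf_int (fun x => chi x * harm_proj n H x) = surf_int (fun x => chi x * H x).
Proof.
move=> Pchi LH; have Lchi := sL2_Pspace Pchi; move: (Pchi) => /PspaceP[c cE].
have intE (G : S2 R -> R) : sL2 G ->
    surf_int (fun x => chi x * G x) = \sum_i c i * surf_int (fun x => G x * Yidx i x).
  move=> LG; have L1 i : sL1 (fun x => G x * Yidx i x) by apply: sL2M => //; exact: sL2_Yidx.
  under eq_bigr do rewrite -surf_intZ//.
  rewrite -surf_int_sum; last by move=> i _; exact: sL1Z.
  congr surf_int; apply/funext => x; rewrite cE mulr_suml; apply: eq_bigr => i _; ring.
rewrite !intE//; last exact: sL2_Pspace (harm_proj_Pspace n H).
by apply: eq_bigr => i _; congr (_ * _); rewrite Pspace_coef.
Qed.

(** The squared norm of the projection is its inner product with H; Cauchy-Schwarz and division by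
    the norm finish. *)
Lemma L2norm_harm_proj n H : sL2 H -> L2norm (harm_proj n H) <= L2norm H.
Proof.
move=> LH; have PH := harm_proj_Pspace n H.
have h : L2norm (harm_proj n H) ^+ 2 <= L2norm (harm_proj n H) * L2norm H.
  rewrite L2norm_sqr; 
  have -> : (fun x => harm_proj n H x ^+ 2) = (fun x => harm_proj n H x * harm_proj n H x).
    by apply/funext => x; rewrite expr2.
  rewrite harm_proj_inner//; apply: le_trans (ler_norm _) _.
  by apply: cauchy_schwarz => //; exact: sL2_Pspace PH.
have [p0|p0] := eqVneq (L2norm (harm_proj n H)) 0; first by rewrite p0 L2norm_ge0.
have pp : 0 < L2norm (harm_proj n H) by rewrite lt_def p0 L2norm_ge0.
by rewrite -(ler_pM2l pp) -expr2.
Qed.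

(** The approximant stays the same for all large n. Its L^2 norm is therefore fixed while eta
    decreases, so that the term eta |chi|_2 of the error bound tends to 0. *)
Lemma Pspace_dense (g : S2 R -> R) : continuous g -> forall e : R, 0 < e ->
  exists N chi, (forall n, (N <= n)%N -> Pspace Y n chi) /\ forall x, `|g x - chi x| <= e.
Proof.
move=> cg e e0; have [N [chi pchi gchi]] := polyfun_dense cg e0.
exists N, chi; split => // n Nn; apply: polyfun_Pspace; exact: polyfun_le pchi.
Qed.

Lemma Pspace0 n : Pspace Y n (fun=> 0).
Proof. exact: (polyfun_Pspace (polyfun0 n)). Qed.

(* A minimizing sequence is bounded in a finite-dimensional space, hence
   equicontinuous; its uniform limit along an ultrafilter is again in the space
   because the orthogonal projection is continuous. *)
Lemma best_approx_exists n g : continuous g -> exists chi, best_approx Y n g chi.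
Proof.
move=> cg; set D := [set supnorm (fun x => g x - chi x) | chi in Pspace Y n].
have cgP chi : Pspace Y n chi -> continuous (fun x => g x - chi x).
  by move=> Pc; apply: continuous_sub => //; exact: Pspace_continuous Pc.
have hinf : has_inf D.
  split; first by exists (supnorm (fun x => g x - 0)), (fun=> 0) => //; exact: Pspace0.
  by exists 0 => _ [psi Ppsi <-]; apply: supnorm_ge0; exact: cgP.
have seq (k : nat) : exists chi, Pspace Y n chi /\
    supnorm (fun x => g x - chi x) <= inf D + k.+1%:R^-1.
  have k0 : 0 < k.+1%:R^-1 :> R by rewrite invr_gt0.
  have [_ [chi Pchi <-] le] := inf_adherent k0 hinf.
  by exists chi; split => //; exact: ltW.
have {seq} [chi chiP] := choice seq.
have Pc k : Pspace Y n (chi k) by have [] := chiP k.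
have cc k : continuous (chi k) by exact: Pspace_continuous (Pc k).
have dist k x : `|g x - chi k x| <= inf D + k.+1%:R^-1.
  by have [_] := chiP k; apply: le_trans; apply: supnorm_ub; exact: cgP.
have [M M0 gM] := continuous_bounded_compact compact_S2 cg.
pose N := M + (inf D + 1).
have bnd k x : `|chi k x| <= N.
  rewrite -[chi k x](subKr (g x)); apply: (le_trans (ler_normB _ _)); rewrite lerD//.
  by apply: (le_trans (dist k x)); rewrite lerD2l invf_le1 ?ler1n.
have N0 : 0 <= N by have [x _] := @S2_nonempty R; exact: (le_trans (normr_ge0 _) (bnd 0%N x)).
have [c cE] := choice (fun k => (PspaceP n (chi k)).1 (Pc k)).
pose L := L2norm (fun _ : S2 R => 1 : R).
have cb k i : `|c k i| <= L * N.
  rewrite -(Pspace_coef (c k) i); under eq_fun do rewrite -cE.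
  apply: (le_trans (cauchy_schwarz (sL2_Pspace (Pc k)) (sL2_Yidx i))).
  have -> : L2norm (Yidx i) = 1.
    rewrite /L2norm; under eq_fun do rewrite expr2.
    by rewrite Yidx_orthonormal eqxx sqrtr1.
  by rewrite mulr1; apply: L2norm_le => //; exact: sL2_Pspace (Pc k).
have LN : 0 < L * N + 1 by rewrite ltr_wpDl// mulr_ge0// L2norm_ge0.
have equi (x : S2 R) (e : R) : 0 < e -> \forall y \near x, forall k, `|chi k x - chi k y| <= e.
  move=> e0; pose d := e / (L * N + 1) / (#|{: deg_index n}|.+1)%:R.
  have d0 : 0 < d by rewrite !divr_gt0.
  have nearY : \forall y \near x, forall i : deg_index n, `|Yidx i x - Yidx i y| <= d.
    have : \forall y \near x, forall i : deg_index n, i \in enum {: deg_index n} ->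
        `|Yidx i x - Yidx i y| <= d.
      elim: (enum _) => [|i s IH]; first by apply: filterS (@filterT _ (nbhs x) _) => y _ i; rewrite in_nil.
      have hi : \forall y \near x, `|Yidx i x - Yidx i y| <= d.
        exact: (continuous_near _ (@continuous_Yidx n i)).
      apply: filterS (filterI hi IH) => y [/= h1 h2] j; rewrite inE => /orP[/eqP -> //|].
      exact: h2.
    by apply: filterS => y h i; apply: h; rewrite mem_enum.
  apply: filterS nearY => y h k; rewrite !cE -sumrB.
  apply: (le_trans (ler_norm_sum _ _ _)).
  apply: (@le_trans _ _ (\sum_(i : deg_index n) ((L * N + 1) * d))).
    apply: ler_sum => i _; rewrite -mulrBr normrM ler_pM//.
    by apply: (le_trans (cb k i)); rewrite lerDl.
  rewrite sumr_const -mulr_natr /d.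
  have -> : (L * N + 1) * (e / (L * N + 1) / (#|{: deg_index n}|.+1)%:R) * #|{: deg_index n}|%:R
      = e * (#|{: deg_index n}|%:R / (#|{: deg_index n}|.+1)%:R).
    have p0 : #|{: deg_index n}|.+1%:R != 0 :> R by rewrite pnatr_eq0.
    move: p0 (lt0r_neq0 LN); move: (_.+1%:R) (L * N + 1) => p q p0 q0.
    by field; apply/andP.
  by rewrite ler_piMr ?(ltW e0)// ler_pdivrMr ?ltr0Sn// mul1r ler_nat.
have [G [UG ooG]] := ultraFilterLemma (@eventually_filter).
have [psi [cpsi psiP]] := ascoli_ultra compact_S2 UG equi bnd.
have Lpsi := sL2_continuous cpsi.
have Ppsi : Pspace Y n psi.
  suff -> : psi = harm_proj n psi by exact: harm_proj_Pspace.
  apply/funext => x; apply/eqP; rewrite -subr_eq0 -normr_le0.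
  pose q := \sum_(i : deg_index n) (L * `|Yidx i x|).
  have q0 : 0 <= q by apply: sumr_ge0 => i _; rewrite mulr_ge0// L2norm_ge0.
  suff key (e : R) : 0 < e -> `|psi x - harm_proj n psi x| <= e.
    by apply/ler_addgt0Pr => e e0; rewrite add0r key.
  move=> e0; pose d := e / (1 + q); have q1 : 0 < 1 + q by rewrite ltr_pwDl.
  have d0 : 0 < d by rewrite divr_gt0.
  have [k /= kP] := filter_ex (psiP _ d0).
  have -> : psi x - harm_proj n psi x = (psi x - chi k x) - harm_proj n (fun y => psi y - chi k y) x.
    rewrite harm_projB//; last exact: sL2_Pspace (Pc k).
    by rewrite (harm_proj_id (Pc k)); ring.
  apply: (le_trans (ler_normB _ _)).
  apply: (@le_trans _ _ (d + d * q)); last first.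
    by rewrite -[X in X + _]mulr1 -mulrDr /d mulfVK// gt_eqF.
  rewrite lerD// /harm_proj /q mulr_sumr; apply: (le_trans (ler_norm_sum _ _ _)).
  apply: ler_sum => i _; rewrite normrM mulrA ler_wpM2r//.
  have Ld : sL2 (fun y => psi y - chi k y) by apply: sL2B => //; exact: sL2_Pspace (Pc k).
  apply: (le_trans (cauchy_schwarz Ld (sL2_Yidx i))).
  have -> : L2norm (Yidx i) = 1.
    rewrite /L2norm; under eq_fun do rewrite expr2.
    by rewrite Yidx_orthonormal eqxx sqrtr1.
  by rewrite mulr1 mulrC; apply: L2norm_le => //; exact: ltW.
exists psi; split => //; apply/eqP; rewrite eq_le; apply/andP; split; last first.
  by apply: inf_lbound; [case: hinf|exists psi].
apply: supnorm_le => x.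
suff key (e : R) : 0 < e -> `|g x - psi x| <= inf D + e.
  by apply/ler_addgt0Pr => e e0; exact: key.
move=> e0; have e2 : 0 < e / 2 by rewrite divr_gt0.
have G2 : G [set k | k.+1%:R^-1 <= e / 2].
  by apply: ooG; near=> k; apply/ltW; near: k; exact: (near_infty_natSinv_lt (PosNum e2)).
have [k [/= h1 h2]] := filter_ex (filterI (psiP _ e2) G2).
have := le_trans (dist k x) (lerD (lexx _) h2); have := h1 x.
move: (chi k x) (psi x) (g x) (inf D) => p q r s; rewrite !ler_norml; lra.
Unshelve. all: by end_near. Qed.

End HarmonicSystem.

(** * Quadrature with the Marcinkiewicz-Zygmund property *)

Lemma weighted_cauchy_schwarz (R : realType) (I : finType) (w a b : I -> R) :
  (forall i, 0 <= w i) ->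
  `|\sum_i w i * a i * b i| <= Num.sqrt (\sum_i w i * a i ^+ 2) * Num.sqrt (\sum_i w i * b i ^+ 2).
Proof.
move=> w0; have sq (u : I -> R) : 0 <= \sum_i w i * u i ^+ 2.
  by apply: sumr_ge0 => i _; rewrite mulr_ge0 ?sqr_ge0.
apply: quadratic_discriminant; rewrite ?sqrtr_ge0// => s t.
rewrite !sqr_sqrtr//; apply: le_trans (sq (fun i => s * a i + t * b i)) _.
rewrite !mulr_sumr -!big_split /=; apply: ler_sum => i _.
by rewrite le_eqVlt; apply/orP; left; apply/eqP; ring.
Qed.

Section Quadrature.
Context {R : realType}.
Variable Y : forall l : nat, 'I_(2 * l + 1) -> S2 R -> R.
Hypothesis hY : harmonic_orthonormal_system Y.
Variables (D : set nat) (node : forall m : nat, 'I_m -> S2 R)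
  (weight : forall m : nat, 'I_m -> R) (C : R).
Hypothesis hquad : quadrature_family D node weight C.

Definition bquad (m n : nat) (g H : S2 R -> R) : R :=
  \sum_(j < m) weight j * g (node j) * harm_proj Y n H (node j).

Variables (m n : nat) (eta : R).
Hypothesis hG : Gamma Y D node weight m n eta.

Let eta0 : 0 <= eta. Proof. by have [_ /andP[]] := hG. Qed.
Let eta1 : eta <= 1. Proof. by have [_ /andP[_ /ltW]] := hG. Qed.

Lemma weight_ge0 (j : 'I_m) : 0 <= weight j.
Proof. by have [Dm _ _] := hG; have [_ w0 _] := hquad Dm; exact: ltW. Qed.

Lemma weight_sum_le : \sum_(j < m) weight j <= C.
Proof. by have [Dm _ _] := hG; have [_ _ /ltW] := hquad Dm. Qed.

Lemma quad_bound_ge0 : 0 <= C.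
Proof. by apply: le_trans weight_sum_le; apply: sumr_ge0 => j _; exact: weight_ge0. Qed.

(** The lower inequality at a chi + b psi and the upper one at a chi - b psi add up to the
    nonnegativity of a quadratic form in (a, b) with diagonal eta |chi|^2, eta |psi|^2 and the
    quadrature error off the diagonal. *)
Lemma mz_polarized chi psi : Pspace Y n chi -> Pspace Y n psi ->
  `|\sum_(j < m) weight j * chi (node j) * psi (node j) - surf_int (fun x => chi x * psi x)|
    <= eta * L2norm chi * L2norm psi.
Proof.
move=> Pc Pp; have Lc := sL2_Pspace hY Pc; have Lp := sL2_Pspace hY Pp.
set B := _ - _.
pose N (u : S2 R -> R) : R := surf_int (fun x => u x ^+ 2).
pose S (u : S2 R -> R) : R := \sum_(j < m) weight j * u (node j) ^+ 2.
have mz u : Pspace Y n u -> (1 - eta) * N u <= S u <= (1 + eta) * N u.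
  by have [_ _] := hG; exact.
have Nab (a b : R) : N (fun x => a * chi x + b * psi x) =
    a ^+ 2 * N chi + 2 * a * b * surf_int (fun x => chi x * psi x) + b ^+ 2 * N psi.
  have I1 := sL1Z (a ^+ 2) Lc.2; have I2 := sL1Z (b ^+ 2) Lp.2.
  have I3 := sL1Z (2 * a * b) (sL2M Lc Lp).
  rewrite /N -!surf_intZ; [|exact: Lp.2|exact: sL2M|exact: Lc.2].
  rewrite -!surf_intD//; last exact: sL1D.
  by congr surf_int; apply/funext => x; ring.
have Sab (a b : R) : S (fun x => a * chi x + b * psi x) =
    a ^+ 2 * S chi + 2 * a * b * (\sum_(j < m) weight j * chi (node j) * psi (node j)) + b ^+ 2 * S psi.
  rewrite /S !mulr_sumr -!big_split; apply: eq_bigr => j _ /=; ring.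
have -> : eta * L2norm chi * L2norm psi =
    (Num.sqrt eta * L2norm chi) * (Num.sqrt eta * L2norm psi).
  by rewrite mulrACA -expr2 sqr_sqrtr// mulrA.
apply: quadratic_discriminant; rewrite ?mulr_ge0 ?sqrtr_ge0// => a b.
rewrite !exprMn sqr_sqrtr// !L2norm_sqr -/(N chi) -/(N psi).
have /andP[p1 p2] := mz _ (Pspace_lin a b Pc Pp).
have /andP[q1 q2] := mz _ (Pspace_lin a (- b) Pc Pp).
rewrite Nab Sab in p1; rewrite Nab Sab in q2; rewrite /B.
move: (surf_int _) (\sum_(j < m) _) p1 q2 => i s p1 q2; lra.
Qed.

Lemma bquad_bound g H (M : R) : sL2 H -> (forall y, `|g y| <= M) ->
  `|bquad m n g H| <= Num.sqrt (2 * C) * M * L2norm H.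
Proof.
move=> LH gM; have M0 : 0 <= M.
  by have [x _] := @S2_nonempty R; exact: (le_trans (normr_ge0 _) (gM x)).
apply: (le_trans (weighted_cauchy_schwarz _ _ weight_ge0)).
have h1 : Num.sqrt (\sum_(j < m) weight j * g (node j) ^+ 2) <= Num.sqrt C * M.
  rewrite -[X in _ * X](ger0_norm M0) -sqrtr_sqr -sqrtrM ?quad_bound_ge0//; apply: ler_wsqrtr.
  apply: (@le_trans _ _ ((\sum_(j < m) weight j) * M ^+ 2)).
    rewrite mulr_suml; apply: ler_sum => j _; rewrite ler_wpM2l ?weight_ge0//.
    by rewrite -(real_normK (num_real (g _))) ler_pXn2r ?nnegrE.
  by rewrite ler_wpM2r ?sqr_ge0// weight_sum_le.
(* The factor 2 bounds 1 + eta and frees the constant from eta. *)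
have h2 : Num.sqrt (\sum_(j < m) weight j * harm_proj Y n H (node j) ^+ 2) <= Num.sqrt 2 * L2norm H.
  apply: (@le_trans _ _ (Num.sqrt 2 * L2norm (harm_proj Y n H))); last first.
    by rewrite ler_wpM2l ?sqrtr_ge0// L2norm_harm_proj.
  rewrite /L2norm -sqrtrM//; apply: ler_wsqrtr.
  have [_ _ /(_ _ (harm_proj_Pspace Y n H))/andP[_ /le_trans]] := hG; apply.
  apply: ler_wpM2r; first by apply: surf_int_ge0 => x; exact: sqr_ge0.
  by rewrite -[2](@natr1 R 1) addrC lerD2r.
apply: (le_trans (ler_pM (sqrtr_ge0 _) (sqrtr_ge0 _) h1 h2)).
by rewrite le_eqVlt sqrtrM//; apply/orP; left; apply/eqP; ring.
Qed.

Lemma bquad_bounded : bilin_bounded (Num.sqrt (2 * C)) (bquad m n).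
Proof.
split.
- move=> g g' H _ _ _; rewrite /bquad -sumrB; apply: eq_bigr => j _; ring.
- move=> a g H _ _; rewrite /bquad mulr_sumr; apply: eq_bigr => j _; ring.
- move=> g H H' _ LH LH'; rewrite /bquad -sumrB; apply: eq_bigr => j _.
  by rewrite harm_projB//; ring.
- by move=> g H M _ LH gM; exact: bquad_bound.
Qed.

(** Both forms see g - chi only through d. On chi the exact form may replace H by its projection,
    since chi is in P_n, and then the polarized property applies. The polynomial chi is free:
    convergence uses a fixed one, the final estimate the best approximation. *)
Lemma bquad_error g H chi (d : R) : continuous g -> sL2 H -> Pspace Y n chi ->
  (forall y, `|g y - chi y| <= d) ->
  `|bquad m n g H - bint g H| <= L2norm H *
     ((Num.sqrt (2 * C) + L2norm (fun _ : S2 R => 1)) * d + eta * L2norm chi).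
Proof.
move=> cg LH Pc gd; have cc := Pspace_continuous hY Pc.
have cgc := continuous_sub cg cc.
have [qB _ _ qb] := bquad_bounded; have [iB _ _ ib] := @bint_bounded R.
have E1 := qB _ _ _ cg cc LH; have E2 := iB _ _ _ cg cc LH.
have h1 := qb _ _ _ cgc LH gd; have h2 := ib _ _ _ cgc LH gd.
have h3 : `|bquad m n chi H - bint chi H| <= eta * L2norm chi * L2norm H.
  rewrite /bquad /bint -(harm_proj_inner hY Pc LH).
  apply: (le_trans (mz_polarized Pc (harm_proj_Pspace Y n H))).
  by rewrite ler_wpM2l ?L2norm_harm_proj// mulr_ge0// L2norm_ge0.
rewrite E1 in h1; rewrite E2 in h2.
move: (bquad m n g H) (bquad m n chi H) (bint g H) (bint chi H) h1 h2 h3 => p q r s.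
set c := Num.sqrt (2 * C); set L := L2norm (fun=> 1).
have -> : L2norm H * ((c + L) * d + eta * L2norm chi) =
  c * d * L2norm H + L * d * L2norm H + eta * L2norm chi * L2norm H by ring.
move: (c * d * _) (L * d * _) (eta * _ * _) => u v w; rewrite !ler_norml; lra.
Qed.

End Quadrature.

(** * The two-stage scheme *)

Section Scheme.
Context {R : realType}.
Variable Y : forall l : nat, 'I_(2 * l + 1) -> S2 R -> R.
Hypothesis hY : harmonic_orthonormal_system Y.
Variables (D : set nat) (node : forall m : nat, 'I_m -> S2 R)
  (weight : forall m : nat, 'I_m -> R) (C : R).
Hypothesis hquad : quadrature_family D node weight C.
Variables (h : R -> R) (K : S2 R * S2 R -> R).
Hypothesis hK : continuous K.
Hypothesis kL2 : forall x, sL2 (kern h x).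
Hypothesis kB : exists2 B, 0 < B & forall x, L2norm (kern h x) <= B.
Hypothesis kC : forall (x : S2 R) (e : R), 0 < e ->
  \forall x' \near x, L2norm (fun y => kern h x y - kern h x' y) <= e.

Local Notation bq := (bquad Y node weight).

Lemma op_bquad m n phi x : op h K (bq m n) phi x =
  \sum_(j < m) Wfun Y node weight h n j x * K (x, node j) * phi (node j).
Proof.
apply: eq_bigr => j _; rewrite /Wfun.
rewrite (@sum_deg_index R n (fun l k => surf_int (fun y => h (Defs.edist x y) * Y k y) * Y k (node j))).
rewrite -/(harm_proj Y n (kern h x) (node j)); ring.
Qed.

Lemma harm_proj_kern_continuous n z : continuous (fun x => harm_proj Y n (kern h x) z).
Proof.
apply: continuous_eps => x e e0.
pose q := \sum_(i : deg_index n) `|Yidx Y i z| * L2norm (Yidx Y i).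
have q0 : 0 <= q by apply: sumr_ge0 => i _; rewrite mulr_ge0// L2norm_ge0.
have q1 : 0 < q + 1 by rewrite ltr_wpDl.
apply: filterS (kC x (divr_gt0 e0 q1)) => x' le.
rewrite -(harm_projB hY)//; apply: (le_trans (ler_norm_sum _ _ _)).
apply: (@le_trans _ _ (e / (q + 1) * q)); last first.
  by rewrite mulrAC ler_pdivrMr// ler_pM2l// lerDl.
rewrite mulr_sumr; apply: ler_sum => i _.
rewrite normrM mulrCA mulrC ler_wpM2l//.
apply: (le_trans (cauchy_schwarz (sL2B (kL2 x) (kL2 x')) (sL2_Yidx hY i))).
by rewrite ler_wpM2r// L2norm_ge0.
Qed.

Lemma Wfun_continuous m n (j : 'I_m) : continuous (Wfun Y node weight h n j).
Proof.
have -> : Wfun Y node weight h n j =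
    fun x => weight j * harm_proj Y n (kern h x) (node j).
  apply/funext => x; rewrite /Wfun.
  by rewrite (@sum_deg_index R n (fun l k => surf_int (fun y => h (Defs.edist x y) * Y k y) * Y k (node j))).
by apply: continuous_scale; exact: harm_proj_kern_continuous.
Qed.

Definition nystrom m n (c : 'I_m -> R) (t : S2 R) : R :=
  \sum_(j < m) Wfun Y node weight h n j t * K (t, node j) * c j.

Lemma nystrom_continuous m n (c : 'I_m -> R) : continuous (nystrom n c).
Proof.
apply: continuous_sum => j _.
have cKj : continuous (fun t => K (t, node j)).
  move=> t; apply: (@continuous_comp _ _ _ (fun t => (t, node j)) K); last exact: hK.
  have cid : {for t, continuous (fun y : S2 R => y)} by exact: cvg_id.
  exact: (cvg_pair cid (cvg_cst _)).
have cWK := continuous_mul (@Wfun_continuous m n j) cKj.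
have cj : continuous (fun _ : S2 R => c j) by exact: continuous_cst.
exact: (continuous_mul cWK cj).
Qed.

(* The lower bound makes the linear system injective, hence invertible. *)
Lemma scheme_solvable m n (B : R) (f : S2 R -> R) : continuous f ->
  (forall phi, continuous phi ->
    supnorm phi <= B * supnorm (fun x => phi x - op h K (bq m n) phi x)) ->
  exists phig, [/\ scheme_output Y node weight h K m n f phig, continuous phig &
    forall x, phig x - op h K (bq m n) phig x = f x].
Proof.
move=> cf low.
pose A : 'M[R]_m := \matrix_(i, j) ((i == j)%:R - Wfun Y node weight h n j (node i) * K (node i, node j)).
have AE (c : 'I_m -> R) i : \sum_j A i j * c j = c i - nystrom n c (node i).
  under eq_bigr do rewrite mxE mulrBl.
  rewrite sumrB (bigD1 i)//= eqxx mul1r big1 ?addr0// => j ji.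
  by rewrite eq_sym (negbTE ji) mul0r.
(* A solution of the homogeneous system consists of the nodal values of [nystrom n c], which is then
   a continuous fixed point of the discrete operator and vanishes by the lower bound. *)
have inj (c : 'I_m -> R) : (forall i, c i = nystrom n c (node i)) -> forall i, c i = 0.
  move=> cE i; have cpsi := @nystrom_continuous m n c.
  have := low _ cpsi.
  have -> : (fun x => nystrom n c x - op h K (bq m n) (nystrom n c) x) = (fun=> 0).
    apply/funext => x; rewrite op_bquad; apply/eqP; rewrite subr_eq0; apply/eqP.
    by apply: eq_bigr => j _; rewrite -cE.
  have -> : supnorm (fun _ : S2 R => 0 : R) = 0.
    apply/eqP; rewrite eq_le supnorm_ge0 ?andbT; last exact: continuous_cst.
    by apply: supnorm_le => x; rewrite normr0.
  rewrite mulr0 => le0; apply/eqP; rewrite -normr_le0 cE.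
  by apply: le_trans le0; exact: supnorm_ub.
have uA : A \in unitmx.
  rewrite -unitmx_tr -row_free_unit -kermx_eq0; apply/rowV0P => v /sub_kermxP vA.
  apply/rowP => i; rewrite mxE; apply: (inj (fun j => v 0 j)) => k.
  apply/eqP; rewrite -subr_eq0 -AE; apply/eqP.
  transitivity ((v *m A^T) 0 k); last by rewrite vA mxE.
  by rewrite [RHS]mxE; apply: eq_bigr => j _; rewrite [A^T _ _]mxE mulrC.
pose c (i : 'I_m) : R := (invmx A *m \col_i f (node i)) i 0.
have cE i : c i - nystrom n c (node i) = f (node i).
  rewrite -AE; transitivity ((A *m (invmx A *m \col_i f (node i))) i 0).
    by rewrite [RHS]mxE.
  by rewrite mulKVmx// mxE.
pose phig t := f t + nystrom n c t.
have phigE i : phig (node i) = c i by rewrite /phig -cE subrK.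
have opE x : op h K (bq m n) phig x = nystrom n c x.
  by rewrite op_bquad; apply: eq_bigr => j _; rewrite phigE.
exists phig; split; last by move=> x; rewrite opE addrK.
- exists c; split => // c' c'E; apply/funext => i; apply/eqP; rewrite -subr_eq0; apply/eqP.
  apply: (inj (fun i => c' i - c i)) => k.
  apply/eqP; rewrite -subr_eq0; apply/eqP.
  have -> : nystrom n (fun i => c' i - c i) (node k) = nystrom n c' (node k) - nystrom n c (node k).
    by rewrite /nystrom -sumrB; apply: eq_bigr => j _; rewrite mulrBr.
  have e1 : c' k - nystrom n c' (node k) = f (node k) by exact: c'E.
  have e2 := cE k; rewrite -e2 in e1; move: e1.
  move: (nystrom _ _ _) (nystrom _ _ _) => u v; lra.
- by apply: continuous_add => //; exact: nystrom_continuous.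
Qed.

(** The joint limit n -> oo, eta -> 0 expressed by a single index, with m unrestricted; this is the
    predicate Q to which [uniform_lower_bound] is applied. *)
Definition quad_forms (k : nat) (b : (S2 R -> R) -> (S2 R -> R) -> R) : Prop :=
  exists m n eta, [/\ Gamma Y D node weight m n eta, (k <= n)%N, eta <= k.+1%:R^-1 & b = bq m n].

Lemma quad_forms_bounded k b : quad_forms k b -> bilin_bounded (Num.sqrt (2 * C)) b.
Proof. by move=> [m [n [eta [hG _ _ ->]]]]; exact: (bquad_bounded hY hquad hG). Qed.

Lemma quad_forms_cvg phi x (e : R) : continuous phi -> 0 < e ->
  exists k0, forall k b, (k0 <= k)%N -> quad_forms k b ->
    `|op h K b phi x - op h K bint phi x| <= e.
Proof.
move=> cphi e0; have cg := continuous_Kphi hK (x := x) cphi.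
set H := L2norm (kern h x); have H0 : 0 <= H by exact: L2norm_ge0.
set c := Num.sqrt (2 * C) + L2norm (fun _ : S2 R => 1).
have c0 : 0 <= c by rewrite addr_ge0 ?sqrtr_ge0.
have q1 : 0 < 2 * H * c + 1 by rewrite ltr_wpDl// !mulr_ge0.
pose d := e / (2 * H * c + 1); have d0 : 0 < d by rewrite divr_gt0.
(* The order of choices matters: chi comes first, and the bound t imposed on eta depends on its
   norm. The two parts of the error are then below e / 2 each. *)
have [N [chi [Pchi gchi]]] := Pspace_dense hY cg d0.
set X := L2norm chi; have X0 : 0 <= X by exact: L2norm_ge0.
have q2 : 0 < 2 * H * X + 1 by rewrite ltr_wpDl// !mulr_ge0.
pose t := e / (2 * H * X + 1); have t0 : 0 < t by rewrite divr_gt0.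
have [M _ MP] : \forall n \near \oo, n.+1%:R^-1 <= t.
  by near=> n; apply/ltW; near: n; exact: (near_infty_natSinv_lt (PosNum t0)).
exists (maxn N M) => k b; rewrite geq_max => /andP[Nk Mk] [m [n [eta [hG kn etak ->]]]].
have Pn := Pchi n (leq_trans Nk kn).
apply: (le_trans (bquad_error hY hquad hG cg (kL2 x) Pn gchi)).
rewrite -/H -/X -/c.
have et : eta <= t by apply: le_trans etak _; exact: MP.
have eta0 : 0 <= eta by have [_ /andP[]] := hG.
have dE : d * (2 * H * c + 1) = e by rewrite /d mulfVK// gt_eqF.
have tE : t * (2 * H * X + 1) = e by rewrite /t mulfVK// gt_eqF.
have h1 : H * (eta * X) <= H * (t * X) by rewrite ler_wpM2l// ler_wpM2r.
rewrite mulrDr; apply: (@le_trans _ _ (H * (c * d) + H * (t * X))); first by rewrite lerD2l.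
clearbody d t; nra.
Unshelve. all: by end_near. Qed.

(** Pointwise convergence becomes uniform by equicontinuity and compactness. The lower bound needs
    only the pointwise version; uniformity is for the convergence of the computed solutions. *)
Lemma quad_forms_cvg_uniform phi (e : R) : continuous phi -> 0 < e ->
  exists k0, forall k b, (k0 <= k)%N -> quad_forms k b ->
    forall x, `|op h K b phi x - op h K bint phi x| <= e.
Proof.
move=> cphi e0.
suff [k0 k0P] : exists k0, forall k b, (k0 <= k)%N -> quad_forms k b ->
    forall x, [set: S2 R] x -> `|op h K b phi x - op h K bint phi x| <= e.
  by exists k0 => k b kk Qb x; exact: (k0P k b).
apply: (compact_ind (P := fun U => exists k0, forall k b, (k0 <= k)%N -> quad_forms k b ->
    forall x, U x -> `|op h K b phi x - op h K bint phi x| <= e)) (compact_S2) _ _ _ _.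
- by exists 0%N.
- by move=> U V UV [k0 k0P]; exists k0 => k b kk Qb x /UV; exact: (k0P k b).
- move=> U V [k0 k0P] [k1 k1P]; exists (maxn k0 k1) => k b.
  by rewrite geq_max => /andP[a1 a2] Qb x [/(k0P k b a1 Qb)|/(k1P k b a2 Qb)].
- move=> x; have e3 : 0 < e / 3 by rewrite divr_gt0.
  have [M M0 pM] := continuous_bounded_compact compact_S2 cphi.
  have eM : 0 < e / 3 / M by rewrite divr_gt0.
  have equi := op_equicontinuous hK kL2 kB kC (sqrtr_ge0 (2 * C)) x eM.
  have equi' := op_equicontinuous hK kL2 kB kC (L2norm_ge0 (fun _ : S2 R => 1 : R)) x eM.
  have [k0 k0P] := quad_forms_cvg x cphi e3.
  apply: (ex_intro2 _ _ _ (filterI equi equi')).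
  exists k0 => k b kk Qb y [/= h1 h2].
  have {h1} := h1 _ (quad_forms_bounded Qb) _ _ cphi pM.
  have {h2} := h2 _ (@bint_bounded R) _ _ cphi pM.
  have := k0P k b kk Qb; rewrite mulfVK ?gt_eqF//.
  move: (op h K b phi x) (op h K b phi y) (op h K bint phi x) (op h K bint phi y) => p q r s.
  rewrite !ler_norml; lra.
Qed.

End Scheme.

(** The estimates hold with constants independent of gamma. The factor 1 + 1 / (n + 1) + eta is at
    least 1 and makes them strictly monotone in n and in eta. *)
Lemma decreasing_constant_family (R : realType) (N : nat) (eta0 B : R) : 0 < B ->
  decreasing_constant N eta0 (fun _ n eta => B * (1 + n.+1%:R^-1 + eta)).
Proof.
move=> B0; split.
- move=> m n eta _ /andP[e0 _]; rewrite mulr_gt0//.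
  by rewrite ltr_wpDr// ltr_wpDr// invr_ge0.
- move=> m n n' eta _ nn' _; rewrite ltr_pM2l// ltrD2r ltrD2l.
  by rewrite ltf_pV2 ?posrE// ltr_nat.
- by move=> m n eta eta' _ _ lt _; rewrite ltr_pM2l// ltrD2l.
Qed.

Theorem theorem3p1 (R : realType)
    (Y : forall l : nat, 'I_(2 * l + 1) -> S2 R -> R)
    (D : set nat) (node : forall m : nat, 'I_m -> S2 R)
    (weight : forall m : nat, 'I_m -> R) (C : R)
    (h : R -> R) (K : S2 R * S2 R -> R)
    (hY : harmonic_orthonormal_system Y)
    (hquad : quadrature_family D node weight C)
    (hK : continuous K)
    (hh : weakly_singular h)
    (hL1 : (@lebesgue_measure R).-integrable `]-1, 1[%classic
       (fun t => (h (Num.sqrt (2 * (1 - t))))%:E))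
    (hL2 : (@lebesgue_measure R).-integrable `]-1, 1[%classic
       (fun t => (h (Num.sqrt (2 * (1 - t))) ^+ 2)%:E))
    (htriv : forall phi : S2 R -> R, continuous phi ->
       (forall x, phi x - integral_op h K phi x = 0) -> forall x, phi x = 0) :
  exists (N : nat) (eta0 : R) (C1 C2 : nat -> nat -> R -> R),
    [/\ 0 < eta0, decreasing_constant N eta0 C1, decreasing_constant N eta0 C2 &
      forall f : S2 R -> R, continuous f ->
      exists phi : S2 R -> R,
        [/\ continuous phi /\ (forall x, phi x - integral_op h K phi x = f x),
            (forall psi : S2 R -> R, continuous psi ->
               (forall x, psi x - integral_op h K psi x = f x) -> psi = phi),
            (forall (m n : nat) (eta : R), Gamma Y D node weight m n eta ->
               (N <= n)%N -> eta <= eta0 ->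
               exists phig : S2 R -> R,
                 [/\ scheme_output Y node weight h K m n f phig,
                     continuous phig,
                     supnorm phig <= C1 m n eta * supnorm f &
                     exists x0 : S2 R,
                       let g := fun y => K (x0, y) * phi y in
                       (exists chi, best_approx Y n g chi) /\
                       forall chi, best_approx Y n g chi ->
                         supnorm (fun t => phig t - phi t) <=
                           C2 m n eta *
                           (best_error Y n g +
                            Num.sqrt (eta ^+ 2 + 4 * eta) * L2norm chi)]) &
            (forall eps : R, 0 < eps ->
               exists (N' : nat) (delta : R), 0 < delta /\
                 forall (m n : nat) (eta : R), Gamma Y D node weight m n eta ->
                   (N' <= n)%N -> eta <= delta ->
                   exists phig : S2 R -> R,
                     scheme_output Y node weight h K m n f phig /\
                     supnorm (fun t => phig t - phi t) < eps)]].

Proof.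
have [hc _] := hh.
have hc' x y : x <> y ->
    {for (x, y), continuous (fun p : S2 R * S2 R => h (Defs.edist p.1 p.2))} := hc x y.
have kL2 := sL2_kern hc' hL1 hL2.
have kB := L2norm_kern_bounded hc' hL1 hL2.
have kC := L2norm_kern_continuous hc' hL1 hL2.
have injA (phi : S2 R -> R) : continuous phi ->
    (forall x, phi x - op h K bint phi x = 0) -> forall x, phi x = 0.
  by move=> cp H; apply: htriv => // x; rewrite -op_bint.
pose c := Num.sqrt (2 * C); have c0 : 0 <= c by exact: sqrtr_ge0.
have [N [B [B0 low]]] := uniform_lower_bound hK kL2 kB kC injA c0
  (fun k b => @quad_forms_bounded R Y hY D node weight C hquad k b)
  (fun phi x e => @quad_forms_cvg R Y hY D node weight C hquad h K hK kL2 phi x e).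
have [Hb Hb0 HH] := kB.
pose L := L2norm (fun _ : S2 R => 1 : R); have L0 : 0 <= L by exact: L2norm_ge0.
(* Hb bounds |H_x|_2, c + L is the coefficient of the approximation error in [bquad_error], and 1 is
   that of eta |chi|_2. *)
pose E := Hb * (c + L + 1).
have E0 : 0 < E by rewrite mulr_gt0// ltr_wpDl// addr_ge0.
have N0 : 0 < N.+1%:R^-1 :> R by rewrite invr_gt0.
(* For n >= N and eta <= 1 / (N + 1) the discrete form belongs to stage N of [quad_forms], where the
   lower bound [low] is available. *)
exists N, N.+1%:R^-1, (fun _ n eta => B * (1 + n.+1%:R^-1 + eta)),
  (fun _ n eta => B * E * (1 + n.+1%:R^-1 + eta)).
split => //; [exact: decreasing_constant_family|
  by apply: decreasing_constant_family; rewrite mulr_gt0|].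
move=> f cf; have [phi cphi phiE] := fredholm hK kL2 kB kC injA cf.
have c10 : 0 <= L2norm (fun _ : S2 R => 1 : R) by exact: L2norm_ge0.
(* [phig - phi] is mapped by [I - A_gamma] to [(A_gamma - A) phi]. *)
have solve m n eta : Gamma Y D node weight m n eta -> (N <= n)%N -> eta <= N.+1%:R^-1 ->
    exists phig, [/\ scheme_output Y node weight h K m n f phig, continuous phig,
      supnorm phig <= B * supnorm f &
      supnorm (fun t => phig t - phi t) <=
        B * supnorm (fun t => op h K (bquad Y node weight m n) phi t - op h K bint phi t)].
  move=> hG Nn etaN; have Qb : quad_forms Y D node weight N (bquad Y node weight m n).
    by exists m, n, eta.
  have lowb phi' (cp : continuous phi') := low N _ phi' (leqnn N) Qb cp.
  have [phig [out cphig phigE]] := scheme_solvable hY hK kL2 kC cf lowb.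
  exists phig; split => //.
    by apply: (le_trans (lowb _ cphig)); rewrite (_ : (fun x => _) = f)//; exact/funext.
  apply: (le_trans (lowb _ (continuous_sub cphig cphi))).
  rewrite ler_pM2l// le_eqVlt; apply/orP; left; apply/eqP; congr supnorm; apply/funext => t.
  rewrite (opB hK kL2 _ (quad_forms_bounded hY hquad Qb))//.
  have := phigE t; have := phiE t.
  set b := bquad Y node weight m n.
  move: (op h K b phig t) (op h K b phi t) (op h K bint phi t) => u v w; lra.
exists phi; split.
- by split => // x; rewrite -op_bint.
- move=> psi cpsi psiE; apply/funext => x; apply/eqP; rewrite -subr_eq0; apply/eqP.
  apply: (injA (fun x => psi x - phi x)); first exact: continuous_sub.
  move=> y; rewrite (opB hK kL2 _ (@bint_bounded R))// opprB addrACA.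
  have := psiE y; have := phiE y; rewrite -op_bint.
  move: (op _ _ _ phi y) (op _ _ _ psi y) => u v; lra.
- move=> m n eta hG Nn etaN; have [phig [out cphig b1 b2]] := solve _ _ _ hG Nn etaN.
  have eta0 : 0 <= eta by have [_ /andP[]] := hG.
  have s1 : 1 <= 1 + n.+1%:R^-1 + eta by rewrite -addrA lerDl addr_ge0// invr_ge0.
  have Qb : quad_forms Y D node weight N (bquad Y node weight m n) by exists m, n, eta.
  exists phig; split => //.
    apply: (le_trans b1); rewrite -mulrA ler_pM2l//.
    by rewrite ler_peMl// supnorm_ge0.
  have cdiff : continuous (fun t => op h K (bquad Y node weight m n) phi t - op h K bint phi t).
    apply: continuous_sub; last exact: (op_continuous hK kL2 kB kC c10 (@bint_bounded R)).
    exact: (op_continuous hK kL2 kB kC c0 (quad_forms_bounded hY hquad Qb)).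
  have [x0 x0E] := supnorm_attained cdiff.
  exists x0 => g; have cg : continuous g by exact: (continuous_Kphi hK (x := x0) cphi).
  split; first exact: best_approx_exists.
  move=> chi [Pchi chiE]; apply: (le_trans b2); rewrite -!mulrA ler_pM2l// x0E.
  have cc := Pspace_continuous hY Pchi.
  have gd y : `|g y - chi y| <= best_error Y n g.
    by rewrite -chiE; exact: (supnorm_ub y (continuous_sub cg cc)).
  set d := best_error Y n g in gd *; set X := L2norm chi.
  have X0 : 0 <= X by exact: L2norm_ge0.
  have d0 : 0 <= d by exact: le_trans (gd x0).
  apply: (le_trans (bquad_error hY hquad hG cg (kL2 x0) Pchi gd)).
  set s := Num.sqrt (eta ^+ 2 + 4 * eta).
  (* The polarized estimate gives the factor eta, which is below the square root in the claim. *)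
  have es : eta <= s.
    by rewrite -[leLHS](ger0_norm eta0) -sqrtr_sqr; apply: ler_wsqrtr; rewrite lerDl mulr_ge0.
  have sX0 : 0 <= s * X by rewrite mulr_ge0// sqrtr_ge0.
  apply: (@le_trans _ _ (Hb * ((c + L) * d + s * X))).
    have t0 : 0 <= (c + L) * d + eta * X by rewrite addr_ge0// mulr_ge0// addr_ge0.
    apply: (ler_pM (L2norm_ge0 _) t0 (HH x0)); rewrite lerD2l ler_wpM2r//.
  apply: (@le_trans _ _ (E * (d + s * X))); last first.
    by rewrite [leRHS]mulrA -/E ler_pM2l// ler_peMl// addr_ge0.
  rewrite /E -mulrA ler_pM2l//.
  have -> : (c + L + 1) * (d + s * X) = (c + L) * d + s * X + (d + (c + L) * (s * X)) by ring.
  by rewrite lerDl addr_ge0// mulr_ge0// addr_ge0.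
- move=> eps eps0; have e1 : 0 < eps / (2 * B) by rewrite divr_gt0// mulr_gt0.
  have [k0 k0P] := quad_forms_cvg_uniform hY hquad hK kL2 kB kC cphi e1.
  (* Stage N makes the scheme solvable and stable, and stage k0 makes the discrete operator accurate
     at phi; the maximum puts gamma in both. *)
  exists (maxn N k0), (maxn N k0).+1%:R^-1; split; first by rewrite invr_gt0.
  move=> m n eta hG; rewrite geq_max => /andP[Nn kn] etad.
  have le_inv k : (k <= maxn N k0)%N -> (maxn N k0).+1%:R^-1 <= k.+1%:R^-1 :> R.
    by move=> km; rewrite lef_pV2 ?posrE// ler_nat.
  have [phig [out cphig b1 b2]] := solve _ _ _ hG Nn (le_trans etad (le_inv N (leq_maxl _ _))).
  exists phig; split => //; apply: (le_lt_trans b2).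
  have Qk : quad_forms Y D node weight k0 (bquad Y node weight m n).
    by exists m, n, eta; split => //; apply: (le_trans etad); apply: le_inv; exact: leq_maxr.
  have : supnorm (fun t => op h K (bquad Y node weight m n) phi t - op h K bint phi t) <= eps / (2 * B).
    by apply: supnorm_le => x; exact: (k0P k0 _ (leqnn k0) Qk x).
  rewrite -(ler_pM2l B0) => /le_lt_trans; apply.
  have -> : B * (eps / (2 * B)) = eps / 2 by field; rewrite gt_eqF.
  lra.
Qed.
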